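(* Let $d\in\{2,3\}$, $\alpha\in(0,2)$, and let $\Omega=B_1^d(0)$ be the open unit ball of $\mathbb{R}^d$. Let $\mathcal{X}=[-1,1]^d\supset\Omega$. There exists a constant $C>0$, independent of $f,\rho,K,N,L$, such that the following holds. Let $\rho>1$ and let $f:\mathcal{X}\to\mathbb{R}$ have a bounded analytic extension (still denoted $f$) to the generalized Bernstein ellipse $B(\mathcal{X},\underline{\rho})$ with $\underline\rho=(\rho,\dots,\rho)$. Let $K\in\mathbb{N}$ and let $N\ge K$, $L\ge 2K$ be integers. Then $$\|u_{NL}-u\|_{L^2(\Omega)}\le C\,\frac{\rho^{-\lfloor K/d\rfloor}}{(\rho-1)\left(1-\frac1\rho\right)^{d-1}}\,\|f\|_{L^\infty(B(\mathcal{X},\underline\rho))}.$$ Here $u=\mathcal{L}f$ is the solution of $(-\Delta)^{\alpha/2}u=f$ in $\Omega$, $u=0$ in $\mathbb{R}^d\setminus\Omega$, and $u_{NL}=\mathcal{L}f_{NL}$, where $f_{NL}$ is the $L^2(w)$-orthogonal projection of $f|_\Omega$ onto $\mathrm{span}\{P_{l,m,n}:0\le l\le L,\ 0\le n\le N,\ 1\le m\le M_{d,l}\}$.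
   Context: The Bernstein ellipse $B([-1,1],\rho)\subset\mathbb{C}$, $\rho>1$, is the region bounded by the ellipse with foci $\pm1$ whose semi-axes sum to $\rho$. For $\underline\rho=(\rho_1,\dots,\rho_d)$, the generalized Bernstein ellipse is $B(\mathcal{X},\underline\rho)=B([-1,1],\rho_1)\times\cdots\times B([-1,1],\rho_d)\subset\mathbb{C}^d$. $w(\mathbf{x})=(1-|\mathbf{x}|^2)_+^{\alpha/2}$, and $L^2(w)$ is the weighted space on $\Omega$ with $\|f\|_{L^2(w)}^2=\int_\Omega|f|^2w\,d\mathbf{x}$. The integral fractional Laplacian of $u:\mathbb{R}^d\to\mathbb{R}$ is $$(-\Delta)^{\alpha/2}u(\mathbf{x})=c_{\alpha,d}\,\mathrm{P.V.}\int_{\mathbb{R}^d}\frac{u(\mathbf{x})-u(\mathbf{y})}{|\mathbf{x}-\mathbf{y}|^{d+\alpha}}\,d\mathbf{y},\qquad c_{\alpha,d}=\frac{2^\alpha\Gamma(\frac{d+\alpha}{2})}{\pi^{d/2}|\Gamma(-\frac{\alpha}{2})|}.$$ For $l\ge 0$ let $M_{d,l}$ be the dimension of the space of homogeneous harmonic polynomials of degree $l$ in $\mathbb{R}^d$ ($M_{2,0}=1$, $M_{2,l}=2$ for $l\ge1$, $M_{3,l}=2l+1$), and let $V_{l,m}$, $1\le m\le M_{d,l}$, be a basis of this space whose restrictions to the unit sphere are orthonormal with respect to surface measure. For $l,n\ge 0$, $1\le m\le M_{d,l}$, set $$P_{l,m,n}(\mathbf{x})=V_{l,m}(\mathbf{x})\,P_n^{(\alpha/2,\;d/2+l-1)}(2|\mathbf{x}|^2-1),$$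 where $P_n^{(a,b)}$ is the Jacobi polynomial. The family $\{P_{l,m,n}\}$ is a complete orthogonal system of $L^2(w)$, and $(-\Delta)^{\alpha/2}(wP_{l,m,n})=d_{n,l}^{\alpha,d}P_{l,m,n}$ in $\Omega$, where $$d_{n,l}^{\alpha,d}=\frac{2^\alpha\,\Gamma(1+\frac{\alpha}{2}+n)\,\Gamma(\frac{\delta+\alpha}{2}+n)}{n!\,\Gamma(\frac{\delta}{2}+n)},\qquad \delta=d+2l.$$ The solution operator $\mathcal{L}$ acts as follows: if $f=\sum_{l,n\ge0}\sum_{m=1}^{M_{d,l}} a_{l,m,n}\,d_{n,l}^{\alpha,d}\,P_{l,m,n}$ in $L^2(w)$, then the solution is $\mathcal{L}f=w\sum_{l,n\ge0}\sum_{m=1}^{M_{d,l}}a_{l,m,n}P_{l,m,n}$ in $\Omega$ (inner series converging in $L^2(w)$), extended by $0$. Thus $f_{NL}=\sum_{l=0}^L\sum_{n=0}^N\sum_{m=1}^{M_{d,l}}a_{l,m,n}d_{n,l}^{\alpha,d}P_{l,m,n}$ and $u_{NL}=w\sum_{l=0}^L\sum_{n=0}^N\sum_{m=1}^{M_{d,l}}a_{l,m,n}P_{l,m,n}$. *)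

(* Defs.v *)
(* The notations of mpoly clash with those of MathComp-Analysis and are not
   imported: mpoly d R is the ring of polynomials over R in d variables. *)
From HB Require Import structures.
From mathcomp Require Import all_boot all_order all_algebra.
From mathcomp Require Import -(notations) mpoly.
From mathcomp Require Import all_classical all_reals all_analysis.
From mathcomp Require Import complex.
Import Order.TTheory GRing.Theory Num.Theory.
Import numFieldNormedType.Exports.

Set Implicit Arguments.
Unset Strict Implicit.
Unset Printing Implicit Defensive.

Local Open Scope classical_set_scope.
Local Open Scope ring_scope.

(* n-fold product of a sigma-finite measure, on n.-tuple T with the library's
   product sigma-algebra: at each step, the image of mu \x mu^n under
   (t, x) |-> t :: x. *)
Section tuple_measure.
Context {disp : measure_display} {T : measurableType disp} {R : realType}.
Variable mu : {sigma_finite_measure set T -> \bar R}.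
Local Open Scope ereal_scope.

Definition tuple_cons {n : nat} (p : T * n.-tuple T) : n.+1.-tuple T :=
  [tuple of p.1 :: p.2].

Lemma measurable_tuple_cons n : measurable_fun setT (@tuple_cons n).
Proof. exact: measurable_cons. Qed.

Section step.
Variables (n : nat) (m : {sigma_finite_measure set (n.-tuple T) -> \bar R}).

Definition tuple_measure_step : set (n.+1.-tuple T) -> \bar R :=
  pushforward (mu \x m) (@tuple_cons n).

Let tuple_measure_step0 : tuple_measure_step set0 = 0.
Proof. by rewrite /tuple_measure_step /pushforward preimage_set0 measure0. Qed.

Let tuple_measure_step_ge0 A : 0 <= tuple_measure_step A.
Proof. by rewrite /tuple_measure_step /pushforward; exact: measure_ge0. Qed.

Let tuple_measure_step_sigma_additive : semi_sigma_additive tuple_measure_step.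
Proof.
move=> F mF tF mUF; rewrite /tuple_measure_step /pushforward preimage_bigcup.
apply: measure_semi_sigma_additive.
- by move=> k; rewrite -[_ @^-1` _]setTI; exact: measurable_tuple_cons.
- apply/trivIsetP => /= i j _ _ ij; rewrite -preimage_setI.
  by move/trivIsetP : tF => /(_ _ _ _ _ ij) ->//; rewrite preimage_set0.
- by rewrite -preimage_bigcup -[_ @^-1` _]setTI; exact: measurable_tuple_cons.
Qed.

HB.instance Definition _ := isMeasure.Build _ _ _ tuple_measure_step
  tuple_measure_step0 tuple_measure_step_ge0 tuple_measure_step_sigma_additive.

Let tuple_measure_step_sigma_finite : sigma_finite setT tuple_measure_step.
Proof.
have /sigma_finiteP[F [TF ndF Foo]] := sigma_finiteT mu.
have /sigma_finiteP[G [TG ndG Goo]] := sigma_finiteT m.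
pose unc (x : n.+1.-tuple T) : T * n.-tuple T := (thead x, [tuple of behead x]).
have consK p : unc (tuple_cons p) = p.
  by case: p => a x; congr pair; apply/val_inj.
have munc : measurable_fun setT unc.
  apply/measurable_fun_pair; last exact: measurable_behead.
  exact: measurable_tnth.
exists (fun k => unc @^-1` (F k `*` G k)).
  apply/seteqP; split => // x _.
  have [i _ Fi] : (\bigcup_i F i) (unc x).1 by rewrite -TF.
  have [j _ Gj] : (\bigcup_i G i) (unc x).2 by rewrite -TG.
  exists (maxn i j) => //; split.
  - by move: Fi; exact/subsetPset/ndF/leq_maxl.
  - by move: Gj; exact/subsetPset/ndG/leq_maxr.
move=> k; have [mF Fk] := Foo k; have [mG Gk] := Goo k; split.
  by rewrite -[_ @^-1` _]setTI; apply: munc => //; exact: measurableX.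
rewrite /tuple_measure_step /pushforward -comp_preimage.
rewrite (_ : unc \o tuple_cons = id); last exact/funext.
by rewrite preimage_id product_measure1E// lte_mul_pinfty// ge0_fin_numE.
Qed.

HB.instance Definition _ := Measure_isSigmaFinite.Build _ _ _ tuple_measure_step
  tuple_measure_step_sigma_finite.

End step.

Fixpoint tuple_measure (n : nat) :
    {sigma_finite_measure set (n.-tuple T) -> \bar R} :=
  match n with
  | 0%N => \d_([tuple] : 0.-tuple T)
  | n'.+1 => tuple_measure_step (tuple_measure n')
  end.

End tuple_measure.

(* Points of R^d.  measurableTypeR R is R with its Borel sigma-algebra. *)
Notation euclid R d := (d.-tuple (measurableTypeR R)).

Definition coord (R : realType) (d : nat) (x : euclid R d) (i : 'I_d) : R :=
  tnth x i.

Definition lebesgue (R : realType) (d : nat) :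
    {sigma_finite_measure set (euclid R d) -> \bar R} :=
  tuple_measure (@lebesgue_measure R) d.

Section weighted_space.
Context {R : realType} {d : nat}.
Implicit Types (x : euclid R d) (D : set (euclid R d)) (g w : euclid R d -> R).

Definition sqnorm x : R := \sum_(i < d) coord x i ^+ 2.

Definition unit_ball : set (euclid R d) := [set x | sqnorm x < 1].

Definition weight (alpha : R) x : R := Num.max (1 - sqnorm x) 0 `^ (alpha / 2).

Definition normL2 D w g : \bar R :=
  ((\int[lebesgue R d]_(x in D) (`|g x| ^+ 2 * w x)%:E) `^ 2^-1)%E.

(* Integral over the unit sphere against surface measure sigma, through
   sigma(A) = d * |{x in unit_ball : x <> 0, x / |x| in A}|. *)
Definition sphere_integral g : R :=
  d%:R * \int[lebesgue R d]_(x in unit_ball)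
    g [tuple coord x i / Num.sqrt (sqnorm x) | i < d].

End weighted_space.

Section harmonic_basis.
Context {R : realType} {d : nat}.
Implicit Types (l : nat) (p : mpoly d R).

Definition peval p (x : euclid R d) : R := meval (coord x) p.

Definition laplacian p : mpoly d R :=
  \sum_(i < d) mderiv i (mderiv i p).

Definition solid_harmonic l p : Prop :=
  p \is ishomog1 l mdeg /\ laplacian p = 0.

(* Linear independence is a consequence of orthonormality, so that k is the
   dimension of the space of homogeneous harmonic polynomials of degree l. *)
Definition orthonormal_harmonic_basis l k (V : 'I_k -> mpoly d R) : Prop :=
  [/\ forall i, solid_harmonic l (V i),
      forall p, solid_harmonic l p -> exists c : 'I_k -> R,
        p = \sum_(i < k) c i *: V i
    & forall i j, sphere_integral (fun x => peval (V i) x * peval (V j) x) =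
        (i == j)%:R].

End harmonic_basis.

Section special_functions.
Context {R : realType}.
Implicit Types (a b t x : R) (n k l d : nat).

Definition gbinomial x k : R := (\prod_(i < k) (x - i%:R)) / k`!%:R.

(* Jacobi polynomial P_n^(a, b), Szego's formula (4.3.2) *)
Definition jacobi n a b t : R :=
  \sum_(s < n.+1) gbinomial (n%:R + a) (n - s) * gbinomial (n%:R + b) s *
    ((t - 1) / 2) ^+ s * ((t + 1) / 2) ^+ (n - s).

Definition Gamma x : R :=
  \int[@lebesgue_measure R]_(t in `]0, +oo[) (t `^ (x - 1) * expR (- t)).

Definition eigenvalue d (alpha : R) l n : R :=
  let delta := (d + l.*2)%:R in
  2 `^ alpha * Gamma (1 + alpha / 2 + n%:R) *
    Gamma ((delta + alpha) / 2 + n%:R) / (n`!%:R * Gamma (delta / 2 + n%:R)).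

End special_functions.

Section spectral_method.
Context {R : realType} {d : nat}.
Variables (alpha : R) (M : nat -> nat).
Variable V : forall l, 'I_(M l) -> mpoly d R.
Implicit Types (L N : nat) (f g u v : euclid R d -> R).
Implicit Types c : forall l, 'I_(M l) -> nat -> R.

Definition ball_poly l (m : 'I_(M l)) (n : nat) (x : euclid R d) : R :=
  peval (V m) x *
    jacobi n (alpha / 2) (d%:R / 2 + l%:R - 1) (2 * sqnorm x - 1).

Definition ball_poly_sum c L N (x : euclid R d) : R :=
  \sum_(l < L.+1) \sum_(n < N.+1) \sum_(m < M l) c l m n * ball_poly m n x.

(* g represents the sum in L^2(w) of the series of the c l m n * ball_poly m n,
   with rectangular partial sums; as the system is orthogonal, the order of
   summation is irrelevant. *)
Definition has_expansion c g : Prop :=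
  measurable_fun unit_ball g /\
  normL2 unit_ball (weight alpha) (g \- ball_poly_sum c LN.1 LN.2)
    @[LN --> filter_prod \oo \oo] --> 0%E.

(* u represents the solution, extended by 0, of the Dirichlet problem for the
   fractional Laplacian of order alpha with right-hand side f.  This is a
   relation since elements of L^2(w) are only defined almost everywhere. *)
Definition solution_operator f u : Prop :=
  exists (a : forall l, 'I_(M l) -> nat -> R) (v : euclid R d -> R),
    [/\ has_expansion (fun l m n => a l m n * eigenvalue d alpha l n) f,
        has_expansion a v,
        forall x, unit_ball x -> u x = weight alpha x * v x
      & forall x, ~ unit_ball x -> u x = 0].

(* g represents the L^2(w)-orthogonal projection of f onto the span of the
   ball_poly m n with l <= L and n <= N. *)
Definition spectral_projection L N f g : Prop :=
  (exists c, forall x, unit_ball x -> g x = ball_poly_sum c L N x) /\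
  forall l (m : 'I_(M l)) n, (l <= L)%N -> (n <= N)%N ->
    \int[lebesgue R d]_(x in unit_ball)
      ((f x - g x) * ball_poly m n x * weight alpha x) = 0.

End spectral_method.

Section analytic_extension.
Context {R : realType}.
Local Open Scope complex_scope.

Definition modulus (z : R[i]) : R := ComplexField.Normc.normc z.

(* Foci at 1 and -1 mean a ^+ 2 - b ^+ 2 = 1 for the semi-axes a and b;
   together with a + b = rho this gives the values below. *)
Definition bernstein_ellipse (rho : R) : set R[i] :=
  let a := (rho + rho^-1) / 2 in
  let b := (rho - rho^-1) / 2 in
  [set z | (complex.Re z / a) ^+ 2 + (complex.Im z / b) ^+ 2 < 1].

Context {d : nat}.
Implicit Types (z : d.-tuple R[i]) (F : d.-tuple R[i] -> R[i]).

Definition bernstein_polyellipse (rho : R) : set (d.-tuple R[i]) :=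
  [set z | forall i, bernstein_ellipse rho (tnth z i)].

(* F is, near z0, the sum of an absolutely convergent power series *)
Definition analytic_at F z0 : Prop :=
  exists (c : {ffun 'I_d -> nat} -> R[i]) (r S : R),
  [/\ 0 < r,
      forall n, \sum_(b : {ffun 'I_d -> 'I_n})
        modulus (c [ffun i => b i : nat]) * r ^+ (\sum_(i < d) b i) <= S
    & forall z, (forall i, modulus (tnth z i - tnth z0 i) < r) ->
        modulus (F z - \sum_(b : {ffun 'I_d -> 'I_n})
          c [ffun i => b i : nat] *
            \prod_(i < d) (tnth z i - tnth z0 i) ^+ b i)
          @[n --> \oo] --> (0 : R)].

Definition bounded_analytic_extension (rho : R) F (f : euclid R d -> R) : Prop :=
  [/\ forall z, bernstein_polyellipse rho z -> analytic_at F z,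
      exists S : R, forall z, bernstein_polyellipse rho z -> modulus (F z) <= S
    & forall x : euclid R d, (forall i, -1 <= coord x i <= 1) ->
        F [tuple (coord x i)%:C | i < d] = (f x)%:C].

Definition sup_norm (rho : R) F : R :=
  sup [set modulus (F z) | z in bernstein_polyellipse rho].

End analytic_extension.

(* Main.v *)
Require Import Defs.
From HB Require Import structures.
From mathcomp Require Import all_boot all_order all_algebra.
From mathcomp Require Import -(notations) mpoly.
From mathcomp Require Import all_classical all_reals all_analysis.
From mathcomp Require Import measurable_realfun.
From mathcomp Require Import complex.
From mathcomp Require Import ring lra zify.
Import Order.TTheory GRing.Theory Num.Theory.
Import numFieldNormedType.Exports.

Set Implicit Arguments.
Unset Strict Implicit.
Unset Printing Implicit Defensive.

Local Open Scope classical_set_scope.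
Local Open Scope ring_scope.

(** The proof compares u_NL - u with the best polynomial approximation of f.

    Stability.  The eigenvalue d_{n,l} depends only on the block (l, n), so the
    expansions are grouped into blocks: for each (l, n), a solid harmonic of degree
    l times one Jacobi polynomial in |x|^2.  Different blocks are orthogonal in
    L^2(w), and the eigenvalues stay above a constant s > 0: they are, up to the
    factor 2^alpha, products of two ratios Gamma(x + alpha/2) / Gamma(x) with
    x >= 1 ([eigenvalue_lower_bound]).  Dividing the blocks of f_NL - f by the
    eigenvalues thus gives a function v_NL - v with u_NL - u = w (v_NL - v) and
    |v_NL - v| <= (2 / s) |f_NL - f| in L^2(w) ([expansion_stable]).  Since
    w <= 1, this also bounds the unweighted norm of u_NL - u.

    Orthogonality.  The operator (1 - |x|^2) Laplacian - (alpha + 2) x.grad is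
    symmetric for the weight w, because (1 - |x|^2) w vanishes on the sphere and
    its gradient is -(alpha + 2) x w ([weighted_integral_by_parts]).  A block is an
    eigenvector of it, by the Jacobi differential equation, and the eigenvalues
    separate the indices n of blocks with the same l ([ball_operator_eigen]).
    For l <> l', the operator separates the two solid harmonics, and multiplying a
    homogeneous polynomial by |x|^2 only rescales its weighted integral
    ([ball_mpoly_orthogonal]).

    Best approximation.  A polynomial of degree at most K is a sum of terms
    |x|^(2j) h with h a solid harmonic of degree l and l + 2j <= K ([almansi]),
    and t^j is a combination of Jacobi polynomials of degree at most j.  It thus
    lies in the span of the blocks with l <= L and n <= N ([ball_sum_span]), and
    f_NL is at least as close to f as any such polynomial ([projection_best]).

    Approximation of f.  The tensor-product Chebyshev sum of degree
    n = K %/ d in each variable has total degree at most K.  In one variable,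
    cos (t - i s) maps the strip |s| < ln rho onto the ellipse and turns f into a
    periodic function whose k-th cosine coefficient decays like rho^-k.  The
    coefficients are computed by the trapezoidal rule, that is, by finite sums of
    values of f, whose error is made as small as desired by refining the grid.  The
    contour shift is likewise a finite chain of small steps, each controlled by the
    first-order Taylor expansions of the function along s and t, which are uniform
    by compactness ([strip_smooth], [discrete_cheb_approx]).  Treating the
    variables one after the other ([sample_approx]) gives [polynomial_approx], with
    the rate of the theorem up to an arbitrarily small eps. *)

(** * Modulus and exponential of complex numbers *)

Section complex_modulus.
Context {R : realType}.
Local Open Scope complex_scope.
Implicit Types (z w : R[i]) (x y : R).

Lemma complex_ext z w : complex.Re z = complex.Re w ->
  complex.Im z = complex.Im w -> z = w.
Proof. by case: z w => [a b] [c e] /= -> ->. Qed.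

Lemma modulus_ge0 z : 0 <= modulus z.
Proof. by case: z => a b; exact: sqrtr_ge0. Qed.

Lemma modulusM z w : modulus (z * w) = modulus z * modulus w.
Proof. exact: ComplexField.Normc.normcM. Qed.

Lemma modulusD z w : modulus (z + w) <= modulus z + modulus w.
Proof. exact: le_normcD. Qed.

Lemma modulusN z : modulus (- z) = modulus z.
Proof. exact: normcN. Qed.

Lemma modulusB z w : modulus (z - w) <= modulus z + modulus w.
Proof. by rewrite -(modulusN w) modulusD. Qed.

Lemma modulus0 : modulus (0 : R[i]) = 0.
Proof. exact: ComplexField.Normc.normc0. Qed.

Lemma modulus0_eq z : modulus z = 0 -> z = 0.
Proof. exact: ComplexField.Normc.eq0_normc. Qed.

Lemma modulus1 : modulus (1 : R[i]) = 1.
Proof. exact: ComplexField.Normc.normc1. Qed.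

Lemma modulus_real x : modulus x%:C = `|x|.
Proof. by rewrite /modulus /= expr0n addr0 sqrtr_sqr. Qed.

Lemma realcM x y : (x * y)%:C = x%:C * y%:C.
Proof. by apply: complex_ext => /=; ring. Qed.

Lemma realcD x y : (x + y)%:C = x%:C + y%:C.
Proof. by apply: complex_ext => /=; ring. Qed.

Lemma modulus_i : modulus ('i : R[i]) = 1.
Proof. by rewrite /modulus /= expr0n add0r expr1n sqrtr1. Qed.

Lemma modulusX z n : modulus (z ^+ n) = modulus z ^+ n.
Proof. by elim: n => [|n IH]; rewrite ?expr0 ?modulus1// !exprS modulusM IH. Qed.

Lemma modulus_sum I (r : seq I) (P : pred I) (F : I -> R[i]) :
  modulus (\sum_(i <- r | P i) F i) <= \sum_(i <- r | P i) modulus (F i).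
Proof.
elim/big_rec2: _ => [|i y z _ ih]; first by rewrite modulus0.
by rewrite (le_trans (modulusD _ _))// lerD2l.
Qed.

Lemma modulus_prod I (r : seq I) (P : pred I) (F : I -> R[i]) :
  modulus (\prod_(i <- r | P i) F i) = \prod_(i <- r | P i) modulus (F i).
Proof. by apply: big_morph; [exact: modulusM|exact: modulus1]. Qed.

Lemma le_Re_modulus z : `|complex.Re z| <= modulus z.
Proof.
by case: z => a b /=; rewrite -sqrtr_sqr ler_wsqrtr// lerDl sqr_ge0.
Qed.

Lemma le_Im_modulus z : `|complex.Im z| <= modulus z.
Proof.
by case: z => a b /=; rewrite -sqrtr_sqr ler_wsqrtr// lerDr sqr_ge0.
Qed.

Lemma modulus_le z : modulus z <= `|complex.Re z| + `|complex.Im z|.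
Proof.
case: z => a b; have -> : a +i* b = a%:C + 'i * b%:C.
  by simpc.
by rewrite (le_trans (modulusD _ _))// modulusM modulus_i mul1r !modulus_real; simpc.
Qed.

Lemma distm_triangle z (y : R[i]) w : modulus (z - w) <= modulus (z - y) + modulus (y - w).
Proof. by rewrite (_ : z - w = (z - y) + (y - w)) ?modulusD//; ring. Qed.

End complex_modulus.

Section cis.
Context {R : realType}.
Local Open Scope complex_scope.
Implicit Types x y e h : R.

Definition cis x : R[i] := cos x +i* sin x.

Lemma cis0 : cis 0 = 1.
Proof. by rewrite /cis cos0 sin0. Qed.

Lemma cisD x y : cis (x + y) = cis x * cis y.
Proof.
by rewrite /cis cosD sinD; simpc; congr Complex; ring.
Qed.

Lemma cisMn x n : cis (x *+ n) = cis x ^+ n.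
Proof. by elim: n => [|n IH]; rewrite ?cis0// mulrS exprS cisD IH. Qed.

Lemma modulus_cis x : modulus (cis x) = 1.
Proof. by rewrite /cis /modulus /= cos2Dsin2 sqrtr1. Qed.

Lemma cisDcisN x : cis x + cis (- x) = 2 * (cos x)%:C.
Proof. by rewrite /cis cosN sinN; simpc; congr Complex; ring. Qed.

Lemma cisMcisN x : cis x * cis (- x) = 1.
Proof. by rewrite -cisD subrr cis0. Qed.

Lemma cis2pi : cis (pi *+ 2) = 1.
Proof. by rewrite /cis cos2pi sin2pi. Qed.

Lemma cis2pi_nat k : cis (k%:R * (pi *+ 2)) = 1.
Proof. by rewrite mulr_natl cisMn cis2pi expr1n. Qed.

Lemma sin_lip x : `|sin x| <= `|x|.
Proof.
wlog x0 : x / 0 < x.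
  move=> H; have [x0|x0|<-] := ltgtP 0 x; first exact: H.
    by rewrite -normrN -sinN -(normrN x) H// oppr_gt0.
  by rewrite sin0.
have [|c _] := @MVT R sin cos 0 x x0.
  by apply: continuous_subspaceT => y; exact: continuous_sin.
by rewrite sin0 !subr0 => ->; rewrite normrM ler_piMl// cos_max.
Qed.

Lemma cos_ge x : 1 - x ^+ 2 / 2 <= cos x.
Proof.
have -> : x = (x / 2) *+ 2 by lra.
rewrite cos_mulr2n.
have : `|sin (x / 2)| ^+ 2 <= `|x / 2| ^+ 2.
  by rewrite lerXn2r ?nnegrE ?sin_lip.
rewrite !real_normK ?num_real// => H; rewrite cos2sin2.
move: H; set u := sin _; set v := x / 2 => H; lra.
Qed.

Lemma sin_taylor e : `|e| <= 1 -> `|sin e - e| <= e ^+ 2 / 2.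
Proof.
wlog e0 : e / 0 < e.
  move=> H; have [e0|e0|<-] := ltgtP 0 e; first exact: H.
    have -> : sin e - e = - (sin (- e) - (- e)) by rewrite sinN; ring.
    by move=> e1; rewrite normrN -(sqrrN e) H ?normrN ?oppr_gt0.
  by rewrite sin0 subrr normr0 expr0n mul0r.
move=> e1; have [|c] := @MVT R (fun x => sin x - x) (fun x => cos x - 1) 0 e e0.
  apply: continuous_subspaceT => y.
  by apply: cvgB; [exact: continuous_sin|exact: cvg_id].
rewrite in_itv/= => /andP[c0 ce]; rewrite sin0 !subr0 => ->.
rewrite normrM (gtr0_norm e0) ler0_norm ?subr_le0 ?cos_le1//.
have Hd := cos_ge c.
rewrite gtr0_norm// in e1.
have : c ^+ 2 <= e by rewrite (le_trans _ (ltW ce))// expr2 ler_piMl// ltW// (lt_le_trans ce).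
by nra.
Qed.

Lemma cos_lip x y : `|cos x - cos y| <= `|x - y|.
Proof.
wlog xy : x y / y < x.
  move=> H; have [xy|xy|->] := ltgtP x y; last by rewrite !subrr.
    by rewrite distrC [leRHS]distrC H.
  exact: H.
have [|c _ ->] := @MVT R cos (fun x => - sin x) y x xy.
  by apply: continuous_subspaceT => z; exact: continuous_cos.
by rewrite normrM normrN ler_piMl// sin_max.
Qed.

(** The constant is crude but uniform up to the frequency cut-off of a grid. *)
Lemma cos_le_pi x : 0 <= x <= pi -> x ^+ 2 / 32 <= 1 - cos x.
Proof.
move=> /andP[x0 xpi]; have pi4 : pi < 4 :> R by have := pihalf_lt2 R; lra.
set z := x / 4; have -> : x = z *+ 2 *+ 2 by rewrite /z; lra.
have z0 : 0 <= z by rewrite /z; lra.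
have z1 : z <= 1 by rewrite /z; lra.
have Hs : `|sin z - z| <= z ^+ 2 / 2 by apply: sin_taylor; rewrite ger0_norm.
have Hc := cos_ge z.
rewrite cos_mulr2n (cos2sin2 (z *+ 2)) sin_mulr2n.
have s0 : z / 2 <= sin z by move: Hs; rewrite ler_norml => /andP[Hs _]; nra.
have c0 : 1 / 2 <= cos z by nra.
have p0 : z / 4 <= cos z * sin z by nra.
by move: p0; set p := cos z * sin z => p0; nra.
Qed.

Lemma cis_taylor e : `|e| <= 1 ->
  modulus (cis e - 1 - 'i * e%:C) <= e ^+ 2.
Proof.
move=> e1; rewrite (le_trans (modulus_le _))//.
have -> : cis e - 1 - 'i * e%:C = (cos e - 1) +i* (sin e - e).
  by apply: complex_ext => /=; ring.
rewrite /=; have Hc := cos_ge e; have Hc1 := cos_le1 e.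
have Hs := sin_taylor e1.
by rewrite ler0_norm ?subr_le0//; lra.
Qed.

(** The upper bound comes from exp(h) (1 - h) <= exp(h) exp(-h) = 1. *)
Lemma expR_taylor h : `|h| <= 1/2 -> `|expR h - 1 - h| <= 2 * h ^+ 2.
Proof.
move=> h1; have /andP[hl hu] : -(1/2) <= h <= 1/2 by rewrite -ler_norml.
have H1 := expR_ge1Dx h; have H2 := expR_ge1Dx (- h).
rewrite ger0_norm; last by lra.
have H3 := expRxMexpNx_1 h.
have : expR h * (1 - h) <= 1 by rewrite -[leRHS]H3 ler_wpM2l ?expR_ge0.
have := expR_gt0 h; move: H1; set u := expR h => H1 H4 H5.
have h0 : 0 < 1 - h by lra.
rewrite -(ler_pM2r h0).
have : h ^+ 2 <= 2 * h ^+ 2 * (1 - h) by have := sqr_ge0 h; nra.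
by lra.
Qed.

End cis.

(** * Discrete Fourier coefficients and the shift of the contour *)

Section periodic_strip.
Context {R : realType}.
Local Open Scope complex_scope.
Implicit Types (G : R -> R -> R[i]) (s t h e sigma M A delta : R).

(** G is a function of s + i t on the strip |s| <= sigma.  Of its holomorphy only
    the first-order Taylor expansions along s and t are recorded: their common
    derivative D is the Cauchy-Riemann equation, and A and delta make them uniform.
    The parity in t at s = 0 is that of a function of cos t. *)
Definition smooth_strip sigma M A delta G : Prop :=
  [/\ forall s t, `|s| <= sigma -> modulus (G s t) <= M,
      forall s t, G s (t + pi *+ 2) = G s t,
      forall t, G 0 (- t) = G 0 t
    & forall s t, `|s| <= sigma -> exists D : R[i],
        (forall h, `|h| <= delta -> `|s + h| <= sigma ->
           modulus (G (s + h) t - G s t - h%:C * D) <= A * h ^+ 2) /\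
        (forall e, `|e| <= delta ->
           modulus (G s (t + e) - G s t - 'i * e%:C * D) <= A * e ^+ 2)].

Section mean.
Variable N : nat.
Hypothesis N0 : (0 < N)%N.

Definition mesh : R := pi *+ 2 / N%:R.
Definition node (j : nat) : R := j%:R * mesh.
Definition mean (f : nat -> R[i]) : R[i] := \sum_(j < N) N%:R^-1 * f j.

Let NR0 : (N%:R : R) != 0. Proof. by rewrite pnatr_eq0 -lt0n. Qed.

Lemma mesh_gt0 : 0 < mesh.
Proof. by rewrite divr_gt0 ?ltr0n// mulrn_wgt0// pi_gt0. Qed.

Lemma node0 : node 0 = 0. Proof. by rewrite /node mul0r. Qed.

Lemma nodeN : node N = pi *+ 2.
Proof. by rewrite /node /mesh mulrC divfK. Qed.

Lemma nodeS j : node j.+1 = node j + mesh.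
Proof. by rewrite /node -natr1 mulrDl mul1r. Qed.

Lemma modulus_nat n : modulus (n%:R : R[i]) = n%:R.
Proof. by rewrite -(rmorph_nat (real_complex R)) modulus_real normr_nat. Qed.

Lemma modulus_natV n : modulus (n%:R^-1 : R[i]) = n%:R^-1.
Proof.
by rewrite -(rmorph_nat (real_complex R)) -fmorphV modulus_real ger0_norm// invr_ge0 ler0n.
Qed.

Lemma mean_le B f : (forall j, modulus (f j) <= B) -> modulus (mean f) <= B.
Proof.
move=> fB; rewrite (le_trans (modulus_sum _ _ _))//.
rewrite (@le_trans _ _ (\sum_(j < N) N%:R^-1 * B))//.
  by apply: ler_sum => j _; rewrite modulusM modulus_natV ler_wpM2l// invr_ge0.
by rewrite sumr_const card_ord -mulrnAl -[_^-1 *+ _]mulr_natr mulVf// mul1r.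
Qed.

(** Discrete substitute for the integration by parts of a periodic function. *)
Lemma mean_shift f : f N = f 0%N -> mean (fun j => f j.+1) = mean f.
Proof.
move=> fN; apply/eqP; rewrite -subr_eq0 /mean -sumrB; apply/eqP.
rewrite -(big_mkord xpredT (fun j => N%:R^-1 * f j.+1 - N%:R^-1 * f j)).
by rewrite (telescope_sumr (fun j => N%:R^-1 * f j))// fN subrr.
Qed.

Lemma meanD f g : mean (fun j => f j + g j) = mean f + mean g.
Proof. by rewrite /mean -big_split; apply: eq_bigr => j _; rewrite mulrDr. Qed.

Lemma meanZ c f : mean (fun j => c * f j) = c * mean f.
Proof. by rewrite /mean mulr_sumr; apply: eq_bigr => j _; rewrite mulrCA. Qed.

Lemma meanB f g : mean (fun j => f j - g j) = mean f - mean g.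
Proof. by rewrite /mean -sumrB; apply: eq_bigr => j _; rewrite mulrBr. Qed.

Section shift_of_the_line.
Variables (sigma M A delta : R) (G : R -> R -> R[i]).
Hypothesis sG : smooth_strip sigma M A delta G.
Hypothesis delta_gt0 : 0 < delta.
Hypothesis mesh_delta : mesh <= delta.
Variable kap : R.
Hypothesis kap_per : cis (kap * (pi *+ 2)) = 1.
Hypothesis kap_mesh : `|kap * mesh| <= 1.

Definition fourier s := mean (fun j => G s (node j) * cis (- (kap * node j))).

Lemma fourier_le s : `|s| <= sigma -> modulus (fourier s) <= M.
Proof.
case: sG => HM _ _ _ hs; apply: mean_le => j.
by rewrite modulusM modulus_cis mulr1 HM.
Qed.

(** For holomorphic G, the Fourier coefficient E of frequency kap on the line s
    solves E' = kap E.  On the grid this holds up to an error of the order of the mesh: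
    the derivative along t is traded for that along s, and the difference quotient
    along t is moved to the exponential by shifting the nodes. *)
Lemma fourier_diff s h : `|s| <= sigma -> `|h| <= delta -> `|s + h| <= sigma ->
  modulus (fourier (s + h) - (1 + (h * kap)%:C) * fourier s) <=
    A * h ^+ 2 + `|h| * mesh * (A + kap ^+ 2 * M).
Proof.
case: (sG) => HM Hper _ HD hs hd hsh.
have : forall j, exists D : R[i],
    modulus (G (s + h) (node j) - G s (node j) - h%:C * D) <= A * h ^+ 2 /\
    modulus (G s (node j + mesh) - G s (node j) - 'i * mesh%:C * D) <=
      A * mesh ^+ 2.
  move=> j; have [D [H1 H2]] := HD s (node j) hs.
  exists D; split; first exact: H1.
  by apply: H2; rewrite gtr0_norm// mesh_gt0.
move=> /choice[D HDj].
pose m := mean (fun j => D j * cis (- (kap * node j))).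
have Ha : modulus (fourier (s + h) - fourier s - h%:C * m) <= A * h ^+ 2.
  rewrite -meanB -meanZ -meanB.
  rewrite (_ : mean _ = mean (fun j => (G (s + h) (node j) - G s (node j) -
     h%:C * D j) * cis (- (kap * node j)))); last first.
    by congr mean; apply/funext => j; ring.
  by apply: mean_le => j; rewrite modulusM modulus_cis mulr1; case: (HDj j).
have Hb : modulus ((cis (kap * mesh) - 1) * fourier s - 'i * mesh%:C * m) <=
    A * mesh ^+ 2.
  rewrite (_ : _ - _ = mean (fun j => (G s (node j + mesh) - G s (node j) -
     'i * mesh%:C * D j) * cis (- (kap * node j)))); last first.
    transitivity (mean (fun j => cis (kap * mesh) *
        (G s (node j.+1) * cis (- (kap * node j.+1)))) - fourier s -
        'i * mesh%:C * m).
      rewrite meanZ (@mean_shift (fun j => G s (node j) * cis (- (kap * node j)))).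
        by rewrite -/(fourier s); ring.
      rewrite nodeN node0 mulr0 oppr0 -[pi *+ 2]add0r Hper add0r.
      by rewrite -[cis (- _)]mul1r -[in LHS]kap_per cisMcisN cis0.
    rewrite -meanB -meanZ -meanB; congr mean; apply/funext => j.
    rewrite nodeS; set g := G s (node j + mesh).
    have -> : cis (- (kap * node j)) =
        cis (kap * mesh) * cis (- (kap * (node j + mesh))).
      by rewrite -cisD; congr cis; ring.
    move: (cis (kap * mesh)) (cis (- (kap * (node j + mesh)))) => c1 c2.
    by ring.
  by apply: mean_le => j; rewrite modulusM modulus_cis mulr1; case: (HDj j).
clearbody m.
have Hc : modulus (kap%:C * fourier s - m) <= (A + kap ^+ 2 * M) * mesh.
  have m0 := mesh_gt0.
  rewrite -(ler_pM2l m0).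
  have -> : mesh * modulus (kap%:C * fourier s - m) =
      modulus ('i * mesh%:C * (kap%:C * fourier s - m)).
    by rewrite !modulusM modulus_i mul1r modulus_real gtr0_norm.
  have -> : 'i * mesh%:C * (kap%:C * fourier s - m) =
     ((cis (kap * mesh) - 1) * fourier s - 'i * mesh%:C * m) -
     (cis (kap * mesh) - 1 - 'i * (kap * mesh)%:C) * fourier s.
    rewrite realcM.
    by move: (cis _) => c; ring.
  rewrite (le_trans (modulusB _ _))// modulusM.
  have H1 := cis_taylor kap_mesh.
  have H2 := fourier_le hs.
  have H3 : modulus (cis (kap * mesh) - 1 - 'i * (kap * mesh)%:C) *
         modulus (fourier s) <= (kap * mesh) ^+ 2 * M.
    by rewrite ler_pM// modulus_ge0.
  rewrite (le_trans (lerD Hb H3))// le_eqVlt; apply/orP; left; apply/eqP.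
  by ring.
have -> : fourier (s + h) - (1 + (h * kap)%:C) * fourier s =
  (fourier (s + h) - fourier s - h%:C * m) - h%:C * (kap%:C * fourier s - m).
  rewrite realcM.
  by move: (fourier _) => f0; ring.
rewrite (le_trans (modulusB _ _))// lerD// modulusM modulus_real -mulrA.
by rewrite ler_wpM2l// [leRHS]mulrC.
Qed.

Lemma fourier_step s h : `|s| <= sigma -> `|h| <= delta -> `|s + h| <= sigma ->
  `|kap * h| <= 1 / 2 ->
  modulus (fourier (s + h) - (expR (kap * h))%:C * fourier s) <=
    (A + 2 * kap ^+ 2 * M) * (h ^+ 2 + `|h| * mesh).
Proof.
move=> hs hd hsh kh.
have H1 := fourier_diff hs hd hsh.
have H2 := expR_taylor kh.
have H3 := fourier_le hs.
have -> : fourier (s + h) - (expR (kap * h))%:C * fourier s =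
  (fourier (s + h) - (1 + (h * kap)%:C) * fourier s) -
  (expR (kap * h) - 1 - kap * h)%:C * fourier s.
  have -> : (expR (kap * h) - 1 - kap * h)%:C =
      (expR (kap * h))%:C - 1 - kap%:C * h%:C :> R[i].
    by apply: complex_ext => /=; ring.
  by rewrite realcM; ring.
rewrite (le_trans (modulusB _ _))// modulusM modulus_real.
have H4 : `|expR (kap * h) - 1 - kap * h| * modulus (fourier s) <=
    2 * (kap * h) ^+ 2 * M by rewrite ler_pM// modulus_ge0.
rewrite (le_trans (lerD H1 H4))//.
have hm : 0 <= `|h| * mesh by rewrite mulr_ge0// ltW// mesh_gt0.
have M0 : 0 <= M by rewrite (le_trans _ H3)// modulus_ge0.
have := mulr_ge0 (mulr_ge0 (sqr_ge0 kap) M0) hm.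
by lra.
Qed.

Section decay.
Variables (sg : R) (k : nat).
Hypothesis sgE : sg = 1 \/ sg = -1.
Hypothesis kapE : kap = sg * k%:R.
Hypothesis sigma_gt0 : 0 < sigma.
Hypothesis A_ge0 : 0 <= A.

Let sg2 : sg * sg = 1. Proof. by case: sgE => ->; lra. Qed.
Let sgN : `|sg| = 1. Proof. by case: sgE => ->; rewrite ?normrN normr1. Qed.

(** The contour is moved from s = 0 to s = sg * sigma, where the factor exp(-k sigma)
    appears; the sign sg is that of the frequency.  The errors of the Q steps of length
    eta add up to a multiple of Q * eta * mesh = sigma * mesh. *)
Lemma fourier_decay : modulus (fourier 0) <=
  M * expR (- (k%:R * sigma)) + 2 * (A + 2 * k%:R ^+ 2 * M) * sigma * mesh.
Proof.
have m0 := mesh_gt0.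
have kap2 : kap ^+ 2 = k%:R ^+ 2.
  by rewrite kapE exprMn expr2 sg2 mul1r.
pose B := A + 2 * k%:R ^+ 2 * M.
have M0 : 0 <= M.
  by rewrite (le_trans (modulus_ge0 _) (@fourier_le 0 _))// normr0 ltW.
have B0 : 0 <= B by rewrite addr_ge0// -mulrA mulr_ge0// mulr_ge0// sqr_ge0.
(* the step eta must be small against the mesh, the radius delta and 1 / k *)
pose r := Num.min mesh (Num.min delta (1 / (2 * k.+1%:R))).
have r0 : 0 < r by rewrite !lt_min m0 delta_gt0 divr_gt0// mulr_gt0.
pose Q := (Num.bound (sigma / r)).+1.
pose eta : R := sigma / Q%:R.
have Q0 : 0 < Q%:R :> R by rewrite ltr0n.
have eta0 : 0 < eta by rewrite divr_gt0.
have etar : eta <= r.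
  rewrite ler_pdivrMr// mulrC -ler_pdivrMr// ltW//.
  have sr0 : 0 <= sigma / r by rewrite divr_ge0// ltW.
  by rewrite (lt_le_trans (archi_boundP sr0))// ler_nat.
have etam : eta <= mesh by rewrite (le_trans etar)// ge_min lexx.
have etad : eta <= delta by rewrite (le_trans etar)// !ge_min lexx orbT.
have etak : k%:R * eta <= 1 / 2.
  have : eta <= 1 / (2 * k.+1%:R) by rewrite (le_trans etar)// !ge_min lexx !orbT.
  rewrite ler_pdivlMr ?mulr_gt0// -[k.+1%:R]natr1 => H.
  by have := eta0; lra.
have eta_sum : Q%:R * eta = sigma by rewrite /eta mulrC divfK// gt_eqF.
pose y q : R[i] := (expR (- (k%:R * (q%:R * eta))))%:C * fourier (sg * (q%:R * eta)).
have inside q : (q <= Q)%N -> `|sg * (q%:R * eta)| <= sigma.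
  move=> qQ; have qe : 0 <= q%:R * eta by rewrite mulr_ge0// ltW.
  rewrite normrM sgN mul1r ger0_norm//.
  by rewrite -eta_sum ler_wpM2r// ?ler_nat// ltW.
have ystep q : (q < Q)%N -> modulus (y q.+1 - y q) <= 2 * B * eta * mesh.
  move=> qQ; pose s := sg * (q%:R * eta).
  have -> : y q.+1 - y q = (expR (- (k%:R * (q.+1%:R * eta))))%:C *
      (fourier (s + sg * eta) - (expR (kap * (sg * eta)))%:C * fourier s).
    rewrite mulrBr [_%:C * (_%:C * _)]mulrA -realcM -expRD /y.
    congr (_ * _ - _%:C * _).
      by congr fourier; rewrite /s -[q.+1%:R]natr1; ring.
    congr expR; rewrite kapE -[q.+1%:R]natr1.
    have -> : sg * k%:R * (sg * eta) = sg * sg * (k%:R * eta) by ring.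
    by rewrite sg2; ring.
  rewrite modulusM modulus_real ger0_norm ?expR_ge0//.
  rewrite (@le_trans _ _ (1 * (B * (eta ^+ 2 + eta * mesh))))//.
    apply: ler_pM; rewrite ?expR_ge0 ?modulus_ge0//.
      by rewrite expR_le1 oppr_le0 !mulr_ge0// ltW.
    have E1 : (sg * eta) ^+ 2 = eta ^+ 2 by rewrite exprMn expr2 sg2 mul1r.
    have E2 : `|sg * eta| = eta by rewrite normrM sgN mul1r gtr0_norm.
    have := @fourier_step s (sg * eta); rewrite kap2 -/B E1 E2; apply => //.
    - by apply: inside; exact: ltnW.
    - rewrite (_ : s + _ = sg * (q.+1%:R * eta)) ?inside//.
      by rewrite /s -[q.+1%:R]natr1; ring.
    - rewrite kapE (_ : _ * _ = sg * sg * (k%:R * eta)); last by ring.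
      by rewrite sg2 mul1r ger0_norm// mulr_ge0// ltW.
  rewrite mul1r (_ : 2 * B * eta * mesh = B * (2 * (eta * mesh))); last by ring.
  rewrite ler_wpM2l//.
  have : eta ^+ 2 <= eta * mesh by rewrite expr2 ler_wpM2l// ltW.
  by lra.
have ysum q : (q <= Q)%N -> modulus (y q - y 0%N) <= q%:R * (2 * B * eta * mesh).
  elim: q => [|q IH] qQ; first by rewrite subrr modulus0 mul0r.
  rewrite (le_trans (distm_triangle _ (y q) _))// -[q.+1%:R]natr1 mulrDl mul1r addrC.
  by rewrite lerD ?IH ?ystep// ltnW.
have := ysum Q (leqnn _).
have -> : y 0%N = fourier 0 by rewrite /y !mul0r !mulr0 oppr0 expR0 mul1r.
have -> : Q%:R * (2 * B * eta * mesh) = 2 * B * sigma * mesh.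
  by rewrite -eta_sum; ring.
have yQ : modulus (y Q) <= M * expR (- (k%:R * sigma)).
  rewrite /y modulusM modulus_real ger0_norm ?expR_ge0// eta_sum mulrC.
  by rewrite ler_wpM2r ?expR_ge0// fourier_le// normrM sgN mul1r ger0_norm// ltW.
move=> H; have -> : fourier 0 = y Q - (y Q - fourier 0) by ring.
by rewrite (le_trans (modulusB _ _))// lerD.
Qed.

End decay.

End shift_of_the_line.

End mean.
End periodic_strip.

(** * Decay of the discrete cosine coefficients *)

Section cosine_coefficients.
Context {R : realType}.
Local Open Scope complex_scope.
Variables (sigma M A delta : R) (G : R -> R -> R[i]).
Hypothesis sG : smooth_strip sigma M A delta G.
Hypotheses (sigma_gt0 : 0 < sigma) (delta_gt0 : 0 < delta) (A_ge0 : 0 <= A).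
Variable N : nat.
Hypothesis N0 : (0 < N)%N.
Hypothesis mesh_delta : mesh N <= delta.
Notation mesh := (@mesh R N).
Notation node := (@node R N).

Definition coef k := mean N (fun j => G 0 (node j) * (cos (k%:R * node j))%:C).

Let s0 : `|0 : R| <= sigma. Proof. by rewrite normr0 ltW. Qed.

Lemma coef_le k : modulus (coef k) <= M.
Proof.
case: sG => HM _ _ _; apply: mean_le => // j.
rewrite modulusM modulus_real -[leRHS]mulr1 ler_pM ?modulus_ge0 ?HM//.
exact: cos_max.
Qed.

Lemma coef_fourier k :
  coef k = 2^-1 * (fourier N G k%:R 0 + fourier N G (- k%:R) 0).
Proof.
rewrite /fourier -meanD -meanZ; congr mean; apply/funext => j.
rewrite -mulrDr mulNr opprK [cis (- _) + _]addrC cisDcisN.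
by rewrite [RHS]mulrCA [2^-1 * _]mulrA mulVf ?mul1r// pnatr_eq0.
Qed.

Lemma coef_decay k : k%:R * mesh <= 1 ->
  modulus (coef k) <= M * expR (- (k%:R * sigma)) +
                      2 * (A + 2 * k%:R ^+ 2 * M) * sigma * mesh.
Proof.
move=> km; have m0 := mesh_gt0 (R := R) N0.
have kper : cis (k%:R * (pi *+ 2)) = 1 :> R[i] by exact: cis2pi_nat.
have kperN : cis (- k%:R * (pi *+ 2)) = 1 :> R[i].
  by rewrite -[LHS]mul1r -[in LHS]kper mulNr cisMcisN.
have kmesh : `|k%:R * mesh| <= 1 by rewrite ger0_norm// mulr_ge0// ltW.
have kmeshN : `|- k%:R * mesh| <= 1 by rewrite mulNr normrN.
have H1 := @fourier_decay R N N0 sigma M A delta G sG delta_gt0 mesh_delta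
  k%:R kper kmesh 1 k (or_introl erefl) (esym (mul1r _)) sigma_gt0 A_ge0.
have H2 := @fourier_decay R N N0 sigma M A delta G sG delta_gt0 mesh_delta
  (- k%:R) kperN kmeshN (-1) k (or_intror erefl) (esym (mulN1r _)) sigma_gt0 A_ge0.
rewrite coef_fourier modulusM modulus_natV.
have := modulusD (fourier N G k%:R 0) (fourier N G (- k%:R) 0).
by lra.
Qed.

(** Summing by parts twice moves the second difference from the cosine, where it is
    the factor 2 cos(k mesh) - 2, to G, where it is at most 2 A mesh^2.  Contrary to
    the exponential bound, this one is uniform up to the frequency cut-off of the grid. *)
Lemma coef_second_difference k : k%:R * mesh <= pi ->
  k%:R ^+ 2 * modulus (coef k) <= 32 * A.
Proof.
move=> km; have m0 := mesh_gt0 (R := R) N0.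
case: (sG) => HM Hper _ HD.
pose c j := (cos (k%:R * node j))%:C : R[i].
have cper j : c (N + j)%N = c j.
  rewrite /c /node natrD mulrDl -/(node N) nodeN// mulrDr cosD.
  have H := cis2pi_nat (R := R) k.
  move/(congr1 (@complex.Re R)) : (H) => /= ->.
  by move/(congr1 (@complex.Im R)) : (H) => /= ->; rewrite mul1r mul0r subr0.
have Gper j : G 0 (node (N + j)) = G 0 (node j).
  by rewrite /node natrD mulrDl -/(node N) nodeN// addrC; exact: Hper.
have cS1 j : c j + c j.+2 = 2 * (cos (k%:R * mesh))%:C * c j.+1.
  rewrite /c !nodeS; have -> : (2 : R[i]) = 2%:R%:C by rewrite rmorph_nat.
  rewrite -realcD -!realcM; congr (_%:C).
  have -> : k%:R * node j = k%:R * (node j + mesh) - k%:R * mesh by ring.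
  have -> : k%:R * (node j + mesh + mesh) = k%:R * (node j + mesh) + k%:R * mesh by ring.
  by rewrite cosB cosD; ring.
pose g j := G 0 (node j).
have g0 : g N = g 0%N by have := Gper 0%N; rewrite addn0.
have g1 : g N.+1 = g 1%N by have := Gper 1%N; rewrite addn1.
have c0 : c N = c 0%N by have := cper 0%N; rewrite addn0.
have c1 : c N.+1 = c 1%N by have := cper 1%N; rewrite addn1.
have sum_eq : mean N (fun j => (g j.+2 - 2 * g j.+1 + g j) * c j.+1) =
    (2 * (cos (k%:R * mesh))%:C - 2) * coef k.
  transitivity (mean N (fun j => g j.+2 * c j.+1) + mean N (fun j => g j * c j.+1)
      - 2 * mean N (fun j => g j.+1 * c j.+1)).
    by rewrite -meanZ -meanD -meanB; congr mean; apply/funext => j; ring.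
  rewrite (@mean_shift _ N (fun j => g j.+1 * c j)); last first.
    by rewrite g1 c0.
  rewrite -(@mean_shift _ N (fun j => g j * c j.+1)); last first.
    by rewrite c1 g0.
  rewrite (@mean_shift _ N (fun j => g j * c j)); last first.
    by rewrite g0 c0.
  rewrite -meanD -/(coef k) mulrBl; congr (_ - _).
  transitivity (mean N (fun j => 2 * (cos (k%:R * mesh))%:C * (g j.+1 * c j.+1))).
    by congr mean; apply/funext => j; rewrite -mulrDr cS1; ring.
  rewrite meanZ (@mean_shift _ N (fun j => g j * c j))//.
  by rewrite g0 c0.
have sum_le : modulus ((2 * (cos (k%:R * mesh))%:C - 2) * coef k) <= 2 * A * mesh ^+ 2.
  rewrite -sum_eq; apply: mean_le => // j.
  rewrite modulusM modulus_real -[leRHS]mulr1 ler_pM ?modulus_ge0 ?cos_max//.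
  have [D [_ H]] := HD 0 (node j.+1) s0.
  have H1 := H mesh; have H2 := H (- mesh).
  rewrite normrN (gtr0_norm m0) sqrrN in H1 H2.
  have -> : g j.+2 - 2 * g j.+1 + g j =
    (G 0 (node j.+1 + mesh) - G 0 (node j.+1) - 'i * mesh%:C * D) +
    (G 0 (node j.+1 + - mesh) - G 0 (node j.+1) - 'i * (- mesh)%:C * D).
    rewrite /g nodeS -/mesh (nodeS N j) addrK -nodeS.
    have -> : (- mesh)%:C = - mesh%:C :> R[i] by apply: complex_ext => /=; ring.
    by ring.
  by rewrite (le_trans (modulusD _ _))// (le_trans (lerD (H1 _) (H2 _)))//; lra.
have H3 : (k%:R * mesh) ^+ 2 / 32 <= 1 - cos (k%:R * mesh).
  by apply: cos_le_pi; rewrite km mulr_ge0// ltW.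
move: sum_le; have -> : 2 * (cos (k%:R * mesh))%:C - 2 =
    (2 * (cos (k%:R * mesh) - 1))%:C :> R[i].
  by apply: complex_ext => /=; ring.
rewrite modulusM modulus_real normrM (@ger0_norm _ 2)// ler0_norm ?subr_le0 ?cos_le1//.
rewrite opprB => H4.
have coef0 := modulus_ge0 (coef k).
have m2 : 0 < mesh ^+ 2 by rewrite exprn_gt0.
rewrite -(ler_pM2r m2).
move: H3 H4 coef0; set cc := modulus _; set x := cos _ => H3 H4 coef0.
have : (k%:R * mesh) ^+ 2 / 32 * cc <= (1 - x) * cc by rewrite ler_wpM2r.
rewrite exprMn; set m := mesh ^+ 2 in H4 *; lra.
Qed.

End cosine_coefficients.

(** * The Dirichlet kernel and discrete inversion *)

Section dirichlet.
Context {R : realType}.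
Local Open Scope complex_scope.
Implicit Types (x a t : R) (n k Q : nat).

Definition dirichlet n x : R := 1 + 2 * \sum_(k < n) cos (k.+1%:R * x).

Definition chebyshev_kernel n a t : R :=
  1 + 2 * \sum_(k < n) cos (k.+1%:R * a) * cos (k.+1%:R * t).

Lemma dirichlet_sin n x : sin (x / 2) * dirichlet n x = sin ((n%:R + 1 / 2) * x).
Proof.
elim: n => [|n IH]; first by rewrite /dirichlet big_ord0 mulr0 addr0 mulr1; congr sin; lra.
have -> : dirichlet n.+1 x = dirichlet n x + 2 * cos (n.+1%:R * x).
  by rewrite /dirichlet big_ord_recr /=; ring.
rewrite mulrDr IH -[n.+1%:R]natr1.
have -> : (n%:R + 1 / 2) * x = (n%:R + 1) * x - x / 2 by lra.
have -> : (n%:R + 1 + 1 / 2) * x = (n%:R + 1) * x + x / 2 by lra.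
by rewrite sinB sinD; ring.
Qed.

Lemma dirichlet0 n : dirichlet n 0 = n.*2.+1%:R.
Proof.
rewrite /dirichlet (eq_bigr (fun=> 1)) => [|k _]; last by rewrite mulr0 cos0.
by rewrite sumr_const card_ord -natrM addrC natr1 mul2n.
Qed.

Lemma dirichletN n x : dirichlet n (- x) = dirichlet n x.
Proof. by congr (1 + 2 * _); apply: eq_bigr => k _; rewrite mulrN cosN. Qed.

Lemma cos_nat_period k x : cos (k%:R * (x + pi *+ 2)) = cos (k%:R * x).
Proof. by rewrite mulrDr [k%:R * (pi *+ 2)]mulr_natl (periodicn (@cosD2pi R)). Qed.

Lemma dirichlet_period n x : dirichlet n (x + pi *+ 2) = dirichlet n x.
Proof. by congr (1 + 2 * _); apply: eq_bigr => k _; rewrite cos_nat_period. Qed.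

Lemma chebyshev_kernelE n a t :
  chebyshev_kernel n a t = (dirichlet n (a - t) + dirichlet n (a + t)) / 2.
Proof.
rewrite /chebyshev_kernel /dirichlet.
have -> : \sum_(k < n) cos (k.+1%:R * a) * cos (k.+1%:R * t) =
   (\sum_(k < n) cos (k.+1%:R * (a - t)) + \sum_(k < n) cos (k.+1%:R * (a + t))) / 2.
  rewrite -big_split mulr_suml; apply: eq_bigr => k _ /=.
  by rewrite mulrBr mulrDr cosB cosD; lra.
by lra.
Qed.

(** On a grid of 2 Q + 1 points the kernel of order Q vanishes at all nodes but 0,
    so that trigonometric polynomials of degree Q interpolate exactly. *)
Lemma dirichlet_node Q r : (0 < r < Q.*2.+1)%N ->
  dirichlet Q (node Q.*2.+1 r) = 0.
Proof.
move=> /andP[r0 rN]; set N := Q.*2.+1 in rN *.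
have NR : 0 < N%:R :> R by rewrite ltr0n.
have E : N%:R = 2 * Q%:R + 1 :> R by rewrite /N -natr1 -mul2n natrM.
have s0 : 0 < sin (node N r / 2 : R).
  have -> : node N r / 2 = r%:R / N%:R * pi :> R by rewrite /node /mesh -mulr_natr; field; rewrite gt_eqF.
  apply: sin_gt0_pi; rewrite mulr_gt0 ?pi_gt0 ?divr_gt0 ?ltr0n//=.
  by rewrite gtr_pMl ?pi_gt0// ltr_pdivrMr// mul1r ltr_nat.
apply: (mulfI (lt0r_neq0 s0)); rewrite mulr0 dirichlet_sin.
have -> : (Q%:R + 1 / 2) * node N r = 0 + pi *+ r :> R.
  have -> : Q%:R + 1 / 2 = N%:R / 2 :> R by rewrite E; lra.
  by rewrite /node /mesh -[pi *+ 2]mulr_natr -[pi *+ r]mulr_natr; field; rewrite gt_eqF.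
by rewrite (alternatingn (@sinDpi R)) sin0 mulr0.
Qed.

(** The Chebyshev partial sum of degree n in cos t, with coefficients given by the
    trapezoidal rule; in this form it is visibly a combination of samples of G. *)
Definition discrete_cheb Q n (G : R -> R -> R[i]) t :=
  mean Q.*2.+1 (fun j => G 0 (node Q.*2.+1 j) *
                         (chebyshev_kernel n (node Q.*2.+1 j) t)%:C).

Section inversion.
Variables (Q : nat) (G : R -> R -> R[i]).
Hypothesis Gper : forall t, G 0 (t + pi *+ 2) = G 0 t.
Hypothesis Geven : forall t, G 0 (- t) = G 0 t.
Notation N := Q.*2.+1.

Lemma dirichlet_node_diff j m : (j < N)%N -> (m < N)%N ->
  dirichlet Q (node N j - node N m) = (j == m)%:R * N%:R.
Proof.
wlog jm : j m / (m <= j)%N.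
  move=> H jN mN; have [mj|jm] := leqP m j; first exact: (H j m mj jN mN).
  by rewrite -dirichletN opprB (H m j (ltnW jm) mN jN) eq_sym.
move=> jN mN; rewrite (_ : node N j - node N m = node N (j - m)); last first.
  by rewrite /node natrB// mulrBl.
have [->|jm1] := eqVneq j m; first by rewrite subnn node0 dirichlet0 mul1r.
rewrite dirichlet_node ?mul0r// subn_gt0 ltn_neqAle eq_sym jm1 jm/=.
by rewrite (leq_ltn_trans (leq_subr _ _)).
Qed.

Lemma mean_dirichlet m : (m < N)%N ->
  mean N (fun j => G 0 (node N j) * (dirichlet Q (node N j - node N m))%:C) =
  G 0 (node N m).
Proof.
move=> mN; rewrite /mean (bigD1 (Ordinal mN))//= big1 => [|j jm].
  rewrite dirichlet_node_diff// eqxx mul1r addr0 (rmorph_nat (real_complex R)).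
  by rewrite mulrCA mulVf ?mulr1// pnatr_eq0.
rewrite dirichlet_node_diff// (_ : (nat_of_ord j == m) = false) ?mul0r ?mulr0//.
by apply/negbTE; apply: contra jm => /eqP jm; apply/eqP/val_inj.
Qed.

(** As G is even, the nodes m and N - m contribute the same value, and the two
    Dirichlet kernels of the Chebyshev kernel reproduce it once each. *)
Lemma inversion m : (m < N)%N -> discrete_cheb Q Q G (node N m) = G 0 (node N m).
Proof.
move=> mN; rewrite /discrete_cheb.
have -> : mean N (fun j => G 0 (node N j) *
    (chebyshev_kernel Q (node N j) (node N m))%:C) =
  2^-1 * (mean N (fun j => G 0 (node N j) * (dirichlet Q (node N j - node N m))%:C) +
          mean N (fun j => G 0 (node N j) * (dirichlet Q (node N j + node N m))%:C)).
  rewrite -meanD -meanZ; congr mean; apply/funext => j.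
  rewrite chebyshev_kernelE -mulrDr -realcD mulrCA; congr (_ * _).
  have -> : (2^-1 : R[i]) = (2^-1)%:C by rewrite fmorphV rmorph_nat.
  by rewrite -realcM mulrC.
rewrite mean_dirichlet//.
(* the grid is symmetric: the reflection of a node is a node *)
have [m' m'N [ED EG]] : exists2 m', (m' < N)%N &
    (forall x, dirichlet Q (x + node N m) = dirichlet Q (x - node N m')) /\
    G 0 (node N m') = G 0 (node N m).
  case: m mN => [|m] mN.
    by exists 0%N => //; split=> // x; rewrite node0 addr0 subr0.
  exists (N - m.+1)%N; first by rewrite ltn_subrL.
  have E : node N (N - m.+1) = - node N m.+1 + pi *+ 2 :> R.
    by rewrite {1}/node natrB 1?ltnW// mulrBl -!/(node N _) nodeN//; ring.
  rewrite E Gper Geven; split=> // x.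
  by rewrite -(dirichlet_period _ (x - _)); congr dirichlet; ring.
rewrite (_ : mean N (fun j => _ * (dirichlet Q (_ + _))%:C) = G 0 (node N m)).
  by rewrite -[X in _ * X]mulr2n -[X in _ * X]mulr_natl mulKf// pnatr_eq0.
by rewrite -EG -mean_dirichlet//; congr mean; apply/funext => j; rewrite ED.
Qed.

Lemma discrete_chebE n t : discrete_cheb Q n G t =
  coef G N 0 + 2 * \sum_(k < n) coef G N k.+1 * (cos (k.+1%:R * t))%:C.
Proof.
rewrite /discrete_cheb /coef.
transitivity (mean N (fun j => G 0 (node N j) +
    2 * \sum_(k < n) (cos (k.+1%:R * t))%:C *
       (G 0 (node N j) * (cos (k.+1%:R * node N j))%:C))).
  congr mean; apply/funext => j.
  rewrite realcD mulrDr mulr1; congr (_ + _).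
  rewrite realcM (rmorph_nat (real_complex R)) mulrCA; congr (_ * _).
  rewrite (rmorph_sum (real_complex R)) mulr_sumr; apply: eq_bigr => k _ /=.
  by rewrite realcM; ring.
rewrite meanD meanZ; congr (_ + 2 * _).
  by congr mean; apply/funext => j; rewrite mul0r cos0 mulr1.
rewrite {1}/mean; under eq_bigr do rewrite mulr_sumr.
rewrite exchange_big/=; apply: eq_bigr => k _.
by rewrite /mean mulr_suml; apply: eq_bigr => j _; ring.
Qed.

End inversion.
End dirichlet.

(** * Discrete Chebyshev approximation in one variable *)

Section one_variable.
Context {R : realType}.
Local Open Scope complex_scope.

Lemma mesh_cvg (r : R) : 0 < r ->
  exists Q0, forall Q, (Q0 <= Q)%N -> @mesh R Q.*2.+1 <= r.
Proof.
move=> r0; have c0 : 0 <= pi *+ 2 / r by apply: divr_ge0 (ltW r0); rewrite mulr2n addr_ge0// (pi_ge0 R).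
exists (Num.bound (pi *+ 2 / r)) => Q hQ.
have NR : 0 < (Q.*2.+1)%:R :> R by rewrite ltr0n.
rewrite /mesh ler_pdivrMr// mulrC -ler_pdivrMr// ltW//.
rewrite (lt_le_trans (archi_boundP c0))// ler_nat (leq_trans hQ)//.
by rewrite -addnn leqW// leq_addr.
Qed.

Lemma geometric_tail (x : R) n P : 0 <= x < 1 ->
  \sum_(n <= k < P) x ^+ k.+1 <= x ^+ n.+1 / (1 - x).
Proof.
move=> /andP[x0 x1]; have y0 : 0 < 1 - x by rewrite subr_gt0.
have [nP|Pn] := leqP n P; last first.
  by rewrite big_geq ?(ltnW Pn)// divr_ge0 ?exprn_ge0// ltW.
rewrite ler_pdivlMr// mulr_suml.
rewrite (eq_bigr (fun k => - x ^+ k.+2 - - x ^+ k.+1)) => [|k _]; last first.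
  by rewrite [x ^+ k.+2]exprS; ring.
rewrite (telescope_sumr (fun k => - x ^+ k.+1))// opprK.
by rewrite gerDr oppr_le0 exprn_ge0.
Qed.

Lemma inverse_square_tail P Q : (0 < P)%N ->
  \sum_(P <= k < Q) (k.+1%:R ^+ 2)^-1 <= P%:R^-1 :> R.
Proof.
move=> P0; have [PQ|QP] := leqP P Q; last first.
  by rewrite big_geq ?(ltnW QP)// invr_ge0.
rewrite (@le_trans _ _ (\sum_(P <= k < Q) (- k.+1%:R^-1 - - k%:R^-1)))//.
  rewrite [leLHS]big_nat [leRHS]big_nat; apply: ler_sum => k /andP[Pk kQ].
  have k0 : 0 < k%:R :> R by rewrite ltr0n (leq_trans P0).
  rewrite -natr1; set y := k%:R in k0 *.
  have y1 : 0 < y + 1 by rewrite addr_gt0.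
  have -> : - (y + 1)^-1 - - y^-1 = (y * (y + 1))^-1 by field; rewrite !gt_eqF.
  rewrite lef_pV2 ?posrE ?mulr_gt0 ?exprn_gt0// expr2 ler_wpM2r// ?(ltW y1)//.
  by rewrite lerDl.
rewrite (telescope_sumr (fun k => - k%:R^-1 : R))// opprK.
by rewrite gerDr oppr_le0 invr_ge0.
Qed.

Section bounds.
Variables (sigma M A delta : R) (G : R -> R -> R[i]).
Hypothesis sG : smooth_strip sigma M A delta G.
Hypotheses (sigma_gt0 : 0 < sigma) (delta_gt0 : 0 < delta) (A_ge0 : 0 <= A).
Let x : R := expR (- sigma).

Let s0 : `|0 : R| <= sigma. Proof. by rewrite normr0 ltW. Qed.
Let M0 : 0 <= M.
Proof. by case: sG => H _ _ _; exact: le_trans (modulus_ge0 _) (H 0 0 s0). Qed.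
Let x01 : 0 <= x < 1.
Proof. by rewrite expR_ge0 expR_lt1 oppr_lt0. Qed.

Lemma strip_lipschitz t e : `|e| <= delta ->
  modulus (G 0 (t + e) - G 0 t) <= `|e| * (2 * M / delta + 2 * A * delta).
Proof.
move=> ed; case: sG => HM _ _ HD; have [D [_ H]] := HD 0 t s0.
have HDle : modulus D <= 2 * M / delta + A * delta.
  have := H delta; rewrite gtr0_norm// lexx => /(_ isT) H1.
  have H2 : delta * modulus D <= 2 * M + A * delta ^+ 2.
    have -> : delta * modulus D = modulus ('i * delta%:C * D).
      by rewrite !modulusM modulus_i mul1r modulus_real gtr0_norm.
    have -> : 'i * delta%:C * D = (G 0 (t + delta) - G 0 t) -
        (G 0 (t + delta) - G 0 t - 'i * delta%:C * D) by ring.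
    rewrite (le_trans (modulusB _ _))// lerD// (le_trans (modulusB _ _))//.
    by rewrite mulr_natl mulr2n lerD// HM.
  rewrite -(ler_pM2l delta_gt0) (le_trans H2)// le_eqVlt; apply/orP; left.
  by apply/eqP; field; rewrite gt_eqF.
have -> : G 0 (t + e) - G 0 t =
    (G 0 (t + e) - G 0 t - 'i * e%:C * D) + 'i * e%:C * D by ring.
rewrite (le_trans (modulusD _ _))// !modulusM modulus_i mul1r modulus_real.
have H1 := H e ed.
have H2 : `|e| * modulus D <= `|e| * (2 * M / delta + A * delta) by rewrite ler_wpM2l.
rewrite (le_trans (lerD H1 H2))//.
have : A * e ^+ 2 <= A * (`|e| * delta).
  by rewrite ler_wpM2l// -(real_normK (num_real e)) expr2 ler_wpM2l.
by lra.
Qed.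

Section fixed_grid.
Variables n P Q : nat.
Notation N := Q.*2.+1.
Hypotheses (nP : (n <= P)%N) (P0 : (0 < P)%N) (PQ : (P <= Q)%N).
Hypotheses (mesh_delta : @mesh R N <= delta) (Pmesh : P%:R * @mesh R N <= 1).

Let m0 : 0 < @mesh R N. Proof. exact: mesh_gt0. Qed.
Let B := 2 * (A + 2 * P%:R ^+ 2 * M) * sigma * @mesh R N.
Let B0 : 0 <= B.
Proof.
have H := mulr_ge0 (sqr_ge0 (P%:R : R)) M0.
have a0 : 0 <= A + 2 * P%:R ^+ 2 * M by rewrite -mulrA addr_ge0// mulr_ge0.
by apply: mulr_ge0 (ltW m0); apply: mulr_ge0 (ltW sigma_gt0); rewrite mulr_ge0.
Qed.

Lemma coef_low k : (k < P)%N -> modulus (coef G N k.+1) <= M * x ^+ k.+1 + B.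
Proof.
move=> kP; have kmesh : k.+1%:R * @mesh R N <= 1.
  by rewrite (le_trans _ Pmesh)// ler_wpM2r ?(ltW m0)// ler_nat.
have := coef_decay sG sigma_gt0 delta_gt0 A_ge0 (ltn0Sn _) mesh_delta kmesh.
rewrite -mulrN expRM_natl -/x => /le_trans; apply.
rewrite lerD2l /B ler_wpM2r ?(ltW m0)// ler_wpM2r ?(ltW sigma_gt0)//.
have kk : k.+1%:R ^+ 2 <= P%:R ^+ 2 :> R by rewrite lerXn2r ?nnegrE// ler_nat.
by have := ler_wpM2r M0 kk; lra.
Qed.

Lemma coef_high k : (k < Q)%N ->
  modulus (coef G N k.+1) <= 32 * A * (k.+1%:R ^+ 2)^-1.
Proof.
move=> kQ; have kmesh : k.+1%:R * @mesh R N <= pi.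
  rewrite /mesh mulrA ler_pdivrMr ?ltr0n// -[pi *+ 2]mulr_natl mulrA mulrC.
  rewrite ler_wpM2l ?pi_ge0// -natrM ler_nat muln2 ltnW// ltnS leq_double//.
have := coef_second_difference sG sigma_gt0 (ltn0Sn _) mesh_delta kmesh.
by rewrite mulrC -ler_pdivlMr// exprn_gt0.
Qed.

Lemma sum_coef_low i j : (j <= P)%N ->
  \sum_(i <= k < j) modulus (coef G N k.+1) <= M * (x ^+ i.+1 / (1 - x)) + P%:R * B.
Proof.
move=> jP; rewrite (@le_trans _ _ (\sum_(i <= k < j) (M * x ^+ k.+1 + B)))//.
  rewrite [leLHS]big_nat [leRHS]big_nat; apply: ler_sum => k /andP[_ kj].
  by rewrite coef_low// (leq_trans kj).
rewrite big_split/= -mulr_sumr lerD//.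
  by rewrite ler_wpM2l// geometric_tail.
rewrite sumr_const_nat -[B *+ _]mulr_natl ler_wpM2r// ler_nat.
by rewrite (leq_trans (leq_subr _ _)).
Qed.

Lemma discrete_cheb_le t : modulus (discrete_cheb Q n G t) <=
  M * (1 + 2 * x / (1 - x)) + 2 * (P%:R * B).
Proof.
rewrite discrete_chebE (le_trans (modulusD _ _))// mulrDr mulr1 -addrA.
rewrite lerD ?(coef_le sG)//.
rewrite modulusM modulus_nat.
have : modulus (\sum_(k < n) coef G N k.+1 * (cos (k.+1%:R * t))%:C) <=
       M * (x ^+ 1 / (1 - x)) + P%:R * B.
  rewrite (le_trans (modulus_sum _ _ _))//.
  rewrite (le_trans _ (@sum_coef_low 0 n nP))// big_mkord; apply: ler_sum => k _.
  by rewrite modulusM modulus_real ler_piMr ?modulus_ge0// cos_max.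
by rewrite expr1; lra.
Qed.

Lemma discrete_cheb_lip t e : modulus (discrete_cheb Q n G (t + e) -
   discrete_cheb Q n G t) <= `|e| * (2 * n%:R ^+ 2 * M).
Proof.
rewrite !discrete_chebE.
have -> : coef G N 0 + 2 * \sum_(k < n) coef G N k.+1 * (cos (k.+1%:R * (t + e)))%:C -
   (coef G N 0 + 2 * \sum_(k < n) coef G N k.+1 * (cos (k.+1%:R * t))%:C) =
   2 * \sum_(k < n) coef G N k.+1 * (cos (k.+1%:R * (t + e)) - cos (k.+1%:R * t))%:C.
  rewrite opprD addrACA subrr add0r -mulrBr -sumrB; congr (_ * _).
  apply: eq_bigr => k _; rewrite -mulrBr; congr (_ * _).
  by apply: complex_ext => /=; ring.
rewrite modulusM modulus_nat -!mulrA mulrCA ler_wpM2l//.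
rewrite (le_trans (modulus_sum _ _ _))//.
rewrite (@le_trans _ _ (\sum_(k < n) M * (n%:R * `|e|)))//; last first.
  by rewrite sumr_const card_ord -[M * _ *+ _]mulr_natl le_eqVlt; apply/orP; left; apply/eqP; ring.
apply: ler_sum => k _; rewrite modulusM modulus_real ler_pM ?modulus_ge0 ?(coef_le sG)//.
rewrite (le_trans (cos_lip _ _))// -mulrBr addrC addKr normrM ger0_norm//.
by rewrite ler_wpM2r// ler_nat.
Qed.

(** By inversion the error at a node is the sum of the coefficients from n to Q.  The
    exponential bound serves up to P, where its error term of the order of the mesh is
    still harmless, and the quadratic decay serves beyond. *)
Lemma discrete_cheb_error_node m : (m < N)%N ->
  modulus (G 0 (node N m) - discrete_cheb Q n G (node N m)) <=
  2 * M * (x ^+ n.+1 / (1 - x)) + 2 * (P%:R * B) + 64 * A / P%:R.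
Proof.
move=> mN; case: (sG) => _ Gper Geven _.
rewrite -(@inversion _ Q G (Gper 0) Geven)// !discrete_chebE.
set c := fun k : nat => coef G N k.+1 * (cos (k.+1%:R * node N m))%:C.
have -> : coef G N 0 + 2 * \sum_(k < Q) c k - (coef G N 0 + 2 * \sum_(k < n) c k) =
   2 * \sum_(n <= k < Q) c k.
  rewrite -!(big_mkord xpredT c) (@big_cat_nat _ _ _ n 0 Q)//=; last first.
    by rewrite (leq_trans nP).
  by ring.
rewrite modulusM modulus_nat.
have cle k : modulus (c k) <= modulus (coef G N k.+1).
  by rewrite modulusM modulus_real ler_piMr ?modulus_ge0// cos_max.
suff : \sum_(n <= k < Q) modulus (coef G N k.+1) <=
    M * (x ^+ n.+1 / (1 - x)) + P%:R * B + 32 * A / P%:R.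
  have : modulus (\sum_(n <= k < Q) c k) <= \sum_(n <= k < Q) modulus (coef G N k.+1).
    by rewrite (le_trans (modulus_sum _ _ _))// ler_sum.
  by lra.
rewrite (@big_cat_nat _ _ _ P n Q)//= lerD// ?sum_coef_low//.
rewrite (@le_trans _ _ (\sum_(P <= k < Q) 32 * A * (k.+1%:R ^+ 2)^-1))//.
  rewrite [leLHS]big_nat [leRHS]big_nat; apply: ler_sum => k /andP[_ kQ].
  exact: coef_high.
by rewrite -mulr_sumr ler_wpM2l ?mulr_ge0// inverse_square_tail.
Qed.

Lemma discrete_cheb_error t : 0 <= t <= pi ->
  modulus (G 0 t - discrete_cheb Q n G t) <=
  2 * M * (x ^+ n.+1 / (1 - x)) + 64 * A / P%:R +
  (2 * (P%:R * B) + @mesh R N * (2 * M / delta + 2 * A * delta + 2 * n%:R ^+ 2 * M)).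
Proof.
move=> /andP[t0 tpi]; pose m := Num.truncn (t / @mesh R N).
have tm0 : 0 <= t / @mesh R N by rewrite divr_ge0// ltW.
have /andP[m1 m2] := truncn_itv tm0.
have E1 : node N m <= t by rewrite /node -ler_pdivlMr.
have E2 : t < node N m + @mesh R N by rewrite -nodeS /node -ltr_pdivrMr.
have mN : (m < N)%N.
  rewrite -(ltr_nat R) -(ltr_pM2r m0) -!/(node N _) nodeN//.
  by have := pi_gt0 R; lra.
pose e := t - node N m; have te : t = node N m + e by rewrite /e; ring.
have eb : `|e| <= @mesh R N by rewrite /e ger0_norm; lra.
have H1 := discrete_cheb_error_node mN.
have H2 := strip_lipschitz (node N m) (le_trans eb mesh_delta).
have H3 := discrete_cheb_lip (node N m) e.
rewrite te.
have -> : G 0 (node N m + e) - discrete_cheb Q n G (node N m + e) =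
  (G 0 (node N m + e) - G 0 (node N m)) - (discrete_cheb Q n G (node N m + e) -
   discrete_cheb Q n G (node N m)) + (G 0 (node N m) - discrete_cheb Q n G (node N m)).
  by ring.
rewrite (le_trans (modulusD _ _))//.
have H4 := modulusB (G 0 (node N m + e) - G 0 (node N m))
   (discrete_cheb Q n G (node N m + e) - discrete_cheb Q n G (node N m)).
have c1 : 0 <= 2 * M / delta + 2 * A * delta.
  by rewrite addr_ge0 ?divr_ge0 ?mulr_ge0// ltW.
have c2 : 0 <= 2 * n%:R ^+ 2 * M by rewrite mulr_ge0// mulr_ge0// sqr_ge0.
have H5 := ler_wpM2r c1 eb; have H6 := ler_wpM2r c2 eb.
by lra.
Qed.

End fixed_grid.
End bounds.

(** The grid size depends on the constants only, so that one grid serves all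
    functions of a family obtained by freezing the other variables. *)
Lemma discrete_cheb_approx (sigma M A delta : R) n (tau : R) :
  0 < sigma -> 0 < delta -> 0 <= A -> 0 <= M -> 0 < tau ->
  exists Q0, forall Q, (Q0 <= Q)%N ->
    forall G, smooth_strip sigma M A delta G ->
    let x := expR (- sigma) in
    (forall t, 0 <= t <= pi -> modulus (G 0 t - discrete_cheb Q n G t) <=
       2 * M * (x ^+ n.+1 / (1 - x)) + tau) /\
    (forall t, modulus (discrete_cheb Q n G t) <= M * (1 + 2 * x / (1 - x)) + tau).
Proof.
move=> sigma0 delta0 A0 M0 tau0.
have a0 : 0 <= 128 * A / tau by rewrite divr_ge0 ?mulr_ge0// ltW.
(* P makes the tail of the quadratic bound small; the mesh r is chosen after P *)
pose P := maxn n (Num.bound (128 * A / tau)).+1.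
have P0 : (0 < P)%N by rewrite /P leq_max orbT.
have nP : (n <= P)%N by rewrite leq_max leqnn.
have PR : 0 < P%:R :> R by rewrite ltr0n.
have AP : 64 * A / P%:R <= tau / 2.
  have : 128 * A / tau <= P%:R.
    rewrite (le_trans (ltW (archi_boundP a0)))// ler_nat /P.
    by rewrite leq_max leqnSn orbT.
  rewrite ler_pdivrMr// => H; rewrite ler_pdivrMr//; lra.
pose c1 := 4 * P%:R * (A + 2 * P%:R ^+ 2 * M) * sigma.
pose c2 := 2 * M / delta + 2 * A * delta + 2 * n%:R ^+ 2 * M.
have c10 : 0 <= c1.
  rewrite /c1 mulr_ge0// ?(ltW sigma0)// mulr_ge0 ?mulr_ge0// addr_ge0//.
  by rewrite -mulrA mulr_ge0// mulr_ge0// sqr_ge0.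
have c20 : 0 <= c2.
  rewrite /c2 addr_ge0 ?mulr_ge0 ?sqr_ge0// addr_ge0 ?divr_ge0 ?mulr_ge0//; exact: ltW.
pose r := Num.min delta (Num.min P%:R^-1 (tau / (2 * (c1 + c2 + 1)))).
have cc : 0 < 2 * (c1 + c2 + 1) by lra.
have r0 : 0 < r by rewrite !lt_min delta0 invr_gt0 PR divr_gt0.
have [Q0 HQ0] := mesh_cvg r0.
exists (maxn Q0 P) => Q; rewrite geq_max => /andP[QQ0 PQ] G sG x.
have mr := HQ0 _ QQ0.
have md : @mesh R Q.*2.+1 <= delta by rewrite (le_trans mr)// ge_min lexx.
have mP : P%:R * @mesh R Q.*2.+1 <= 1.
  rewrite -ler_pdivlMl// mulr1 (le_trans mr)//.
  by rewrite !ge_min lexx orbT.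
have mt : @mesh R Q.*2.+1 * (c1 + c2) <= tau / 2.
  have : @mesh R Q.*2.+1 <= tau / (2 * (c1 + c2 + 1)).
    by rewrite (le_trans mr)// !ge_min lexx !orbT.
  rewrite ler_pdivlMr//.
  have := mesh_gt0 (R := R) (ltn0Sn Q.*2); lra.
have m0 := mesh_gt0 (R := R) (ltn0Sn Q.*2).
have E : 2 * (P%:R * (2 * (A + 2 * P%:R ^+ 2 * M) * sigma * @mesh R Q.*2.+1)) =
    @mesh R Q.*2.+1 * c1 by rewrite /c1; ring.
have H2 := mulr_ge0 (ltW m0) c20.
split=> t => [ht|].
  have := discrete_cheb_error sG sigma0 delta0 A0 nP P0 PQ md mP ht.
  rewrite E -/c2 -/x; lra.
have := discrete_cheb_le sG sigma0 delta0 A0 nP md mP t.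
rewrite E -/x; lra.
Qed.

End one_variable.

(** * Local estimates from power series *)

Section local_power_series.
Context {R : realType}.
Local Open Scope complex_scope.
Implicit Types (u v w a b : R[i]).

Lemma modulus_subX s u v m : 0 <= s -> modulus u <= s -> modulus v <= s ->
  s * modulus (u ^+ m - v ^+ m) <= m%:R * s ^+ m * modulus (u - v).
Proof.
move=> s0 us vs; elim: m => [|m IH].
  by rewrite !expr0 subrr modulus0 mulr0 !mul0r.
have -> : u ^+ m.+1 - v ^+ m.+1 = u * (u ^+ m - v ^+ m) + (u - v) * v ^+ m.
  by rewrite !exprS; ring.
have H1 : s * modulus (u * (u ^+ m - v ^+ m)) <=
          s * (m%:R * s ^+ m * modulus (u - v)).
  by rewrite modulusM mulrCA ler_pM ?modulus_ge0 ?mulr_ge0 ?modulus_ge0.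
have H2 : s * modulus ((u - v) * v ^+ m) <= s * (modulus (u - v) * s ^+ m).
  rewrite modulusM modulusX ler_wpM2l// ler_wpM2l ?modulus_ge0//.
  by rewrite lerXn2r ?nnegrE ?modulus_ge0.
rewrite (le_trans (ler_wpM2l s0 (modulusD _ _)))// mulrDr.
rewrite (le_trans (lerD H1 H2))// le_eqVlt; apply/orP; left; apply/eqP.
by rewrite exprS -[m.+1%:R]natr1; ring.
Qed.

(** The second divided difference of a monomial at w, w + a and w + b,
    cleared of its denominators; halving the radius pays for the quadratic
    growth of its coefficients. *)
Lemma modulus_divided_difference s w a b m :
  0 <= s -> modulus w <= s -> modulus (w + a) <= s -> modulus (w + b) <= s ->
  s ^+ 2 * modulus (b * ((w + a) ^+ m - w ^+ m) - a * ((w + b) ^+ m - w ^+ m)) <=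
    modulus a * modulus b * modulus (a - b) * (2 * s) ^+ m.
Proof.
move=> s0 ws as_ bs; set X := modulus a * modulus b * modulus (a - b).
have X0 : 0 <= X by rewrite !mulr_ge0 ?modulus_ge0.
elim: m => [|m IH].
  by rewrite !expr0 !subrr !mulr0 subrr modulus0 mulr0 mulr1.
set u := w + a; set v := w + b; set D := _ - _ in IH.
have -> : b * (u ^+ m.+1 - w ^+ m.+1) - a * (v ^+ m.+1 - w ^+ m.+1) =
    w * D + a * b * (u ^+ m - v ^+ m) by rewrite /D /u /v !exprS; ring.
have H1 : s ^+ 2 * modulus (w * D) <= s * (X * (2 * s) ^+ m).
  by rewrite modulusM mulrCA ler_pM ?modulus_ge0 ?mulr_ge0 ?modulus_ge0 ?exprn_ge0.
have H2 : s ^+ 2 * modulus (a * b * (u ^+ m - v ^+ m)) <= s * X * (m%:R * s ^+ m).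
  rewrite !modulusM; have := modulus_subX m s0 as_ bs; rewrite -/u -/v.
  have -> : u - v = a - b by rewrite /u /v; ring.
  move=> H; have ab0 : 0 <= s * (modulus a * modulus b).
    by rewrite !mulr_ge0 ?modulus_ge0.
  by have := ler_wpM2l ab0 H; rewrite /X; lra.
rewrite (le_trans (ler_wpM2l (sqr_ge0 s) (modulusD _ _)))// mulrDr.
rewrite (le_trans (lerD H1 H2))//.
have m2 : m%:R <= 2 ^+ m :> R by rewrite -natrX ler_nat ltnW// ltn_expl.
have sX := mulr_ge0 (mulr_ge0 s0 X0) (exprn_ge0 m s0).
have := ler_wpM2l sX m2.
by rewrite !exprMn !exprS; lra.
Qed.

Section several_variables.
Variable d : nat.
Implicit Types (z : d.-tuple R[i]) (F : d.-tuple R[i] -> R[i]) (i : 'I_d).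

Definition upd T (z : d.-tuple T) i (v : T) : d.-tuple T :=
  [tuple if j == i then v else tnth z j | j < d].

Lemma tnth_upd T (z : d.-tuple T) i (v : T) j :
  tnth (upd z i v) j = if j == i then v else tnth z j.
Proof. by rewrite tnth_mktuple. Qed.

Lemma le_cvg0 (X Y : R) (e : nat -> R) :
  e n @[n --> \oo] --> (0 : R) -> (forall n, X <= Y + e n) -> X <= Y.
Proof.
move=> e0 H; apply/ler_addgt0Pr => eps eps0.
have [n ne] : exists n, e n < eps.
  by apply: (@filter_ex _ \oo); exact: (cvgr_lt _ e0).
by rewrite (le_trans (H n))// lerD2l ltW.
Qed.

(** Bounds for monomials pass to the sum of the series.  The second estimate is a
    divided difference, which needs no derivative of the series to be named;
    the derivative is later recovered from it. *)
Lemma analytic_local F z0 : analytic_at F z0 ->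
  exists s B : R, [/\ 0 < s, 0 <= B,
    forall z, (forall k, modulus (tnth z k - tnth z0 k) <= s) -> modulus (F z) <= B
  & forall z i a b, (forall k, modulus (tnth z k - tnth z0 k) <= s) ->
      modulus (tnth z i - tnth z0 i + a) <= s ->
      modulus (tnth z i - tnth z0 i + b) <= s ->
      modulus (b * (F (upd z i (tnth z i + a)) - F z) -
               a * (F (upd z i (tnth z i + b)) - F z)) <=
        B * (modulus a * modulus b * modulus (a - b))].
Proof.
move=> [c [r [S [r0 HS HF]]]]; pose s := r / 2.
have s0 : 0 < s by rewrite divr_gt0.
have sr : s < r by rewrite /s; lra.
have rs : 2 * s = r by rewrite /s; lra.
have S0 : 0 <= S.
  apply: le_trans (HS 0%N); apply: sumr_ge0 => b _.
  by rewrite mulr_ge0 ?modulus_ge0// exprn_ge0// ltW.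
pose P n z : R[i] := \sum_(b : {ffun 'I_d -> 'I_n})
  c [ffun i => b i : nat] * \prod_(i < d) (tnth z i - tnth z0 i) ^+ b i.
have cvgP z : (forall k, modulus (tnth z k - tnth z0 k) <= s) ->
    modulus (F z - P n z) @[n --> \oo] --> (0 : R).
  by move=> hz; apply: HF => k; exact: le_lt_trans sr.
exists s, (S / s ^+ 2 + S); split=> //.
- by rewrite addr_ge0// divr_ge0// exprn_ge0// ltW.
- move=> z hz; apply: (@le_trans _ _ S); last first.
    by rewrite lerDr divr_ge0// exprn_ge0// ltW.
  apply: (le_cvg0 (cvgP z hz)) => n.
  have E : F z = P n z + (F z - P n z) by ring.
  rewrite {1}E.
  rewrite (le_trans (modulusD _ _))// lerD2r (le_trans _ (HS n))//.
  rewrite (le_trans (modulus_sum _ _ _))//; apply: ler_sum => b _.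
  rewrite modulusM ler_wpM2l ?modulus_ge0// modulus_prod -prodrXr.
  apply: ler_prod => k _; rewrite modulus_ge0/= modulusX.
  by rewrite lerXn2r ?nnegrE ?modulus_ge0 ?(ltW r0)// (le_trans (hz k))// ltW.
move=> z i a b hz ha hb; set za := upd z i _; set zb := upd z i _.
set X := modulus a * modulus b * modulus (a - b).
have X0 : 0 <= X by rewrite !mulr_ge0 ?modulus_ge0.
have updE v k : tnth (upd z i (tnth z i + v)) k - tnth z0 k =
    if k == i then tnth z i - tnth z0 i + v else tnth z k - tnth z0 k.
  by rewrite tnth_upd; case: eqP => [->|//]; ring.
have hza k : modulus (tnth za k - tnth z0 k) <= s by rewrite updE; case: eqP.
have hzb k : modulus (tnth zb k - tnth z0 k) <= s by rewrite updE; case: eqP.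
apply: (@le_trans _ _ (S / s ^+ 2 * X)); last by rewrite ler_wpM2r// lerDl.
pose err n := modulus b * (modulus (F za - P n za) + modulus (F z - P n z)) +
  modulus a * (modulus (F zb - P n zb) + modulus (F z - P n z)).
have cvg_err : err n @[n --> \oo] --> (0 : R).
  rewrite [X in _ --> X](_ : _ = modulus b * (0 + 0) + modulus a * (0 + 0)).
    by apply: cvgD; apply: cvgMr; apply: cvgD; exact: cvgP.
  by rewrite !addr0 !mulr0 addr0.
apply: (le_cvg0 cvg_err) => n.
have -> : b * (F za - F z) - a * (F zb - F z) =
  (b * (P n za - P n z) - a * (P n zb - P n z)) +
  (b * ((F za - P n za) - (F z - P n z)) - a * ((F zb - P n zb) - (F z - P n z))).
  by ring.
rewrite (le_trans (modulusD _ _))// lerD//; last first.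
  rewrite (le_trans (modulusB _ _))// !modulusM lerD// ler_wpM2l ?modulus_ge0//;
  exact: modulusB.
have -> : b * (P n za - P n z) - a * (P n zb - P n z) =
  \sum_(be : {ffun 'I_d -> 'I_n}) c [ffun k => be k : nat] *
    (\prod_(k < d | k != i) (tnth z k - tnth z0 k) ^+ be k *
    (b * ((tnth z i - tnth z0 i + a) ^+ be i - (tnth z i - tnth z0 i) ^+ be i) -
     a * ((tnth z i - tnth z0 i + b) ^+ be i - (tnth z i - tnth z0 i) ^+ be i))).
  rewrite /P -!sumrB !mulr_sumr -sumrB; apply: eq_bigr => be _.
  have prodE v : \prod_(k < d) (tnth (upd z i (tnth z i + v)) k - tnth z0 k) ^+ be k =
      (tnth z i - tnth z0 i + v) ^+ be i *
      \prod_(k < d | k != i) (tnth z k - tnth z0 k) ^+ be k.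
    rewrite (bigD1 i)//= updE eqxx; congr (_ * _); apply: eq_bigr => k ki.
    by rewrite updE (negbTE ki).
  rewrite !prodE [\prod_(k < d) _](bigD1 i)//=.
  by move: (\prod_(k < d | k != i) _) => p; ring.
rewrite (le_trans (modulus_sum _ _ _))//.
rewrite (@le_trans _ _ (\sum_(be : {ffun 'I_d -> 'I_n})
   modulus (c [ffun k => be k : nat]) * r ^+ (\sum_(k < d) be k) * (X / s ^+ 2)))//.
  apply: ler_sum => be _; rewrite !modulusM -mulrA ler_wpM2l ?modulus_ge0//.
  have -> : r ^+ (\sum_(k < d) be k) =
      \prod_(k < d | k != i) r ^+ be k * r ^+ be i.
    by rewrite -prodrXr (bigD1 i)//= mulrC.
  rewrite modulus_prod -mulrA.
  rewrite ler_pM ?modulus_ge0//; first by apply: prodr_ge0 => k _; exact: modulus_ge0.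
    apply: ler_prod => k _; rewrite modulus_ge0/= modulusX.
    by rewrite lerXn2r ?nnegrE ?modulus_ge0 ?(ltW r0)// (le_trans (hz k))// ltW.
  have := modulus_divided_difference (be i) (ltW s0) (hz i) ha hb.
  rewrite -/X rs mulrA ler_pdivlMr ?exprn_gt0// => H.
  by rewrite [leLHS]mulrC [leRHS]mulrC.
rewrite -mulr_suml [leRHS](_ : _ = S * (X / s ^+ 2)); last by ring.
by rewrite ler_wpM2r ?HS// divr_ge0// exprn_ge0// ltW.
Qed.

End several_variables.
End local_power_series.

(** * Complex derivative and the Joukowski map *)

Section derivative.
Context {R : realType}.
Local Open Scope complex_scope.

(** The limit of phi at 0 is the supremum of its lower envelopes phi(a) - B a. *)
Lemma lipschitz_quotient_limit (phi : R -> R) (s B : R) :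
  0 < s -> 0 <= B ->
  (forall a b, 0 < a <= s -> 0 < b <= s -> `|phi a - phi b| <= B * `|a - b|) ->
  exists l, forall t, 0 < t <= s -> `|phi t - l| <= B * t.
Proof.
move=> s0 B0 H; pose E := [set phi a - B * a | a in [set a | 0 < a <= s]].
have sE : 0 < s <= s by rewrite s0 lexx.
have ubE b : 0 < b <= s -> ubound E (phi b + B * b).
  move=> hb _ [a /= ha <-].
  have ab : B * `|a - b| <= B * (a + b).
    rewrite ler_wpM2l// ler_norml; case/andP: ha hb => a0 _ /andP[b0 _].
    by apply/andP; split; lra.
  by have := le_trans (H a b ha hb) ab; rewrite ler_norml => /andP[_]; lra.
have supE : has_sup E.
  split; first by exists (phi s - B * s), s.
  by exists (phi s + B * s); exact: ubE.
exists (sup E) => t ht.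
have H1 : phi t - B * t <= sup E by apply: ub_le_sup; [case: supE|exists t].
have H2 : sup E <= phi t + B * t by apply: ge_sup; [case: supE|exact: ubE].
by rewrite ler_norml; apply/andP; split; lra.
Qed.

(** The hypothesis says that the quotients X(a) / a are Lipschitz.  The derivative D is
    their limit along the positive reals, and a general direction a is compared
    with the positive real of the same modulus. *)
Lemma complex_derivative (X : R[i] -> R[i]) (s B : R) :
  0 < s -> 0 <= B -> X 0 = 0 ->
  (forall a b, modulus a <= s -> modulus b <= s ->
     modulus (b * X a - a * X b) <= B * (modulus a * modulus b * modulus (a - b))) ->
  exists D, forall a, modulus a <= s ->
    modulus (X a - a * D) <= 4 * B * modulus a ^+ 2.
Proof.
move=> s0 B0 X0 H; pose phi t := X t%:C / t%:C.
have mt t : 0 < t <= s -> modulus t%:C = t.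
  by move=> /andP[t0 _]; rewrite modulus_real gtr0_norm.
have phiB a b : 0 < a <= s -> 0 < b <= s ->
    modulus (phi a - phi b) <= B * `|a - b|.
  move=> ha hb; have /andP[a0 _] := ha; have /andP[b0 _] := hb.
  have a1 : a%:C != 0 :> R[i].
    by apply/eqP => /(congr1 (@complex.Re R)) /= a1; move: a0; rewrite a1 ltxx.
  have b1 : b%:C != 0 :> R[i].
    by apply/eqP => /(congr1 (@complex.Re R)) /= b1; move: b0; rewrite b1 ltxx.
  rewrite -(ler_pM2l (mulr_gt0 a0 b0)).
  have := H a%:C b%:C; rewrite !mt//; case/andP: ha => _ ->; case/andP: hb => _ ->.
  move=> /(_ isT isT).
  have -> : a%:C - b%:C = (a - b)%:C :> R[i] by apply: complex_ext => /=; ring.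
  rewrite modulus_real.
  have -> : b%:C * X a%:C - a%:C * X b%:C = (a * b)%:C * (phi a - phi b).
    by rewrite realcM /phi; field; rewrite a1 b1.
  rewrite modulusM modulus_real gtr0_norm ?mulr_gt0//; lra.
have [l1 H1] : exists l, forall t, 0 < t <= s -> `|complex.Re (phi t) - l| <= B * t.
  apply: lipschitz_quotient_limit => // a b ha hb.
  by rewrite -raddfB (le_trans (le_Re_modulus _))// phiB.
have [l2 H2] : exists l, forall t, 0 < t <= s -> `|complex.Im (phi t) - l| <= B * t.
  apply: lipschitz_quotient_limit => // a b ha hb.
  by rewrite -raddfB (le_trans (le_Im_modulus _))// phiB.
exists (l1 +i* l2) => a ha.
have [->|a0] := eqVneq a 0; first by rewrite X0 mul0r subr0 modulus0 expr0n mulr0.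
set t := modulus a; have t0 : 0 < t.
  rewrite lt_neqAle modulus_ge0 andbT eq_sym; apply: contra a0 => /eqP /modulus0_eq ->//.
have ht : 0 < t <= s by rewrite t0.
have H3 : modulus (phi t - (l1 +i* l2)) <= 2 * B * t.
  rewrite (le_trans (modulus_le _))//; have := H1 t ht; have := H2 t ht.
  by case: (phi t) => u v /=; lra.
have t1 : t%:C != 0 :> R[i].
  by apply/eqP => /(congr1 (@complex.Re R)) /= t1; move: t0; rewrite t1 ltxx.
have H4 := H a t%:C ha; rewrite mt// in H4.
have {}H4 := H4 (proj2 (andP ht)).
have H5 : modulus (a - t%:C) <= 2 * t by rewrite (le_trans (modulusB _ _))// mt// -/t; lra.
rewrite -(ler_pM2l t0).
have -> : t * modulus (X a - a * (l1 +i* l2)) = modulus (t%:C * (X a - a * (l1 +i* l2))).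
  by rewrite modulusM mt.
have -> : t%:C * (X a - a * (l1 +i* l2)) = (t%:C * X a - a * X t%:C) +
    a * t%:C * (phi t - (l1 +i* l2)).
  by rewrite /phi; move: (l1 +i* l2) => D; field.
rewrite (le_trans (modulusD _ _))// !modulusM mt// -/t.
have tt : 0 <= B * (t * t) by rewrite !mulr_ge0// ltW.
have H6 := ler_wpM2l tt H5.
have H7 : t * t * modulus (phi t - (l1 +i* l2)) <= t * t * (2 * B * t).
  by rewrite ler_wpM2l// mulr_ge0// ltW.
by move: H4 H6 H7; rewrite -/t; lra.
Qed.

(** The constants are uniform for z close to z0, as the compactness argument on the
    polystrip requires. *)
Lemma analytic_taylor d (F : d.-tuple R[i] -> R[i]) z0 : analytic_at F z0 ->
  exists s B : R, [/\ 0 < s, 0 <= B &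
    forall z i, (forall k, modulus (tnth z k - tnth z0 k) <= s) ->
    exists2 D, modulus D <= B & forall a, modulus a <= s ->
      modulus (F (upd z i (tnth z i + a)) - F z - a * D) <= B * modulus a ^+ 2].
Proof.
move=> /analytic_local[s0 [B [s00 B0 HB H]]].
pose s := s0 / 2; have s_gt0 : 0 < s by rewrite divr_gt0.
exists s, (4 * B + (2 * B / s + 4 * B * s)); split => //.
  by rewrite !addr_ge0// ?divr_ge0 ?mulr_ge0// ltW.
move=> z i hz; pose X a := F (upd z i (tnth z i + a)) - F z.
have zs k : modulus (tnth z k - tnth z0 k) <= s0 by rewrite (le_trans (hz k))// /s; lra.
have zas a : modulus a <= s -> modulus (tnth z i - tnth z0 i + a) <= s0.
  by move=> ha; rewrite (le_trans (modulusD _ _))//; have := hz i; rewrite /s in ha *; lra.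
have [|a b ha hb|D HD] := @complex_derivative X s B s_gt0 B0.
- rewrite /X addr0 (_ : upd z i (tnth z i) = z) ?subrr//.
  by apply: eq_from_tnth => j; rewrite tnth_upd; case: eqP => [->|].
- by apply: H => //; exact: zas.
have XB a : modulus a <= s -> modulus (X a) <= 2 * B.
  move=> ha; rewrite (le_trans (modulusB _ _))// mulr_natl mulr2n lerD ?HB// => k.
  by rewrite tnth_upd; case: eqP => [->|//]; rewrite addrAC zas.
have Bs : 0 <= 2 * B / s + 4 * B * s by rewrite addr_ge0 ?divr_ge0 ?mulr_ge0// ltW.
exists D => [|a ha]; last first.
  by rewrite (le_trans (HD a ha))// ler_wpM2r ?sqr_ge0// lerDl.
apply: (@le_trans _ _ (2 * B / s + 4 * B * s)); last by rewrite lerDr mulr_ge0.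
have ms : modulus s%:C = s by rewrite modulus_real gtr0_norm.
rewrite -(ler_pM2l s_gt0) -{1}ms -modulusM.
have -> : s%:C * D = X s%:C - (X s%:C - s%:C * D) by ring.
rewrite (le_trans (modulusB _ _))//.
have H1 := XB s%:C; have H2 := HD s%:C; rewrite ms lexx in H1 H2.
rewrite (le_trans (lerD (H1 isT) (H2 isT)))// le_eqVlt; apply/orP; left; apply/eqP.
by field; rewrite gt_eqF.
Qed.

End derivative.

Section joukowski.
Context {R : realType}.
Local Open Scope complex_scope.
Implicit Types s t h e sigma : R.

(** This is cos (t - i s); it maps the strip |s| < ln rho onto the ellipse. *)
Definition joukowski s t : R[i] :=
  2^-1 * ((expR s)%:C * cis t + (expR (- s))%:C * cis (- t)).

(** The derivative of joukowski with respect to s, and to t up to the factor 'i. *)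
Definition joukowski' s t : R[i] :=
  2^-1 * ((expR s)%:C * cis t - (expR (- s))%:C * cis (- t)).

Lemma joukowskiE s t : joukowski s t =
  ((expR s + expR (- s)) / 2 * cos t) +i* ((expR s - expR (- s)) / 2 * sin t).
Proof.
rewrite /joukowski (_ : (2^-1 : R[i]) = (2^-1)%:C); last by rewrite fmorphV rmorph_nat.
by apply: complex_ext; rewrite /= cosN sinN; ring.
Qed.

Lemma joukowski0 t : joukowski 0 t = (cos t)%:C.
Proof. by rewrite joukowskiE; apply: complex_ext => /=; rewrite oppr0 expR0; lra. Qed.

Lemma joukowski_period s t : joukowski s (t + pi *+ 2) = joukowski s t.
Proof. by rewrite !joukowskiE sinD2pi cosD2pi. Qed.

Let half : modulus (2^-1 : R[i]) = 2^-1. Proof. exact: modulus_natV. Qed.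

Lemma joukowski'_le sigma s t : `|s| <= sigma -> modulus (joukowski' s t) <= expR sigma.
Proof.
rewrite ler_norml => /andP[s1 s2]; rewrite modulusM half.
rewrite -ler_pdivlMl ?invr_gt0// invrK (le_trans (modulusB _ _))//.
rewrite !modulusM !modulus_cis !mulr1 !modulus_real !ger0_norm ?expR_ge0//.
by rewrite mulr_natl mulr2n lerD// ler_expR; lra.
Qed.

Let combination_le sigma s t (a b : R[i]) (K : R) : `|s| <= sigma ->
  modulus a <= K -> modulus b <= K ->
  modulus (2^-1 * ((expR s)%:C * a * cis t + (expR (- s))%:C * b * cis (- t))) <=
    expR sigma * K.
Proof.
rewrite ler_norml => /andP[s1 s2] aK bK; rewrite modulusM half ler_pdivrMl//.
rewrite (le_trans (modulusD _ _))// mulr_natl mulr2n.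
rewrite !modulusM !modulus_cis !mulr1 !modulus_real !ger0_norm ?expR_ge0//.
by rewrite lerD// ler_pM ?expR_ge0 ?modulus_ge0// ler_expR; lra.
Qed.

Lemma joukowski_taylor_s sigma s t h : `|s| <= sigma -> `|h| <= 1 / 2 ->
  modulus (joukowski (s + h) t - joukowski s t - h%:C * joukowski' s t) <=
    expR sigma * (2 * h ^+ 2).
Proof.
move=> hs h2; have -> : joukowski (s + h) t - joukowski s t - h%:C * joukowski' s t =
  2^-1 * ((expR s)%:C * (expR h - 1 - h)%:C * cis t +
    (expR (- s))%:C * (expR (- h) - 1 - (- h))%:C * cis (- t)).
  have E (x : R) : (expR x - 1 - x)%:C = (expR x)%:C - 1 - x%:C :> R[i].
    by apply: complex_ext => /=; ring.
  rewrite /joukowski /joukowski' !E opprD !expRD !realcM.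
  have -> : (- h)%:C = - h%:C :> R[i] by apply: complex_ext => /=; ring.
  by move: (cis t) (cis (- t)) => c1 c2; ring.
apply: combination_le; rewrite ?modulus_real ?expR_taylor//.
by rewrite -(sqrrN h) expR_taylor// normrN.
Qed.

Lemma joukowski_taylor_t sigma s t e : `|s| <= sigma -> `|e| <= 1 ->
  modulus (joukowski s (t + e) - joukowski s t - 'i * e%:C * joukowski' s t) <=
    expR sigma * e ^+ 2.
Proof.
move=> hs e1; have -> :
  joukowski s (t + e) - joukowski s t - 'i * e%:C * joukowski' s t =
  2^-1 * ((expR s)%:C * (cis e - 1 - 'i * e%:C) * cis t +
    (expR (- s))%:C * (cis (- e) - 1 - 'i * (- e)%:C) * cis (- t)).
  rewrite /joukowski /joukowski' opprD !cisD.
  have -> : (- e)%:C = - e%:C :> R[i] by apply: complex_ext => /=; ring.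
  by move: (cis t) (cis (- t)) (cis e) (cis (- e)) => c1 c2 c3 c4; ring.
apply: combination_le; rewrite ?cis_taylor//.
by rewrite -(sqrrN e) cis_taylor// normrN.
Qed.

Let lip_of_taylor sigma s t h (X k : R[i]) : `|s| <= sigma -> `|h| <= 1 / 2 ->
  modulus k = `|h| -> modulus (X - k * joukowski' s t) <= expR sigma * (2 * h ^+ 2) ->
  modulus X <= 2 * expR sigma * `|h|.
Proof.
move=> hs hh kh HX; have H := ler_wpM2l (normr_ge0 h) (joukowski'_le t hs).
rewrite -(subrK (k * joukowski' s t) X) (le_trans (modulusD _ _))// modulusM kh.
have e0 := expR_ge0 sigma.
have : expR sigma * h ^+ 2 <= expR sigma * (`|h| * (1 / 2)).
  by rewrite ler_wpM2l// -(real_normK (num_real h)) expr2 ler_wpM2l.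
by lra.
Qed.

Lemma joukowski_lip_s sigma s t h : `|s| <= sigma -> `|h| <= 1 / 2 ->
  modulus (joukowski (s + h) t - joukowski s t) <= 2 * expR sigma * `|h|.
Proof.
move=> hs hh; apply: (lip_of_taylor hs hh (modulus_real h)).
exact: joukowski_taylor_s.
Qed.

Lemma joukowski_lip_t sigma s t e : `|s| <= sigma -> `|e| <= 1 / 2 ->
  modulus (joukowski s (t + e) - joukowski s t) <= 2 * expR sigma * `|e|.
Proof.
move=> hs he; apply: (@lip_of_taylor sigma s t e _ ('i * e%:C)) => //.
  by rewrite modulusM modulus_i mul1r modulus_real.
apply: le_trans (joukowski_taylor_t t hs _) _; first by lra.
by rewrite ler_wpM2l ?expR_ge0//; have := sqr_ge0 e; lra.
Qed.

Lemma joukowski_ellipse rho s t : 1 < rho -> `|s| < ln rho ->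
  bernstein_ellipse rho (joukowski s t).
Proof.
move=> rho1; have rho0 : 0 < rho by lra.
rewrite ltr_norml -lnV ?posrE// => /andP[s1 s2].
have {}s1 : rho^-1 < expR s by rewrite -ltr_ln ?posrE ?invr_gt0 ?expR_gt0// expRK.
have {}s2 : expR s < rho by rewrite -ltr_ln ?posrE ?expR_gt0// expRK.
rewrite joukowskiE /bernstein_ellipse /= expRN.
set x := expR s in s1 s2 *; have x0 : 0 < x by exact: expR_gt0.
have xV : rho^-1 < x^-1 by rewrite ltf_pV2 ?posrE.
have xV2 : x^-1 < rho by rewrite -[ltRHS]invrK ltf_pV2 ?posrE ?invr_gt0.
have rV : rho * rho^-1 = 1 by rewrite divff ?gt_eqF.
have xxV : x * x^-1 = 1 by rewrite divff ?gt_eqF.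
set a := (rho + rho^-1) / 2; set b := (rho - rho^-1) / 2.
have rV1 : rho^-1 < 1 by rewrite invf_lt1.
have a0 : 0 < a by rewrite /a; have := invr_gt0 rho; rewrite rho0; lra.
have b0 : 0 < b by rewrite /b; lra.
set u := (x + x^-1) / 2; set v := (x - x^-1) / 2.
have ua : (u / a) ^+ 2 < 1.
  rewrite expr_div_n ltr_pdivrMr ?exprn_gt0// mul1r ltrXn2r ?nnegrE ?ltW ?divr_gt0 ?addr_gt0 ?invr_gt0//.
  have E : x^-1 * ((rho - x) * (x - rho^-1)) = rho + rho^-1 - x - x^-1.
    by field; rewrite !gt_eqF.
  have : 0 < x^-1 * ((rho - x) * (x - rho^-1)).
    by rewrite !mulr_gt0 ?invr_gt0 ?subr_gt0.
  by rewrite E /u /a; lra.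
have vb : (v / b) ^+ 2 < 1.
  rewrite expr_div_n ltr_pdivrMr ?exprn_gt0// mul1r -real_normK ?num_real// ltrXn2r ?nnegrE ?(ltW b0)//.
  by rewrite ltr_norml /v /b; apply/andP; split; lra.
have -> : (u * cos t / a) ^+ 2 + (v * sin t / b) ^+ 2 =
  (u / a) ^+ 2 * cos t ^+ 2 + (v / b) ^+ 2 * sin t ^+ 2.
  by rewrite -!exprMn; congr (_ ^+ 2 + _ ^+ 2); rewrite mulrAC.
move: ua vb; set p := (u / a) ^+ 2; set q := (v / b) ^+ 2 => ua vb.
rewrite (sin2cos2 t); have := sin2cos2 t; have := sqr_ge0 (sin t).
have := sqr_ge0 (cos t); set c := cos t ^+ 2; rewrite le_eqVlt => /predU1P[<-|c0].
  by move=> _ _; rewrite mulr0 add0r subr0 mulr1.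
move=> s0 sE; have H1 : p * c < c by rewrite gtr_pMl.
have c1 : 0 <= 1 - c by rewrite -sE.
have H2 : q * (1 - c) <= 1 - c by rewrite ler_piMl// ltW.
by lra.
Qed.

End joukowski.

(** * Uniform Taylor estimates on a polystrip *)

Section polystrip.
Context {R : realType}.
Local Open Scope complex_scope.
Variable d : nat.
Implicit Types (s t : 'I_d -> R) (a b : R) (i : 'I_d).

Definition updf T (s : 'I_d -> T) i (a : T) : 'I_d -> T :=
  fun j => if j == i then a else s j.

Definition jpoint s t : d.-tuple R[i] := [tuple joukowski (s i) (t i) | i < d].

Lemma tnth_jpoint s t i : tnth (jpoint s t) i = joukowski (s i) (t i).
Proof. by rewrite tnth_mktuple. Qed.

Lemma jpoint_updf s t i a b :
  jpoint (updf s i a) (updf t i b) = upd (jpoint s t) i (joukowski a b).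
Proof.
apply: eq_from_tnth => j; rewrite tnth_upd !tnth_jpoint /updf.
by case: eqP.
Qed.

Lemma upd_jpoint_updf s t i a b (v : R[i]) :
  upd (jpoint (updf s i a) (updf t i b)) i v = upd (jpoint s t) i v.
Proof.
apply: eq_from_tnth => j; rewrite !tnth_upd !tnth_jpoint /updf.
by case: eqP.
Qed.

Lemma joukowski_reduce (t : R) : exists2 t', 0 <= t' <= pi *+ 2 &
  forall u : R, joukowski u t' = joukowski u t.
Proof.
have p0 : 0 < pi *+ 2 :> R by rewrite mulr2n addr_gt0// (pi_gt0 R).
have per (s u : R) n : joukowski s (u + n%:R * (pi *+ 2)) = joukowski s u.
  elim: n => [|n IH]; first by rewrite mul0r addr0.
  by rewrite -natr1 mulrDl mul1r addrA joukowski_period IH.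
wlog t0 : t / 0 <= t.
  move=> H; have c0 : 0 <= `|t| / (pi *+ 2) by rewrite divr_ge0// ltW.
  have := archi_boundP c0; set n := Num.bound _; rewrite ltr_pdivrMr// => Hn.
  have [|t' ht' E] := H (t + n%:R * (pi *+ 2)).
    by have := ler_norm (- t); rewrite normrN; lra.
  by exists t' => // s; rewrite E per.
have c0 : 0 <= t / (pi *+ 2) by rewrite divr_ge0// ltW.
have /andP[H1 H2] := truncn_itv c0; set n := Num.truncn _ in H1 H2.
exists (t - n%:R * (pi *+ 2)).
  rewrite ler_pdivlMr// in H1; rewrite ltr_pdivrMr// -natr1 in H2.
  by apply/andP; split; lra.
by move=> s; rewrite -(per s _ n) subrK.
Qed.

Section fixed_function.
Variables (F : d.-tuple R[i] -> R[i]) (rho sigma : R).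
Hypothesis rho1 : 1 < rho.
Hypothesis sigma_gt0 : 0 < sigma.
Hypothesis sigma_rho : sigma < ln rho.
Hypothesis Fan : forall z, bernstein_polyellipse rho z -> analytic_at F z.

Lemma jpoint_polyellipse s t : (forall i, `|s i| <= sigma) ->
  bernstein_polyellipse rho (jpoint s t).
Proof.
move=> hs i; rewrite tnth_jpoint; apply: joukowski_ellipse => //.
exact: le_lt_trans sigma_rho.
Qed.

(** Compactness of the closed polystrip modulo its period turns the local
    expansions into one Taylor estimate. *)
Lemma uniform_taylor : exists eta B : R, [/\ 0 < eta, 0 <= B &
  forall s t i, (forall k, `|s k| <= sigma) ->
  exists2 D : R[i], modulus D <= B & forall a : R[i], modulus a <= eta ->
    modulus (F (upd (jpoint s t) i (joukowski (s i) (t i) + a)) - F (jpoint s t) -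
      a * D) <= B * modulus a ^+ 2].
Proof.
pose Ks := [set v : 'rV[R]_d | forall i, `[- sigma, sigma]%classic (v ord0 i)].
pose Kt := [set v : 'rV[R]_d | forall i, `[0, pi *+ 2]%classic (v ord0 i)].
have cK : compact (Ks `*` Kt).
  apply: compact_setX.
    by apply: (@rV_compact _ _ (fun=> `[- sigma, sigma]%classic)) => _; exact: segment_compact.
  by apply: (@rV_compact _ _ (fun=> `[0, pi *+ 2]%classic)) => _; exact: segment_compact.
pose vs (v : 'rV[R]_d * 'rV[R]_d) i := v.1 ord0 i.
pose vt (v : 'rV[R]_d * 'rV[R]_d) i := v.2 ord0 i.
pose P (n : nat) v := forall i, exists2 D : R[i], modulus D <= n%:R & forall a : R[i],
  modulus a <= n.+1%:R^-1 ->
  modulus (F (upd (jpoint (vs v) (vt v)) i (joukowski (vs v i) (vt v i) + a)) -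
    F (jpoint (vs v) (vt v)) - a * D) <= n%:R * modulus a ^+ 2.
have locP v0 : (Ks `*` Kt) v0 -> \forall v \near v0 & n \near \oo, P n v.
  move=> Kv0; have hv0 i : `|vs v0 i| <= sigma.
    by have := Kv0.1 i; rewrite /= in_itv/= ler_norml.
  have [s [B [s0 B0 H]]] := analytic_taylor (Fan (jpoint_polyellipse (vt v0) hv0)).
  pose E := expR (sigma + 1); have E0 : 0 < E by exact: expR_gt0.
  pose r := Num.min (1 / 2) (s / (4 * E)).
  have r0 : 0 < r by rewrite lt_min !divr_gt0// mulr_gt0.
  have rE : 4 * E * r <= s.
    by rewrite mulrC -ler_pdivlMr ?mulr_gt0// ge_min lexx orbT.
  have r2 : r <= 1 / 2 by rewrite ge_min lexx.
  pose n0 := maxn (Num.bound B) (Num.bound s^-1).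
  exists (ball v0 r, [set n | (n0 <= n)%N]) => /=.
    by split; [exact: nbhsx_ballx|exact: nbhs_infty_ge].
  move=> [v n] /= [[[_ bv1] [_ bv2]]]; rewrite geq_max => /andP[nB ns] i.
  have {}nB : B <= n%:R.
    by rewrite (le_trans (ltW (archi_boundP B0)))// ler_nat.
  have {}ns : n.+1%:R^-1 <= s.
    rewrite -[leRHS]invrK lef_pV2 ?posrE ?invr_gt0//.
    have sV0 : 0 <= s^-1 by rewrite invr_ge0 ltW.
    by rewrite (le_trans (ltW (archi_boundP sV0)))// ler_nat (leq_trans ns).
  have zs k : modulus (tnth (jpoint (vs v) (vt v)) k -
                       tnth (jpoint (vs v0) (vt v0)) k) <= s.
    rewrite !tnth_jpoint.
    have b1 := bv1 ord0 k; have b2 := bv2 ord0 k; rewrite /ball/= in b1 b2.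
    have -> : vs v k = vs v0 k + (vs v k - vs v0 k) by ring.
    have -> : vt v k = vt v0 k + (vt v k - vt v0 k) by ring.
    set h := vs v k - vs v0 k; set e := vt v k - vt v0 k.
    have hr : `|h| <= r by rewrite distrC ltW.
    have er : `|e| <= r by rewrite distrC ltW.
    have h1 : `|vs v0 k + h| <= sigma + 1.
      by rewrite (le_trans (ler_normD _ _))//; have := hv0 k; lra.
    have h2 : `|vs v0 k| <= sigma + 1 by have := hv0 k; lra.
    rewrite (le_trans (distm_triangle _ (joukowski (vs v0 k + h) (vt v0 k)) _))//.
    have L1 := joukowski_lip_t (vt v0 k) h1 (le_trans er r2).
    have L2 := joukowski_lip_s (vt v0 k) h2 (le_trans hr r2).
    rewrite (le_trans (lerD L1 L2))// -/E.
    have := ler_wpM2l (ltW E0) hr; have := ler_wpM2l (ltW E0) er; lra.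
  have [D DB HD] := H _ i zs.
  exists D; first exact: le_trans nB.
  move=> a ha; have := HD a (le_trans ha ns); rewrite tnth_jpoint => /le_trans; apply.
  by rewrite ler_wpM2r// sqr_ge0.
have /compact_near_coveringP /(_ nat \oo P _ locP) := cK.
move=> [n0 _ /(_ n0 (leqnn _)) KP].
exists n0.+1%:R^-1, n0%:R; split; rewrite ?invr_gt0//.
move=> s t i hs.
have /choice[t' Ht'] : forall k, exists t' : R, 0 <= t' <= pi *+ 2 /\
    forall u : R, joukowski u t' = joukowski u (t k).
  by move=> k; have [t' h1 h2] := joukowski_reduce (t k); exists t'.
pose v : 'rV[R]_d * 'rV[R]_d := (\row_k s k, \row_k t' k).
have Kv : (Ks `*` Kt) v.
  split=> k; rewrite mxE /= in_itv/=; first by rewrite -ler_norml.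
  by have [] := Ht' k.
have vE : jpoint (vs v) (vt v) = jpoint s t.
  by apply: eq_from_tnth => k; rewrite !tnth_jpoint /vs /vt !mxE/=; have [_ ->] := Ht' k.
have := KP v Kv i; rewrite /P vE /vs /vt !mxE/=.
by have [_ ->] := Ht' i.
Qed.

(** Composition of the Taylor estimate of F with those of the Joukowski map. *)
Lemma strip_smooth (S : R) :
  (forall z, bernstein_polyellipse rho z -> modulus (F z) <= S) ->
  exists A delta : R, [/\ 0 <= A, 0 < delta &
    forall s t i, (forall k, k != i -> `|s k| <= sigma) ->
      smooth_strip sigma S A delta
        (fun a b => F (jpoint (updf s i a) (updf t i b)))].
Proof.
move=> FS; have [eta [B [eta0 B0 H]]] := uniform_taylor.
pose E := expR sigma; have E0 : 0 < E by exact: expR_gt0.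
pose delta := Num.min (1 / 2) (eta / (2 * E)).
have delta0 : 0 < delta by rewrite lt_min !divr_gt0// mulr_gt0.
exists (B * (4 * E ^+ 2 + 2 * E)), delta; split => //.
  by rewrite mulr_ge0// addr_ge0// mulr_ge0// ?exprn_ge0// ltW.
move=> s t i hs.
have hsa a : `|a| <= sigma -> forall k, `|updf s i a k| <= sigma.
  by move=> ha k; rewrite /updf; case: eqP => // /eqP; exact: hs.
split.
- by move=> a b ha; apply: FS; apply: jpoint_polyellipse; exact: hsa.
- by move=> a b; rewrite !jpoint_updf joukowski_period.
- by move=> b; rewrite !jpoint_updf !joukowski0 cosN.
move=> a b ha.
have [D DB HD] := H _ (updf t i b) i (hsa a ha).
have updi T (u : 'I_d -> T) c : updf u i c i = c by rewrite /updf eqxx.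
rewrite !updi in HD.
have key (al J' : R[i]) (h : R) : `|h| <= delta -> modulus al <= 2 * E * `|h| ->
    modulus (al - J') <= 2 * E * h ^+ 2 ->
    modulus (F (upd (jpoint s t) i (joukowski a b + al)) -
      F (jpoint (updf s i a) (updf t i b)) - J' * D) <=
    B * (4 * E ^+ 2 + 2 * E) * h ^+ 2.
  move=> hd hal hJ.
  have al_eta : modulus al <= eta.
    rewrite (le_trans hal)// mulrC -ler_pdivlMr ?mulr_gt0//.
    by rewrite (le_trans hd)// ge_min lexx orbT.
  have := HD al al_eta; rewrite upd_jpoint_updf => H1.
  set X := F _ in H1 *; set Y := F _ in H1 *.
  have -> : X - Y - J' * D = (X - Y - al * D) + (al - J') * D by ring.
  rewrite (le_trans (modulusD _ _))// modulusM.
  have H2 : modulus al ^+ 2 <= (2 * E * `|h|) ^+ 2.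
    by rewrite lerXn2r ?nnegrE ?modulus_ge0 ?mulr_ge0// ltW.
  rewrite exprMn real_normK ?num_real// in H2.
  have H3 : modulus (al - J') * modulus D <= 2 * E * h ^+ 2 * B.
    by rewrite ler_pM ?modulus_ge0.
  have := ler_wpM2l B0 H2; lra.
exists (joukowski' a b * D); split => [h hd _|e ed].
- have h2 : `|h| <= 1 / 2 by rewrite (le_trans hd)// ge_min lexx.
  have T1 := joukowski_taylor_s b ha h2; rewrite -/E mulrA [E * 2]mulrC in T1.
  have := key (joukowski (a + h) b - joukowski a b) (h%:C * joukowski' a b) h hd
    (joukowski_lip_s b ha h2) T1.
  rewrite (_ : joukowski a b + _ = joukowski (a + h) b); last by ring.
  by rewrite -!jpoint_updf -[_ * D]mulrA.
- have e2 : `|e| <= 1 / 2 by rewrite (le_trans ed)// ge_min lexx.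
  have e1 : `|e| <= 1 by lra.
  have T2 : modulus (joukowski a (b + e) - joukowski a b - 'i * e%:C * joukowski' a b)
      <= 2 * E * e ^+ 2.
    rewrite (le_trans (joukowski_taylor_t b ha e1))// -/E.
    by rewrite ler_wpM2r ?sqr_ge0//; lra.
  have := key (joukowski a (b + e) - joukowski a b) ('i * e%:C * joukowski' a b) e ed
    (joukowski_lip_t b ha e2) T2.
  rewrite (_ : joukowski a b + _ = joukowski a (b + e)); last by ring.
  by rewrite -!jpoint_updf -[_ * D]mulrA.
Qed.

End fixed_function.
End polystrip.

(** * Tensor-product approximation *)

Section polynomials_in_cosines.
Context {R : realType}.
Variable d : nat.
Implicit Types (p q : mpoly d R) (v : 'I_d -> R) (i : 'I_d).

Lemma msizeM_le_deg j k p q : (msize p <= j.+1)%N -> (msize q <= k.+1)%N ->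
  (msize (p * q)%R <= (j + k).+1)%N.
Proof.
move=> pj qk; have [->|p0] := eqVneq p 0; first by rewrite mul0r msize0.
have [->|q0] := eqVneq q 0; first by rewrite mulr0 msize0.
rewrite msizeM//; apply: (@leq_trans (j.+1 + k.+1).-1); last by rewrite addSn addnS.
by rewrite -!subn1 leq_sub2r// leq_add.
Qed.

Lemma msizeD_le_deg k p q : (msize p <= k)%N -> (msize q <= k)%N ->
  (msize (p + q)%R <= k)%N.
Proof. by move=> pk qk; rewrite (leq_trans (mmeasureD_le _ _ _))// geq_max pk. Qed.

(** The three-term recurrence of the Chebyshev polynomials. *)
Lemma cheb_mpoly i k : exists T : mpoly d R, (msize T <= k.+1)%N /\
  forall v (t : R), v i = cos t -> meval v T = cos (k%:R * t).
Proof.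
suff [T [T' [H _]]] : exists T T' : mpoly d R,
    ((msize T <= k.+1)%N /\
     forall v (t : R), v i = cos t -> meval v T = cos (k%:R * t)) /\
    ((msize T' <= k.+2)%N /\
     forall v (t : R), v i = cos t -> meval v T' = cos (k.+1%:R * t)) by exists T.
elim: k => [|k [T [T' [[T1 T2] [T1' T2']]]]].
  exists 1, (mpolyX R (mnm1 i)); split.
    by rewrite msize1; split => // v t _; rewrite meval1 mul0r cos0.
  by rewrite msizeX mdeg1; split => // v t vt; rewrite mevalXU mul1r.
exists T', (2 *: (mpolyX R (mnm1 i) * T') - T); split => //; split.
  apply: msizeD_le_deg.
    rewrite (leq_trans (msizeZ_le _ _))//.
    by rewrite (@msizeM_le_deg 1 k.+1)// msizeX mdeg1.
  by rewrite mmeasureN (leq_trans T1)// leqW.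
move=> v t vt; rewrite mevalB mevalZ mevalM mevalXU (T2 v t)// (T2' v t)// vt.
have -> : k%:R * t = k.+1%:R * t - t by rewrite -[k.+1%:R]natr1; ring.
have -> : k.+2%:R * t = k.+1%:R * t + t by rewrite -[k.+2%:R]natr1; ring.
by rewrite cosB cosD; ring.
Qed.

Lemma kernel_mpoly i n (a : R) : exists K : mpoly d R, (msize K <= n.+1)%N /\
  forall v (t : R), v i = cos t -> meval v K = chebyshev_kernel n a t.
Proof.
elim: n => [|n [K [K1 K2]]].
  exists 1; rewrite msize1; split => // v t _.
  by rewrite meval1 /chebyshev_kernel big_ord0 mulr0 addr0.
have [T [T1 T2]] := cheb_mpoly i n.+1.
exists (K + (2 * cos (n.+1%:R * a)) *: T); split.
  apply: msizeD_le_deg; first by rewrite (leq_trans K1)// leqW.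
  exact: leq_trans (msizeZ_le _ _) T1.
move=> v t vt; rewrite mevalD mevalZ (K2 v t)// (T2 v t)//.
by rewrite /chebyshev_kernel big_ord_recr/=; ring.
Qed.

Lemma meval_bounded p : exists W : R,
  forall v, (forall i, `|v i| <= 1) -> `|meval v p| <= W.
Proof.
exists (\sum_(m <- msupp p) `|mcoeff m p|) => v hv.
rewrite mevalE (le_trans (ler_norm_sum _ _ _))//; apply: ler_sum => m _.
rewrite normrM ler_piMr// normr_prod; apply: Num.Theory.prodr_ile1 => i _.
by rewrite normr_ge0 normrX exprn_ile1.
Qed.

End polynomials_in_cosines.

Section tensor_approximation.
Context {R : realType}.
Local Open Scope complex_scope.
Variable d : nat.
Implicit Types (s t y : 'I_d -> R) (a b : R) (i : 'I_d) (m : nat).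

(** The bound M of the combination is a separate hypothesis: it is meant for a
    difference that is much smaller than its terms. *)
Lemma smooth_strip_comb (I : Type) (r : seq I) (c : I -> R)
    (G0 : R -> R -> R[i]) (G : I -> R -> R -> R[i]) (sigma S A delta M W : R) :
  0 <= A -> smooth_strip sigma S A delta G0 ->
  (forall l, smooth_strip sigma S A delta (G l)) ->
  \sum_(l <- r) `|c l| <= W ->
  (forall a b, `|a| <= sigma ->
     modulus (G0 a b - \sum_(l <- r) (c l)%:C * G l a b) <= M) ->
  smooth_strip sigma M (A * (1 + W)) delta
    (fun a b => G0 a b - \sum_(l <- r) (c l)%:C * G l a b).
Proof.
move=> A0 s0 sG cW HM; split => //.
- move=> a b; case: s0 => _ -> _ _; congr (_ - _); apply: eq_bigr => l _.
  by case: (sG l) => _ -> _ _.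
- move=> b; case: s0 => _ _ -> _; congr (_ - _); apply: eq_bigr => l _.
  by case: (sG l) => _ _ -> _.
move=> a b ha; case: s0 => _ _ _ /(_ a b ha)[D0 [D1 D2]].
have /choice[D HD] : forall l, exists D : R[i],
    (forall h, `|h| <= delta -> `|a + h| <= sigma ->
       modulus (G l (a + h) b - G l a b - h%:C * D) <= A * h ^+ 2) /\
    (forall e, `|e| <= delta ->
       modulus (G l a (b + e) - G l a b - 'i * e%:C * D) <= A * e ^+ 2).
  by move=> l; case: (sG l) => _ _ _ /(_ a b ha).
have key (X0 Y0 k : R[i]) (X Y : I -> R[i]) (B : R) : 0 <= B ->
    modulus (X0 - Y0 - k * D0) <= A * B ->
    (forall l, modulus (X l - Y l - k * D l) <= A * B) ->
    modulus (X0 - \sum_(l <- r) (c l)%:C * X l -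
       (Y0 - \sum_(l <- r) (c l)%:C * Y l) -
       k * (D0 - \sum_(l <- r) (c l)%:C * D l)) <= A * (1 + W) * B.
  move=> B0 H0 H.
  have -> : X0 - \sum_(l <- r) (c l)%:C * X l -
       (Y0 - \sum_(l <- r) (c l)%:C * Y l) -
       k * (D0 - \sum_(l <- r) (c l)%:C * D l) =
     (X0 - Y0 - k * D0) - \sum_(l <- r) (c l)%:C * (X l - Y l - k * D l).
    have -> : \sum_(l <- r) (c l)%:C * (X l - Y l - k * D l) =
      \sum_(l <- r) (c l)%:C * X l - \sum_(l <- r) (c l)%:C * Y l -
       k * \sum_(l <- r) (c l)%:C * D l.
      rewrite mulr_sumr -!sumrB; apply: eq_bigr => l _; ring.
    move: (\sum_(l <- r) _) (\sum_(l <- r) _) (\sum_(l <- r) _) => u1 u2 u3.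
    ring.
  rewrite (le_trans (modulusB _ _))// mulrDr mulrDl mulr1 lerD//.
  rewrite (le_trans (modulus_sum _ _ _))//.
  rewrite (@le_trans _ _ (\sum_(l <- r) `|c l| * (A * B)))//.
    by apply: ler_sum => l _; rewrite modulusM modulus_real ler_wpM2l.
  rewrite -mulr_suml [leRHS](_ : _ = W * (A * B)); last by ring.
  by rewrite ler_wpM2r// mulr_ge0.
exists (D0 - \sum_(l <- r) (c l)%:C * D l); split => [h h1 h2|e he].
  apply: key; rewrite ?sqr_ge0//; first exact: D1.
  by move=> l; case: (HD l) => H _; exact: H.
apply: key; rewrite ?sqr_ge0//; first exact: D2.
by move=> l; case: (HD l) => _ H; exact: H.
Qed.

Definition freeze m (y s : 'I_d -> R) : 'I_d -> R :=
  fun i => if (i < m)%N then y i else s i.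

Section fixed_function.
Variables (F : d.-tuple R[i] -> R[i]) (rho sigma S : R) (n : nat).
Hypothesis rho1 : 1 < rho.
Hypothesis sigma_gt0 : 0 < sigma.
Hypothesis sigma_rho : sigma < ln rho.
Hypothesis Fan : forall z, bernstein_polyellipse rho z -> analytic_at F z.
Hypothesis FS : forall z, bernstein_polyellipse rho z -> modulus (F z) <= S.
Let x : R := expR (- sigma).
Let E : R := 2 * S * (x ^+ n.+1 / (1 - x)).
Let kappa : R := 1 + 2 * x / (1 - x).

(** A pair (q, y) stands for the polynomial q in the cosines of the first m
    variables, multiplied by F with its first m variables frozen at the sample y. *)
Definition sample_sum (l : seq (mpoly d R * ('I_d -> R))) m s t : R[i] :=
  \sum_(qy <- l) (meval (cos \o t) qy.1)%:C *
     F (jpoint (freeze m (fun=> 0) s) (freeze m qy.2 t)).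

(** A further variable adds the error E of the one-variable approximation and
    multiplies the previous error by kappa, a bound for its norm. *)
Fixpoint sample_error m : R :=
  if m is m'.+1 then E + kappa * sample_error m' else 0.

Let S0 : 0 <= S.
Proof.
apply: le_trans (modulus_ge0 _) (FS (z := jpoint (fun=> 0) (fun=> 0)) _).
by apply: (@jpoint_polyellipse _ _ _ sigma) => // i; rewrite normr0 ltW.
Qed.
Let x01 : 0 <= x < 1. Proof. by rewrite expR_ge0 expR_lt1 oppr_lt0. Qed.
Let kappa1 : 1 <= kappa.
Proof.
by rewrite lerDl divr_ge0 ?mulr_ge0//; case/andP: x01 => // _ /ltW; rewrite subr_ge0.
Qed.
Let E0 : 0 <= E.
Proof.
rewrite /E !mulr_ge0 ?exprn_ge0//; first by case/andP: x01.
by rewrite invr_ge0 subr_ge0; case/andP: x01 => _ /ltW.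
Qed.

Lemma sample_error_ge0 m : 0 <= sample_error m.
Proof. by elim: m => //= m IH; rewrite addr_ge0// mulr_ge0// (le_trans ler01). Qed.

(** If G approximates F in the first m variables and T is the discrete Chebyshev
    operator in the next one, then F - T G = (F - T F) + T (F - G). *)
Lemma sample_approx m : (m <= d)%N -> forall eps, 0 < eps ->
  exists l : seq (mpoly d R * ('I_d -> R)),
  [/\ forall qy, qy \in map fst l -> (msize qy <= (m * n).+1)%N,
      forall q, q \in map fst l -> forall t t' : 'I_d -> R,
        (forall i, (i < m)%N -> t i = t' i) ->
        meval (cos \o t) q = meval (cos \o t') q
    & forall s t, (forall i, `|s i| <= sigma) ->
        (forall i, (i < m)%N -> 0 <= t i <= pi) ->
        modulus (F (jpoint (freeze m (fun=> 0) s) t) - sample_sum l m s t) <=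
          sample_error m + eps].
Proof.
elim: m => [_ eps eps0|m IH md eps eps0].
  exists [:: (1, fun=> 0)]; split => [q|q|s t hs ht].
  - by rewrite inE => /eqP->; rewrite msize1.
  - by rewrite inE => /eqP-> t t' _; rewrite !meval1.
  rewrite /sample_sum big_seq1 /= meval1 mul1r.
  by rewrite (_ : freeze 0 _ t = t) ?subrr ?modulus0 ?add0r ?ltW//; exact/funext.
pose i := Ordinal md.
have i_m (j : 'I_d) : (j < m.+1)%N = (j == i) || (j < m)%N.
  by rewrite ltnS leq_eqVlt.
have [A [delta [A0 delta0 HA]]] := strip_smooth rho1 sigma_rho Fan FS.
pose eps1 := eps / (4 * kappa).
have k0 : 0 < kappa by exact: lt_le_trans kappa1.
have eps10 : 0 < eps1 by rewrite divr_gt0// mulr_gt0.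
have [l [l1 l2 l3]] := IH (ltnW md) _ eps10.
have [W HW] : exists W : R, forall t, \sum_(qy <- l) `|meval (cos \o t) qy.1| <= W.
  elim: (l) => [|qy l' [W HW]]; first by exists 0 => t; rewrite big_nil.
  have [W' HW'] := meval_bounded qy.1; exists (W' + W) => t.
  by rewrite big_cons lerD// HW'// => j; exact: cos_max.
have W0 : 0 <= W by apply: le_trans (HW (fun=> 0)); apply: sumr_ge0.
pose M1 := sample_error m + eps1.
have M10 : 0 <= M1 by rewrite addr_ge0 ?sample_error_ge0// ltW.
have tau0 : 0 < eps / 4 by rewrite divr_gt0.
have AW0 : 0 <= A * (1 + W) by rewrite mulr_ge0// addr_ge0.
have [Q1 HQ1] := discrete_cheb_approx n sigma_gt0 delta0 A0 S0 tau0.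
have [Q2 HQ2] := discrete_cheb_approx n sigma_gt0 delta0 AW0 M10 tau0.
pose Q := maxn Q1 Q2; pose N := Q.*2.+1.
have {}HQ1 := HQ1 Q (leq_maxl _ _); have {}HQ2 := HQ2 Q (leq_maxr _ _).
have /choice[K HK] : forall j : nat, exists K : mpoly d R, (msize K <= n.+1)%N /\
    forall v (t : R), v i = cos t -> meval v K = chebyshev_kernel n (node N j) t.
  by move=> j; exact: kernel_mpoly.
(* sampling the m-th variable at all nodes, with weight 1 / N *)
pose l' := [seq (N%:R^-1 *: (qy.1 * K j), updf qy.2 i (node N j)) |
             qy <- l, j <- iota 0 N].
have l'P q : q \in map fst l' -> exists2 q0, q0 \in map fst l & exists j,
    q = N%:R^-1 *: (q0 * K j).
  move=> /mapP[/= _ /allpairsPdep[[q0 y] [j [ql _ ->]]] ->] /=.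
  by exists q0; [exact: (map_f fst ql)|exists j].
exists l'; split.
- move=> q /l'P[q0 q0l [j ->]]; rewrite (leq_trans (msizeZ_le _ _))//.
  by rewrite mulSn addnC msizeM_le_deg ?l1//; case: (HK j).
- move=> q /l'P[q0 q0l [j ->]] t t' tt'; rewrite !mevalZ !mevalM.
  rewrite (l2 q0 q0l t t') => [|k km]; last by apply: tt'; rewrite i_m km orbT.
  have [_ HKj] := HK j; congr (_ * (_ * _)).
  by rewrite (HKj _ (t i))// (HKj _ (t' i))// tt'// i_m eqxx.
move=> s t hs ht.
have hs' (y : 'I_d -> R) k : k != i -> `|freeze m (fun=> 0) s k| <= sigma.
  by move=> _; rewrite /freeze; case: ifP => // _; rewrite normr0 ltW.
pose s' := freeze m (fun=> 0) s.
pose G0 := fun a b => F (jpoint (updf s' i a) (updf t i b)).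
pose G := fun (qy : mpoly d R * ('I_d -> R)) a b =>
  F (jpoint (updf s' i a) (updf (freeze m qy.2 t) i b)).
pose c := fun qy : mpoly d R * ('I_d -> R) => meval (cos \o t) qy.1.
have freeze_upd (y u : 'I_d -> R) (v : R) :
    freeze m y (updf u i v) = updf (freeze m y u) i v.
  apply/funext => k; rewrite /freeze /updf.
  by have [->|//] := eqVneq k i; rewrite ltnn.
have sG0 : smooth_strip sigma S A delta G0 by exact: HA (hs' t).
have sG qy : smooth_strip sigma S A delta (G qy) by exact: HA (hs' t).
have sg : smooth_strip sigma M1 (A * (1 + W)) delta
    (fun a b => G0 a b - \sum_(qy <- l) (c qy)%:C * G qy a b).
  apply: (smooth_strip_comb A0 sG0 sG (HW t)) => a b ha.
  have := l3 (updf s i a) (updf t i b).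
  rewrite freeze_upd -/s' -/(G0 a b).
  rewrite (_ : sample_sum _ _ _ _ = \sum_(qy <- l) (c qy)%:C * G qy a b).
    apply; first by move=> k; rewrite /updf; case: ifP.
    move=> k km; rewrite /updf; case: eqP => [ki|_]; first by rewrite ki ltnn in km.
    by apply: ht; rewrite i_m km orbT.
  rewrite /sample_sum [LHS]big_seq [RHS]big_seq; apply: eq_bigr => qy qyl.
  rewrite !freeze_upd -/s'; congr (_%:C * _).
  apply: (l2 _ (map_f fst qyl)) => k km; rewrite /updf; case: eqP => // ki.
  by rewrite ki ltnn in km.
have [H1 _] := HQ1 _ sG0; have [_ H2] := HQ2 _ sg.
have ti : 0 <= t i <= pi by apply: ht; rewrite i_m eqxx.
have {}H1 := H1 (t i) ti; have {}H2 := H2 (t i).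
have updii T (u : 'I_d -> T) : updf u i (u i) = u.
  by apply/funext => k; rewrite /updf; case: eqP => // ->.
have sS : freeze m.+1 (fun=> 0) s = updf s' i 0.
  by apply/funext => k; rewrite /freeze /updf i_m; case: eqP.
have -> : F (jpoint (freeze m.+1 (fun=> 0) s) t) = G0 0 (t i) by rewrite sS /G0 updii.
set g := fun a b => _ in sg H2.
have sumE : sample_sum l' m.+1 s t = discrete_cheb Q n G0 (t i) - discrete_cheb Q n g (t i).
  rewrite /discrete_cheb -/N -meanB.
  transitivity (mean N (fun j => \sum_(qy <- l) (c qy)%:C * G qy 0 (node N j) *
       (chebyshev_kernel n (node N j) (t i))%:C)).
    rewrite /sample_sum /l' big_allpairs_dep /mean.
    under [RHS]eq_bigr do rewrite mulr_sumr.
    rewrite [RHS]exchange_big; apply: eq_bigr => qy _.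
    rewrite -[iota 0 N]/(index_iota 0 N) big_mkord; apply: eq_bigr => j _ /=.
    rewrite mevalZ mevalM; have [_ HKj] := HK j; rewrite (HKj _ (t i))//.
    rewrite sS (_ : freeze m.+1 _ t = updf (freeze m qy.2 t) i (node N j)).
      by rewrite -/(G qy 0 (node N j)) -/(c qy) !realcM fmorphV rmorph_nat; ring.
    by apply/funext => k; rewrite /freeze /updf i_m; case: eqP.
  congr mean; apply/funext => j; rewrite /g -mulr_suml.
  by move: (\sum_(qy <- l) _) => u; ring.
rewrite sumE.
have -> : G0 0 (t i) - (discrete_cheb Q n G0 (t i) - discrete_cheb Q n g (t i)) =
  (G0 0 (t i) - discrete_cheb Q n G0 (t i)) + discrete_cheb Q n g (t i) by ring.
rewrite (le_trans (modulusD _ _))// (le_trans (lerD H1 H2))//.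
rewrite -/x -/E -/kappa /M1 /=.
have : eps1 * kappa = eps / 4 by rewrite /eps1; field; rewrite gt_eqF.
lra.
Qed.

End fixed_function.
End tensor_approximation.

(** * Polynomial approximation on the cube *)

Section polynomial_approximation.
Context {R : realType}.
Local Open Scope complex_scope.

(** With z = 1 / (1 - x), kappa = (1 + x) z is at most 2 z. *)
Lemma sample_error_le (sigma S : R) n m : 0 < sigma -> 0 <= S ->
  sample_error sigma S n m.+1 <=
    m.+1%:R * 2 ^+ m.+1 * S * (expR (- sigma) ^+ n.+1 / (1 - expR (- sigma)) ^+ m.+1).
Proof.
move=> sigma0 S0; set x := expR (- sigma).
have x0 : 0 <= x by exact: expR_ge0.
have x1 : 0 < 1 - x by rewrite subr_gt0 expR_lt1 oppr_lt0.
have y0 : (1 - x) != 0 by rewrite gt_eqF.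
elim: m => [|m IH].
  by rewrite /= -/x mulr0 addr0 !expr1 mul1r mulrA.
rewrite (_ : sample_error sigma S n m.+2 = 2 * S * (x ^+ n.+1 / (1 - x)) +
  (1 + 2 * x / (1 - x)) * sample_error sigma S n m.+1)//.
set e := sample_error _ _ _ _ in IH *.
have -> : 1 + 2 * x / (1 - x) = (1 + x) / (1 - x) by field.
set z := (1 - x)^-1; have z0 : 0 < z by rewrite invr_gt0.
have z1 : 1 <= z.
  by rewrite /z -[leLHS]invr1 lef_pV2 ?posrE//; lra.
have k2 : (1 + x) * z <= 2 * z by rewrite ler_wpM2r ?(ltW z0)//; lra.
have H1 : (1 + x) * z * e <= 2 * z * (m.+1%:R * 2 ^+ m.+1 * S * (x ^+ n.+1 * z ^+ m.+1)).
  apply: (@le_trans _ _ ((1 + x) * z * (m.+1%:R * 2 ^+ m.+1 * S * (x ^+ n.+1 * z ^+ m.+1)))).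
    rewrite ler_wpM2l//; first by rewrite mulr_ge0 ?(ltW z0)// addr_ge0.
    by rewrite /z exprVn.
  rewrite ler_wpM2r// !mulr_ge0 ?exprn_ge0// ltW//.
have H2 : 2 * S * (x ^+ n.+1 * z) <= 2 ^+ m.+2 * S * (x ^+ n.+1 * z ^+ m.+2).
  have : S * (x ^+ n.+1 * z) * 2 <= S * (x ^+ n.+1 * z) * (2 ^+ m.+2 * z ^+ m.+1).
    rewrite ler_wpM2l//; first by rewrite !mulr_ge0 ?exprn_ge0// ltW.
    rewrite -[leLHS]mulr1 ler_pM ?exprn_ege1//.
    by rewrite exprS ler_peMr// exprn_ege1// ler1n.
  by rewrite [z ^+ m.+2]exprS; lra.
have -> : m.+2%:R * 2 ^+ m.+2 * S * (x ^+ n.+1 / (1 - x) ^+ m.+2) =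
   2 ^+ m.+2 * S * (x ^+ n.+1 * z ^+ m.+2) +
   2 * z * (m.+1%:R * 2 ^+ m.+1 * S * (x ^+ n.+1 * z ^+ m.+1)).
  by rewrite -exprVn -/z -[m.+2%:R]natr1 [2 ^+ m.+2]exprS [z ^+ m.+2]exprS; ring.
exact: lerD.
Qed.

(** The estimates hold on closed strips, that is for sigma < ln rho; the rate is
    continuous in sigma. *)
Lemma rate_continuous (rho C eps : R) n d : 1 < rho -> 0 < eps ->
  exists2 sigma, 0 < sigma < ln rho &
    C * (expR (- sigma) ^+ n.+1 / (1 - expR (- sigma)) ^+ d) <=
    C * ((rho^-1) ^+ n.+1 / (1 - rho^-1) ^+ d) + eps.
Proof.
move=> rho1 eps0; have rho0 : 0 < rho by lra.
pose g (x : R) := C * (x ^+ n.+1 / (1 - x) ^+ d).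
have rV1 : rho^-1 < 1 by rewrite invf_lt1.
have rV0 : 0 < rho^-1 by rewrite invr_gt0.
have c1 : (1 - x : R) @[x --> rho^-1] --> 1 - rho^-1.
  by apply: cvgB; [exact: cvg_cst|exact: cvg_id].
have c2 : (1 - x : R) ^+ d @[x --> rho^-1] --> (1 - rho^-1) ^+ d.
  exact: (@cvg_comp _ _ _ (fun x : R => 1 - x) (fun x : R => x ^+ d) _ _ _ c1
    (@exprn_continuous R d (1 - rho^-1))).
have cg : g x @[x --> rho^-1] --> g rho^-1.
  apply: cvgMr; apply: cvgM; first exact: exprn_continuous.
  apply: cvgV; first by rewrite expf_neq0// gt_eqF// subr_gt0.
  exact: c2.
have /nbhs_ballP[r /= r0 Hr] : \forall x \near rho^-1, g x < g rho^-1 + eps.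
  by apply: (cvgr_lt _ cg); rewrite ltrDl.
pose m := Num.min (r / 2) ((1 - rho^-1) / 2).
have m0 : 0 < m by rewrite lt_min !divr_gt0// subr_gt0.
pose x := rho^-1 + m.
have x1 : x < 1.
  have : m <= (1 - rho^-1) / 2 by rewrite ge_min lexx orbT.
  by rewrite /x; lra.
have x0 : 0 < x by rewrite /x addr_gt0.
exists (- ln x).
  rewrite oppr_gt0 ln_lt0 ?x0//= -lnV ?posrE//.
  by rewrite ltr_ln ?posrE ?invr_gt0// -[ltRHS]invrK ltf_pV2 ?posrE// /x ltrDl.
rewrite opprK lnK ?posrE// ltW//; apply: Hr.
rewrite /ball/= /x opprD addNKr normrN gtr0_norm//.
have : m <= r / 2 by rewrite ge_min lexx.
lra.
Qed.

(** At s = 0 the samples are points of the cube, so the coefficients are values of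
    f and the approximation is a real polynomial. *)
Lemma polynomial_approx d n (rho : R) (f : euclid R d -> R) F : (0 < d)%N ->
  1 < rho -> bounded_analytic_extension rho F f -> forall eps, 0 < eps ->
  exists p : mpoly d R, (msize p <= (d * n).+1)%N /\
    forall z : euclid R d, (forall i, -1 <= Defs.coord z i <= 1) ->
      `|f z - peval p z| <= d%:R * 2 ^+ d * sup_norm rho F *
        (rho ^- n / ((rho - 1) * (1 - rho^-1) ^+ (d - 1))) + eps.
Proof.
move=> d0 rho1 [Fan [S0 FS0] Ff] eps eps0.
have rho0 : 0 < rho by lra.
pose S := sup_norm rho F.
have FS z : bernstein_polyellipse rho z -> modulus (F z) <= S.
  move=> hz; apply: ub_le_sup; last by exists z.
  by exists S0 => _ [w hw <-]; exact: FS0.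
have S_ge0 : 0 <= S.
  apply: le_trans (modulus_ge0 _) (FS (jpoint (fun=> 0) (fun=> 0)) _).
  by apply: (@jpoint_polyellipse _ _ _ 0) => [||i]; rewrite ?ln_gt0 ?normr0.
have eps20 : 0 < eps / 2 by rewrite divr_gt0.
have [sigma /andP[sigma0 sigma_rho] rate] :=
  @rate_continuous rho (d%:R * 2 ^+ d * S) (eps / 2) n d rho1 eps20.
have [l [l1 _ l3]] := sample_approx n rho1 sigma0 sigma_rho Fan FS (leqnn d) eps20.
exists (\sum_(qy <- l) f [tuple cos (qy.2 i) | i < d] *: qy.1); split.
  rewrite (leq_trans (mmeasure_sum _ _ _ _))//; apply/bigmax_leqP_seq => qy qyl _.
  by rewrite (leq_trans (msizeZ_le _ _))// l1// map_f.
move=> z hz; pose t i := acos (Defs.coord z i).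
have ct i : cos (t i) = Defs.coord z i by rewrite acosK// in_itv/= hz.
have /= := l3 (fun=> 0) t; rewrite normr0.
move=> /(_ (fun=> ltW sigma0)).
have ht (i : 'I_d) : (i < d)%N -> 0 <= t i <= pi.
  by move=> _; rewrite acos_ge0 ?acos_lepi.
move=> /(_ ht).
have frz (u : 'I_d -> R) (v : 'I_d -> R) : freeze d u v = u.
  by apply/funext => i; rewrite /freeze ltn_ord.
have real_jpoint (u : 'I_d -> R) :
    F (jpoint (fun=> 0) u) = (f [tuple cos (u i) | i < d])%:C.
  rewrite -Ff; last by move=> i; rewrite /Defs.coord tnth_mktuple cos_geN1 cos_le1.
  congr F; apply: eq_from_tnth => i; rewrite tnth_jpoint tnth_mktuple joukowski0.
  by rewrite /Defs.coord tnth_mktuple.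
rewrite frz real_jpoint (_ : [tuple cos (t i) | i < d] = z); last first.
  by apply: eq_from_tnth => i; rewrite tnth_mktuple ct.
have -> : sample_sum F l d (fun=> 0) t =
    (peval (\sum_(qy <- l) f [tuple cos (qy.2 i) | i < d] *: qy.1) z)%:C.
  rewrite /sample_sum /peval (big_morph (meval (Defs.coord z)) (mevalD _) (meval0 _)) (rmorph_sum (real_complex R)).
  apply: eq_bigr => qy _; rewrite !frz real_jpoint -realcM; congr (_%:C).
  by rewrite mevalZ mulrC; congr (_ * _); apply: meval_eq => i /=; exact: ct.
move=> H; have {H} : `|f z - peval (\sum_(qy <- l) f [tuple cos (qy.2 i) | i < d] *: qy.1) z|
    <= sample_error sigma S n d + eps / 2.
  rewrite -modulus_real (_ : (_ - _)%:C = (f z)%:C -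
   (peval (\sum_(qy <- l) f [tuple cos (qy.2 i) | i < d] *: qy.1) z)%:C)//.
  by apply: complex_ext => /=; ring.
move=> /le_trans; apply.
have -> : rho ^- n / ((rho - 1) * (1 - rho^-1) ^+ (d - 1)) =
    rho^-1 ^+ n.+1 / (1 - rho^-1) ^+ d.
  case: d d0 {Fan FS0 Ff S0 S FS S_ge0 rate l l1 l3 z hz t ct ht frz real_jpoint f F} => // d _.
  rewrite subn1 /= [(1 - rho^-1) ^+ d.+1]exprS [rho^-1 ^+ n.+1]exprS exprVn.
  field; rewrite ?expf_neq0 ?gt_eqF ?subr_gt0 ?invf_lt1//.
have := @sample_error_le sigma S n d.-1 sigma0 S_ge0; rewrite prednK// => H.
by have := le_trans H rate; rewrite -/S; lra.
Qed.

End polynomial_approximation.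

(** * Jacobi polynomials *)

Section jacobi_polynomials.
Context {R : realType}.
Implicit Types (a b x t : R) (n k s : nat).

Definition jacobi_coef n a b s : R :=
  gbinomial (n%:R + a) (n - s) * gbinomial (n%:R + b) s.

(** The argument 2 |x|^2 - 1 of the expansions makes t = |x|^2 the natural variable. *)
Definition jacobi_poly n a b : {poly R} :=
  \sum_(s < n.+1) jacobi_coef n a b s *: (('X - 1) ^+ s * 'X ^+ (n - s)).

Lemma jacobi_polyE n a b t : jacobi n a b (2 * t - 1) = (jacobi_poly n a b).[t].
Proof.
rewrite /jacobi /jacobi_poly horner_sum; apply: eq_bigr => s _.
have -> : ((jacobi_coef n a b s) *: (('X - 1) ^+ s * 'X ^+ (n - s))).[t] =
    jacobi_coef n a b s * ((t - 1) ^+ s * t ^+ (n - s)).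
  by rewrite hornerZ hornerM !horner_exp !hornerE.
have -> : (2 * t - 1 - 1) / 2 = t - 1 by lra.
have -> : (2 * t - 1 + 1) / 2 = t by lra.
by rewrite mulrA.
Qed.

Lemma gbinomialS x k : gbinomial x k.+1 * k.+1%:R = gbinomial x k * (x - k%:R).
Proof.
rewrite /gbinomial big_ord_recr /= factS natrM.
have k0 : k.+1%:R != 0 :> R by rewrite pnatr_eq0.
have f0 : k`!%:R != 0 :> R by rewrite pnatr_eq0 -lt0n fact_gt0.
move: (\prod_(i < k) _) (k.+1%:R) (k`!%:R) k0 f0 => p y z y0 z0.
by field; rewrite y0 z0.
Qed.

Lemma gbinomial_gt0 x k : (forall i, (i < k)%N -> i%:R < x) -> 0 < gbinomial x k.
Proof.
move=> H; rewrite divr_gt0 ?ltr0n ?fact_gt0// prodr_gt0// => i _.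
by rewrite subr_gt0 H.
Qed.

Lemma jacobi_coefS n a b s : (s < n)%N ->
  jacobi_coef n a b s.+1 * (s.+1%:R * (s.+1%:R + a)) =
  jacobi_coef n a b s * ((n - s)%:R * ((n - s)%:R + b)).
Proof.
move=> sn; rewrite /jacobi_coef -[(n - s)%N]prednK ?subn_gt0//.
have -> : (n - s).-1 = (n - s.+1)%N by rewrite subnS.
have H1 := gbinomialS (n%:R + a) (n - s.+1).
have H2 := gbinomialS (n%:R + b) s.
have E : (n - s.+1)%:R = n%:R - s%:R - 1 :> R by rewrite natrB// -natr1; ring.
have E1 : (n - s.+1).+1%:R = n%:R - s%:R :> R by rewrite -natr1 E; ring.
rewrite E1 E in H1 *; rewrite -[s.+1%:R]natr1 in H2 *.
set g1 := gbinomial _ (n - s.+1).+1 in H1 *.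
set g2 := gbinomial _ s.+1 in H2 *.
set g3 := gbinomial _ (n - s.+1) in H1 *; set g4 := gbinomial _ s in H2 *.
transitivity (g3 * (s%:R + 1 + a) * (g2 * (s%:R + 1))); first by ring.
rewrite H2.
transitivity (g1 * (n%:R - s%:R) * (g4 * (n%:R - s%:R + b))); last by ring.
by rewrite H1; ring.
Qed.

Lemma jacobi_coef_gt0 n a b s : -1 < a -> -1 < b -> (s <= n)%N ->
  0 < jacobi_coef n a b s.
Proof.
move=> a1 b1 sn; rewrite mulr_gt0// gbinomial_gt0// => i hi.
  have : i.+1%:R <= n%:R :> R by rewrite ler_nat (leq_trans hi)// leq_subr.
  by rewrite -natr1; lra.
have : i.+1%:R <= n%:R :> R by rewrite ler_nat (leq_trans hi).
by rewrite -natr1; lra.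
Qed.

(** For a, b > -1 all the coefficients jacobi_coef are positive, so that the polynomial
    of index i has degree i exactly. *)
Lemma jacobi_poly_span (P : {poly R} -> Prop) a b j : -1 < a -> -1 < b ->
  P 0 -> (forall p q, P p -> P q -> P (p + q)) ->
  (forall c p, P p -> P (c *: p)) ->
  (forall i, (i <= j)%N -> P (jacobi_poly i a b)) ->
  forall p : {poly R}, (size p <= j.+1)%N -> P p.
Proof.
move=> a1 b1 P0 PD PZ PJ.
have monic_term n s : (s <= n)%N ->
    (('X - 1) ^+ s * 'X ^+ (n - s) : {poly R}) \is monic /\
    size (('X - 1) ^+ s * 'X ^+ (n - s) : {poly R}) = n.+1.
  move=> sn; have m1 : (('X - 1) ^+ s : {poly R}) \is monic.
    by rewrite -polyC1 monic_exp// monicXsubC.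
  split; first by rewrite rpredM// monicXn.
  rewrite size_monicM ?monicXn// ?monic_neq0 ?monicXn// -polyC1 size_exp_XsubC size_polyXn.
  by rewrite addnS /= addSn subnKC.
have size_J n : (size (jacobi_poly n a b) <= n.+1)%N.
  rewrite /jacobi_poly (leq_trans (size_sum _ _ _))//; apply/bigmax_leqP => s _.
  by rewrite (leq_trans (size_scale_leq _ _))// (monic_term _ _ _).2// -ltnS.
have lead_J n : 0 < (jacobi_poly n a b)`_n.
  rewrite /jacobi_poly coef_sum.
  rewrite (eq_bigr (fun s : 'I_n.+1 => jacobi_coef n a b s)) => [|s _].
    rewrite big_ord_recl ltr_pwDl// ?jacobi_coef_gt0// sumr_ge0// => s _.
    by rewrite ltW// jacobi_coef_gt0// lift0.
  have [mon sz] := @monic_term n s (ltn_ord s); rewrite coefZ.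
  by have /monicP := mon; rewrite /lead_coef sz /= => ->; rewrite mulr1.
elim: j PJ => [|j IH] PJ p sp.
  have -> : p = (p`_0 / (jacobi_poly 0 a b)`_0) *: jacobi_poly 0 a b.
    rewrite [in LHS](size1_polyC sp) [jacobi_poly 0 a b](size1_polyC (size_J 0%N)).
    rewrite coefC eqxx -mul_polyC -polyCM divfK//.
    by rewrite gt_eqF.
  by apply: PZ; exact: PJ.
set c := p`_j.+1 / (jacobi_poly j.+1 a b)`_j.+1.
have -> : p = (p - c *: jacobi_poly j.+1 a b) + c *: jacobi_poly j.+1 a b by rewrite subrK.
apply: PD; last by apply: PZ; exact: PJ.
apply: IH => [i ij|]; first by apply: PJ; rewrite leqW.
apply/leq_sizeP => i; rewrite leq_eqVlt => /predU1P[<-|ji].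
  by rewrite coefB coefZ /c divfK ?subrr// gt_eqF.
rewrite coefB coefZ !(@nth_default _ 0 _ i) ?mulr0 ?subrr//.
  exact: leq_trans (size_J _) ji.
exact: leq_trans sp ji.
Qed.

(** With u = 'X - 1 and t = 'X, the derivation u t d/d'X multiplies a product of
    powers of u and t by a linear form in u and t, so that the second-order operator,
    times u t, multiplies it by a quadratic form.  Summing over the
    expansion, the recurrence of the coefficients collects all terms into the
    eigenvalue. *)
Lemma jacobi_poly_ode n a b :
  let P := jacobi_poly n a b in
  'X * (1 - 'X) * P^`()^`() + ((b + 1) *: (1 - 'X) - (a + 1) *: 'X) * P^`() =
  - (n%:R * (n%:R + a + b + 1)) *: P.
Proof.
move=> P; have [u uE] : exists u : {poly R}, u = 'X - 1 by exists ('X - 1).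
have [t tE] : exists t : {poly R}, t = 'X by exists 'X.
have du : u^`() = 1 by rewrite uE derivB derivX -polyC1 derivC subr0.
have dt : t^`() = 1 by rewrite tE derivX.
have u0 : u != 0 by rewrite uE -polyC1 polyXsubC_eq0.
have t0 : t != 0 by rewrite tE polyX_eq0.
pose theta (p : {poly R}) := u * t * p^`().
pose e i k := u ^+ i * t ^+ k.
have theta_e i k : theta (e i k) = (i%:R * t + k%:R * u) * e i k.
  have dX (v : {poly R}) m : v * (v ^+ m)^`() = m%:R * v^`() * v ^+ m.
    case: m => [|m]; first by rewrite expr0 -polyC1 derivC mulr0 !mul0r.
    by rewrite deriv_exp -mulr_natl exprS /=; ring.
  rewrite /theta /e derivM.
  transitivity (t * t ^+ k * (u * (u ^+ i)^`()) + u * u ^+ i * (t * (t ^+ k)^`())).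
    by ring.
  by rewrite !dX du dt; ring.
have op_e i k : let y := e i k in
    u * t * (t * (1 - t) * y^`()^`() + ((b + 1) *: (1 - t) - (a + 1) *: t) * y^`()) =
    - ((i%:R * (i%:R + a))%:P * (t ^+ 2 * y) + (k%:R * (k%:R + b))%:P * (u ^+ 2 * y) +
       (i%:R + k%:R + i%:R * (k%:R + b) + k%:R * (i%:R + a))%:P * (u * t * y)).
  move=> y.
  have T1 : u * t * y^`() = (i%:R * t + k%:R * u) * y by exact: theta_e.
  clearbody y.
  have T2 : (u * t) * (u * t * y^`()^`()) =
      u * t * (i%:R + k%:R) * y + (i%:R * t + k%:R * u) ^+ 2 * y
      - (u + t) * ((i%:R * t + k%:R * u) * y).
    have D1 : (t + u) * y^`() + u * t * y^`()^`() =
        (i%:R + k%:R) * y + (i%:R * t + k%:R * u) * y^`().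
      have := congr1 (fun p : {poly R} => p^`()) T1.
      have dn m : (m%:R : {poly R})^`() = 0 by rewrite -polyC_natr derivC.
      rewrite !(derivM, derivD) du dt !dn => H; transitivity ((1 * t + u * 1) * y^`() + u * t * y^`()^`()); first by ring.
      by rewrite H; ring.
    have -> : u * t * y^`()^`() = (i%:R + k%:R) * y + (i%:R * t + k%:R * u) * y^`()
       - (t + u) * y^`() by rewrite -D1; ring.
    transitivity (u * t * (i%:R + k%:R) * y + (i%:R * t + k%:R * u) * (u * t * y^`())
       - (t + u) * (u * t * y^`())); first by ring.
    by rewrite T1; ring.
  have -> : u * t * (t * (1 - t) * y^`()^`() +
      ((b + 1) *: (1 - t) - (a + 1) *: t) * y^`()) =
    - (u * t * (u * t * y^`()^`())) -
      ((b%:P + 1) * u + (a%:P + 1) * t) * (u * t * y^`()).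
    rewrite -!mul_polyC !polyCD (_ : 1 - t = - u); last by rewrite uE tE; ring.
    by ring.
  rewrite T2 T1 !(polyCD, polyCM, polyC_natr); ring.
have sum_op (c : 'I_n.+1 -> R) (f : 'I_n.+1 -> {poly R}) :
    u * t * (t * (1 - t) * (\sum_s c s *: f s)^`()^`() +
    ((b + 1) *: (1 - t) - (a + 1) *: t) * (\sum_s c s *: f s)^`()) =
    \sum_s c s *: (u * t * (t * (1 - t) * (f s)^`()^`() +
    ((b + 1) *: (1 - t) - (a + 1) *: t) * (f s)^`())).
  have dsum (h : 'I_n.+1 -> {poly R}) :
      (\sum_s c s *: h s)^`() = \sum_s c s *: (h s)^`().
    by rewrite (raddf_sum (@deriv R)); apply: eq_bigr => s _; rewrite /= derivZ.
  rewrite !dsum.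
  rewrite !mulr_sumr -big_split mulr_sumr; apply: eq_bigr => s _ /=.
  by rewrite -!scalerAr -scalerDr -scalerAr.
have ut0 : u * t != 0 by rewrite mulf_neq0.
apply: (mulfI ut0); rewrite {1 2}/P /jacobi_poly -uE -tE sum_op.
pose g s : {poly R} := (jacobi_coef n a b s)%:P.
pose A1 s : {poly R} := (s%:R * (s%:R + a))%:P.
pose B1 s : {poly R} := ((n - s)%:R * ((n - s)%:R + b))%:P.
have rec s : (s < n)%N -> g s.+1 * A1 s.+1 = g s * B1 s.
  by move=> sn; rewrite /g /A1 /B1 -!polyCM jacobi_coefS.
transitivity (- (\sum_(s < n.+1) g s * A1 s * (t ^+ 2 * e s (n - s)%N) +
   \sum_(s < n.+1) g s * B1 s * (u ^+ 2 * e s (n - s)%N) +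
   \sum_(s < n.+1) g s * (s%:R + (n - s)%:R + s%:R * ((n - s)%:R + b) +
       (n - s)%:R * (s%:R + a))%:P * (u * t * e s (n - s)%N))).
  rewrite -!big_split -sumrN; apply: eq_bigr => s _ /=.
  by rewrite -/(e s (n - s)%N) op_e -mul_polyC -/(g s) /A1 /B1; ring.
(* the two off-diagonal sums, shifted by one index *)
have -> : \sum_(s < n.+1) g s * A1 s * (t ^+ 2 * e s (n - s)%N) =
    \sum_(s < n.+1) g s * B1 s * (u * t * e s (n - s)%N).
  rewrite big_ord_recl {1}/A1 mul0r polyC0 mulr0 mul0r add0r.
  rewrite [RHS]big_ord_recr /= {2}/B1 subnn mul0r polyC0 mulr0 mul0r addr0.
  apply: eq_bigr => s _; rewrite /= /bump /= add1n -rec//; congr (_ * _).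
  by rewrite /e -[(n - s)%N]prednK ?subn_gt0// -subnS !exprS; ring.
have -> : \sum_(s < n.+1) g s * B1 s * (u ^+ 2 * e s (n - s)%N) =
    \sum_(s < n.+1) g s * A1 s * (u * t * e s (n - s)%N).
  rewrite [RHS]big_ord_recl {1}/A1 mul0r polyC0 mulr0 mul0r add0r.
  rewrite big_ord_recr /= {2}/B1 subnn mul0r polyC0 mulr0 mul0r addr0.
  apply: eq_bigr => s _; rewrite /= /bump /= add1n -rec//; congr (_ * _).
  by rewrite /e -[(n - s)%N]prednK ?subn_gt0// -subnS !exprS; ring.
rewrite -!big_split -sumrN -scalerAr /P /jacobi_poly mulr_sumr scaler_sumr.
apply: eq_bigr => s _ /=; rewrite -uE -tE -/(e s (n - s)%N) -!mul_polyC.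
rewrite /g /A1 /B1 natrB; last by rewrite -ltnS.
rewrite !(polyCM, polyCD, polyCB, polyCN, polyC_natr); ring.
Qed.

End jacobi_polynomials.

(** * Solid harmonics and the ball operator *)

Section harmonic_polynomials.
Context {R : realType}.
Variable d : nat.
Implicit Types (p q h : mpoly d R) (phi : {poly R}) (l k n : nat) (i j : 'I_d).
Local Notation X i := (mpolyX R (mnm1 i)).

Definition sqnorm_poly : mpoly d R := \sum_(i < d) X i ^+ 2.
Local Notation r2 := sqnorm_poly.

Definition euler p : mpoly d R := \sum_(i < d) X i * mderiv i p.

Definition radial phi : mpoly d R := horner_alg r2 phi.

Lemma mderiv_var i j : mderiv i (X j) = (i == j)%:R.
Proof.
rewrite mderivX mnm1E eq_sym; have [->|_] := eqVneq i j; last by rewrite scale0r.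
rewrite scale1r -[RHS]mpolyX0; congr mpolyX.
by apply/mnmP => k; rewrite !mnmE subnn.
Qed.

Lemma mderiv_sqnorm i : mderiv i r2 = 2 *: X i.
Proof.
rewrite (raddf_sum (mderiv i)) /= (bigD1 i)//= big1 => [|j ji].
  by rewrite addr0 expr2 mderivM mderiv_var eqxx mul1r mulr1 -mulr2n scaler_nat.
by rewrite expr2 mderivM mderiv_var eq_sym (negbTE ji) mulr0 mul0r addr0.
Qed.

Lemma radialC c : radial c%:P = mpolyC d c.
Proof. by rewrite /radial horner_algC -mul_mpolyC mulr1. Qed.

Lemma radialX : radial 'X = r2.
Proof. exact: horner_algX. Qed.

Lemma radialD : {morph radial : p q / p + q}.
Proof. exact: rmorphD. Qed.

Lemma radialM : {morph radial : p q / p * q}.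
Proof. exact: rmorphM. Qed.

Lemma radialZ c phi : radial (c *: phi) = c *: radial phi.
Proof. by rewrite -mul_polyC radialM radialC mul_mpolyC. Qed.

Lemma radialXn n : radial 'X^n = r2 ^+ n.
Proof. by rewrite /radial rmorphXn /= horner_algX. Qed.

Lemma mderiv_radial i phi : mderiv i (radial phi) = 2 *: (X i * radial phi^`()).
Proof.
elim/poly_ind: phi => [|phi c IH].
  by rewrite deriv0 -polyC0 radialC mpolyC0 mderiv0 mulr0 scaler0.
rewrite radialD radialM radialX radialC mderivD mderivC addr0 mderivM IH mderiv_sqnorm.
rewrite derivD derivC addr0 derivM derivX mulr1 radialD radialM radialX.
by rewrite -!mul_mpolyC !mpolyC_nat; ring.
Qed.

Lemma laplacianM p q : laplacian (p * q) =
  laplacian p * q + p * laplacian q + 2 *: \sum_(i < d) mderiv i p * mderiv i q.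
Proof.
rewrite /laplacian mulr_suml mulr_sumr scaler_sumr -!big_split /=.
apply: eq_bigr => i _; rewrite mderivM mderivD !mderivM scaler_nat.
move: (mderiv i (mderiv i p)) (mderiv i (mderiv i q)) (mderiv i p) (mderiv i q) => u v w z.
by ring.
Qed.

Lemma laplacianD p q : laplacian (p + q) = laplacian p + laplacian q.
Proof. by rewrite /laplacian -big_split; apply: eq_bigr => i _; rewrite !mderivD. Qed.

Lemma laplacianZ c p : laplacian (c *: p) = c *: laplacian p.
Proof. by rewrite /laplacian scaler_sumr; apply: eq_bigr => i _; rewrite !mderivZ. Qed.

Lemma laplacian_radial phi :
  laplacian (radial phi) = radial (4%:P * 'X * phi^`()^`() + (2 * d%:R)%:P * phi^`()).
Proof.
rewrite /laplacian (eq_bigr (fun i => 2 *: radial phi^`() +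
    4 *: (X i ^+ 2 * radial phi^`()^`()))) => [|i _]; last first.
  rewrite mderiv_radial mderivZ mderivM mderiv_var eqxx mul1r mderiv_radial.
  by rewrite -!mul_mpolyC !mpolyC_nat; ring.
rewrite big_split /= sumr_const card_ord -scaler_sumr -mulr_suml -/r2.
rewrite radialD !radialM !radialC radialX -!mul_mpolyC mpolyCM mpolyC_nat.
by rewrite -mulr_natl; ring.
Qed.

Lemma eulerM p q : euler (p * q) = euler p * q + p * euler q.
Proof.
rewrite /euler mulr_suml mulr_sumr -big_split /=; apply: eq_bigr => i _.
by rewrite mderivM; ring.
Qed.

Lemma eulerD p q : euler (p + q) = euler p + euler q.
Proof.
by rewrite /euler -big_split /=; apply: eq_bigr => i _; rewrite mderivD mulrDr.
Qed.

Lemma eulerZ c p : euler (c *: p) = c *: euler p.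
Proof.
by rewrite /euler scaler_sumr; apply: eq_bigr => i _; rewrite mderivZ scalerAr.
Qed.

Lemma euler_radial phi : euler (radial phi) = radial (2%:P * 'X * phi^`()).
Proof.
rewrite /euler (eq_bigr (fun i => X i ^+ 2 * (2 *: radial phi^`()))) => [|i _].
  by rewrite -mulr_suml -/r2 !radialM radialC radialX -mul_mpolyC; ring.
by rewrite mderiv_radial -!mul_mpolyC; ring.
Qed.

Lemma euler_homog l p : p \is ishomog1 l mdeg -> euler p = l%:R *: p.
Proof.
move=> /dhomogP pl; rewrite [in LHS](mpolyE p) [p in RHS]mpolyE.
have -> : euler (\sum_(m <- msupp p) mcoeff m p *: mpolyX R m) =
    \sum_(m <- msupp p) mcoeff m p *: euler (mpolyX R m).
  elim: (msupp p) => [|m s IH].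
    by rewrite !big_nil /euler big1// => i _; rewrite mderiv0 mulr0.
  by rewrite !big_cons eulerD eulerZ IH.
rewrite scaler_sumr [LHS]big_seq [RHS]big_seq; apply: eq_bigr => m mp.
rewrite scalerA mulrC -scalerA; congr (_ *: _).
have /= <- := pl m mp; rewrite mdegE natr_sum scaler_suml; apply: eq_bigr => i _.
rewrite mderivX -scalerAr; have [->|mi] := eqVneq (m i) 0%N; first by rewrite !scale0r.
by congr (_ *: _); rewrite -mpolyXD addmC submK// lep1mP.
Qed.

Lemma mderiv_homog i l p : p \is ishomog1 l.+1 mdeg -> mderiv i p \is ishomog1 l mdeg.
Proof.
move=> /dhomogP pl; apply/dhomogP => m; rewrite mcoeff_msupp mcoeff_mderiv.
move=> /eqP H; have /pl : mnm_add m (mnm1 i) \in msupp p.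
  by rewrite mcoeff_msupp; apply/eqP => E; apply: H; rewrite E mul0rn.
by rewrite /= mdegD mdeg1 addn1 => -[].
Qed.

Lemma mderiv_homog0 i p : p \is ishomog1 0 mdeg -> mderiv i p = 0.
Proof.
move=> /dhomogP p0; apply/mpolyP => m; rewrite mcoeff_mderiv mcoeff0.
have [E|E] := eqVneq (mcoeff (mnm_add m (mnm1 i)) p) 0; first by rewrite E mul0rn.
have /p0 : mnm_add m (mnm1 i) \in msupp p by rewrite mcoeff_msupp.
by rewrite /= mdegD mdeg1 addn1.
Qed.

Lemma laplacian_homog l p : p \is ishomog1 l.+2 mdeg -> laplacian p \is ishomog1 l mdeg.
Proof.
move=> pl; rewrite /laplacian; apply: rpred_sum => i _.
by apply: mderiv_homog; exact: mderiv_homog.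
Qed.

Lemma laplacian_homog_small l p : (l < 2)%N -> p \is ishomog1 l mdeg -> laplacian p = 0.
Proof.
case: l => [|[|//]] _ pl; rewrite /laplacian big1// => i _.
  by rewrite (mderiv_homog0 i pl) mderiv0.
exact/mderiv_homog0/mderiv_homog.
Qed.

Lemma sqnorm_poly_homog : r2 \is ishomog1 2 mdeg.
Proof.
apply: rpred_sum => i _; apply: (@dhomogMn _ _ _ 1 _ 2).
by rewrite dhomogX /= mdeg1.
Qed.

Lemma laplacian_harmonic_radial l h phi : solid_harmonic l h ->
  laplacian (h * radial phi) = h * radial (4%:P * 'X * phi^`()^`() +
    (2 * d%:R + 4 * l%:R)%:P * phi^`()).
Proof.
move=> [hl h0]; rewrite laplacianM h0 mul0r add0r laplacian_radial.
have -> : \sum_(i < d) mderiv i h * mderiv i (radial phi) =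
    2 *: (euler h * radial phi^`()).
  rewrite /euler mulr_suml scaler_sumr; apply: eq_bigr => i _.
  by rewrite mderiv_radial -!mul_mpolyC; ring.
rewrite (euler_homog hl) !radialD !radialM !radialC radialX -!mul_mpolyC.
by rewrite !(mpolyCD, mpolyCM, mpolyC_nat); ring.
Qed.

(** With w the weight, this is w^-1 div ((1 - |x|^2) w grad p). *)
Definition ball_operator (alpha : R) p : mpoly d R :=
  (1 - r2) * laplacian p - (alpha + 2) *: euler p.

Definition ball_eigenvalue (alpha : R) l n : R :=
  4 * n%:R * (n%:R + alpha / 2 + d%:R / 2 + l%:R) + (alpha + 2) * l%:R.

Definition ball_mpoly (alpha : R) l n h : mpoly d R :=
  h * radial (jacobi_poly n (alpha / 2) (d%:R / 2 + l%:R - 1)).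

Lemma ball_operator_eigen (alpha : R) l n h : solid_harmonic l h ->
  ball_operator alpha (ball_mpoly alpha l n h) =
  - ball_eigenvalue alpha l n *: ball_mpoly alpha l n h.
Proof.
move=> hl; rewrite /ball_operator /ball_mpoly; set phi := jacobi_poly _ _ _.
rewrite (laplacian_harmonic_radial _ hl) eulerM (euler_homog hl.1) euler_radial.
have ode := jacobi_poly_ode n (alpha / 2) (d%:R / 2 + l%:R - 1).
rewrite /= -/phi in ode.
have E : (1 - 'X) * (4%:P * 'X * phi^`()^`() + (2 * d%:R + 4 * l%:R)%:P * phi^`()) -
   (alpha + 2)%:P * (l%:R%:P * phi + 2%:P * 'X * phi^`()) =
   (- ball_eigenvalue alpha l n)%:P * phi.
  transitivity (4%:P * ('X * (1 - 'X) * phi^`()^`() +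
    (((d%:R / 2 + l%:R - 1 + 1)%:P * (1 - 'X)) - (alpha / 2 + 1)%:P * 'X) * phi^`())
    - ((alpha + 2) * l%:R)%:P * phi).
    have -> : (2 * d%:R + 4 * l%:R)%:P = 4%:P * (d%:R / 2 + l%:R - 1 + 1)%:P :> {poly R}.
      by rewrite -polyCM; congr polyC; lra.
    have -> : (alpha + 2)%:P = 2%:P * (alpha / 2 + 1)%:P :> {poly R}.
      by rewrite -polyCM; congr polyC; lra.
    have -> : ((alpha + 2) * l%:R)%:P = 2%:P * (alpha / 2 + 1)%:P * l%:R%:P :> {poly R}.
      by rewrite -!polyCM; congr polyC; lra.
    have -> : 4%:P = 2%:P * 2%:P :> {poly R} by rewrite -polyCM; congr polyC; lra.
    ring.
  rewrite !mul_polyC ode -!mul_polyC mulrA -polyCM -mulrBl -polyCB; congr (_%:P * _).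
  by rewrite /ball_eigenvalue; lra.
have := congr1 radial E.
have radialN (q : {poly R}) : radial (- q) = - radial q by exact: rmorphN.
rewrite !(radialD, radialM, radialN, radialC, radialX) => E'.
rewrite -!mul_mpolyC.
transitivity (h * ((mpolyC d 1 - r2) * (mpolyC d 4 * r2 * radial phi^`()^`() +
  mpolyC d (2 * d%:R + 4 * l%:R) * radial phi^`()) -
  mpolyC d (alpha + 2) * (mpolyC d l%:R * radial phi + mpolyC d 2 * r2 * radial phi^`()))).
  by rewrite mpolyC1; ring.
by rewrite E' [LHS]mulrCA.
Qed.

Lemma laplacian_pow l h n : solid_harmonic l h ->
  laplacian (r2 ^+ n.+1 * h) =
  (2 * n.+1%:R * (d%:R + 2 * l%:R + 2 * n%:R)) *: (r2 ^+ n * h).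
Proof.
move=> hl; rewrite mulrC -radialXn (laplacian_harmonic_radial _ hl).
have dXn m : ('X^m : {poly R})^`() = m%:R%:P * 'X^(m.-1).
  by rewrite derivXn -mulr_natl polyC_natr.
rewrite dXn derivM derivC mul0r add0r dXn [n.+1.-1]/=.
have -> : 4%:P * 'X * (n.+1%:R%:P * (n%:R%:P * 'X^(n.-1))) +
    (2 * d%:R + 4 * l%:R)%:P * (n.+1%:R%:P * 'X^n) =
    (2 * n.+1%:R * (d%:R + 2 * l%:R + 2 * n%:R))%:P * 'X^n :> {poly R}.
  transitivity ((4 * n.+1%:R * n%:R)%:P * ('X * 'X^(n.-1)) +
     ((2 * d%:R + 4 * l%:R) * n.+1%:R)%:P * 'X^n : {poly R}).
    by rewrite !polyCM; ring.
  have [->|n0] := posnP n.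
    by rewrite !mulr0 mul0r add0r addr0; congr (_%:P * _); lra.
  rewrite -exprS prednK// -mulrDl -polyCD; congr (_%:P * _); lra.
rewrite mul_polyC radialZ radialXn -scalerAr; congr (_ *: _); exact: mulrC.
Qed.

Lemma iter_laplacian_pow l h m : (0 < d)%N -> solid_harmonic l h ->
  exists2 c : R, c != 0 & iter m laplacian (r2 ^+ m * h) = c *: h.
Proof.
move=> d0 hl; elim: m => [|m [c c0 IH]].
  by exists 1; rewrite ?oner_neq0// expr0 mul1r scale1r.
exists (2 * m.+1%:R * (d%:R + 2 * l%:R + 2 * m%:R) * c).
  have pos : 0 < d%:R + 2 * l%:R + 2 * m%:R :> R.
    by rewrite -addrA ltr_pwDl ?ltr0n// addr_ge0// mulr_ge0.
  by rewrite mulf_neq0// gt_eqF// !mulr_gt0// ltr0n.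
have iterZ a p k : iter k (@laplacian R d) (a *: p) = a *: iter k laplacian p.
  by elim: k => //= k ->; rewrite laplacianZ.
by rewrite iterSr (laplacian_pow _ hl) iterZ IH scalerA.
Qed.

Lemma iter_laplacian_homog m k p : p \is ishomog1 k mdeg -> (2 * m <= k)%N ->
  iter m laplacian p \is ishomog1 (k - 2 * m)%N mdeg.
Proof.
move=> pk; elim: m => [|m IH] mk; first by rewrite muln0 subn0.
rewrite iterS; apply: laplacian_homog.
have -> : (k - 2 * m.+1).+2 = (k - 2 * m)%N by lia.
by apply: IH; lia.
Qed.

Lemma iter_laplacian_homog0 m k p : p \is ishomog1 k mdeg -> (k < 2 * m)%N ->
  iter m laplacian p = 0.
Proof.
move=> pk; elim: m => [|m IH] mk; first by lia.
rewrite iterS; have [km|mk2] := ltnP k (2 * m).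
  by rewrite IH// /laplacian big1// => i _; rewrite !mderiv0.
apply: (laplacian_homog_small (l := (k - 2 * m)%N)); first by lia.
exact: iter_laplacian_homog.
Qed.

(** Almansi: the last nonzero iterated Laplacian of a homogeneous polynomial is
    harmonic, and subtracting a multiple of it times a power of |x|^2 lowers the
    order of polyharmonicity. *)
Lemma almansi (P : mpoly d R -> Prop) K : (0 < d)%N -> P 0 ->
  (forall p q, P p -> P q -> P (p + q)) ->
  (forall (j l : nat) h, (l + 2 * j <= K)%N -> solid_harmonic l h -> P (r2 ^+ j * h)) ->
  forall p, (msize p <= K.+1)%N -> P p.
Proof.
move=> d0 P0 PD PH.
have homog m k p : (k <= K)%N -> p \is ishomog1 k mdeg -> iter m laplacian p = 0 -> P p.
  elim: m p => [p _ _ /= ->//|m IH] p kK pk.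
  have [km|mk] := ltnP k (2 * m).
    by move=> _; apply: IH => //; exact: iter_laplacian_homog0 pk km.
  rewrite iterS => H0; pose g := iter m laplacian p.
  have hg : solid_harmonic (k - 2 * m) g by split=> //; exact: iter_laplacian_homog.
  have [c c0 E] := iter_laplacian_pow m d0 hg.
  have Pm : P (r2 ^+ m * (c^-1 *: g)).
    apply: (PH _ (k - 2 * m)%N); first by lia.
    case: hg => hg1 hg2; split; first exact: rpredZ.
    by rewrite laplacianZ hg2 scaler0.
  have -> : p = (p - r2 ^+ m * (c^-1 *: g)) + r2 ^+ m * (c^-1 *: g) by rewrite subrK.
  apply: PD => //; apply: IH => //.
    rewrite rpredB//; have -> : k = (2 * m + (k - 2 * m))%N by lia.
    apply: dhomogM; first exact: (dhomogMn m sqnorm_poly_homog).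
    by apply: rpredZ; case: hg.
  have iterD q1 q2 (j : nat) : iter j (@laplacian R d) (q1 + q2) = iter j laplacian q1 + iter j laplacian q2.
    by elim: j => //= j ->; rewrite laplacianD.
  have iterZ a q (j : nat) : iter j (@laplacian R d) (a *: q) = a *: iter j laplacian q.
    by elim: j => //= j ->; rewrite laplacianZ.
  rewrite -scalerAr -scaleNr iterD iterZ E scalerA mulNr mulVf// scaleN1r -/g.
  by rewrite subrr.
move=> p pK; rewrite (pihomog_partitionE pK).
apply: (big_ind P) => // k _; apply: (homog K.+1 k).
- by rewrite -ltnS.
- exact: pihomogP.
- apply: (iter_laplacian_homog0 (k := k)); first exact: pihomogP.
  by have := ltn_ord k; lia.
Qed.

End harmonic_polynomials.

(** * Iterated integrals over the cube *)

Section tuple_fubini.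
Context {disp : measure_display} {T : measurableType disp} {R : realType}.
Variable mu : {sigma_finite_measure set T -> \bar R}.
Local Open Scope ereal_scope.

Lemma tuple_fubini n (g : n.+1.-tuple T -> \bar R) :
  (tuple_measure mu n.+1).-integrable setT g ->
  \int[tuple_measure mu n.+1]_x g x =
    \int[mu]_a \int[tuple_measure mu n]_y g (tuple_cons (a, y)) /\
  \int[tuple_measure mu n.+1]_x g x =
    \int[tuple_measure mu n]_y \int[mu]_a g (tuple_cons (a, y)).
Proof.
move=> ig; have mcons := @measurable_tuple_cons _ T n.
have /integrableP[mg goo] := ig.
pose f (p : T * n.-tuple T) := g (tuple_cons p).
have mf : measurable_fun setT f by exact: measurableT_comp.
have if_ : (mu \x tuple_measure mu n).-integrable setT f.
  apply/integrableP; split => //.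
  move: goo; rewrite /= /tuple_measure_step ge0_integral_pushforward//.
  exact: measurableT_comp.
have -> : \int[tuple_measure mu n.+1]_x g x = \int[mu \x tuple_measure mu n]_p f p.
  by rewrite /= /tuple_measure_step (integral_pushforward mcons).
by split; [rewrite -(integral12_prod_meas1 if_)|rewrite -(integral21_prod_meas1 if_)].
Qed.

End tuple_fubini.

Section cube_integrals.
Context {R : realType}.
Local Notation mu := (@lebesgue_measure R : {sigma_finite_measure set (measurableTypeR R) -> \bar R}).

Definition cube d : set (euclid R d) := [set x | forall i, -1 <= tnth x i <= 1].

Lemma cubeE d : @cube d = \big[setI/setT]_(i < d) ((fun x => tnth x i) @^-1` `[-1, 1]%classic).
Proof.
apply/seteqP; split => [x cx|x].
  by rewrite -bigcap_seq => i /= _; rewrite in_itv/=; exact: cx.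
by rewrite -bigcap_seq => cx i; have := cx i (mem_index_enum i); rewrite /= in_itv.
Qed.

Lemma measurable_cube d : measurable (@cube d).
Proof.
rewrite cubeE; apply: bigsetI_measurable => i _.
by rewrite -[_ @^-1` _]setTI; apply: measurable_tnth.
Qed.

Lemma lebesgue_cube d : (lebesgue R d (@cube d) < +oo)%E.
Proof.
elim: d => [|d IH].
  by rewrite /lebesgue /= diracE; case: (_ \in _); rewrite ltry.
rewrite /lebesgue /= /tuple_measure_step /pushforward.
have -> : @tuple_cons _ (measurableTypeR R) d @^-1` @cube d.+1 =
    `[-1, 1]%classic `*` @cube d.
  apply/seteqP; split => [[a y] /= H|[a y] /= [ha hy] i].
    split => [|i]; first by have := H ord0; rewrite /= in_itv/= (tnth_nth 0).
    by have := H (lift ord0 i); rewrite !(tnth_nth 0).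
  case: (unliftP ord0 i) => [j ->|->]; last by move: ha; rewrite in_itv/= (tnth_nth 0).
  by have := hy j; rewrite !(tnth_nth 0).
rewrite product_measure1E//; last exact: measurable_cube.
have fin11 : @lebesgue_measure R `[-1, 1]%classic \is a fin_num.
  by rewrite lebesgue_measure_itv/= lte_fin; case: ifP => // _; rewrite -EFinB.
apply: lte_mul_pinfty => //.
Qed.

(** Measurable bounded functions supported in the cube, a class stable under
    freezing coordinates. *)
Definition cube_fun d (g : euclid R d -> R) : Prop :=
  [/\ measurable_fun setT g, exists B, forall x, `|g x| <= B
    & forall x, ~ cube x -> g x = 0].

Lemma cube_fun_integrable d (g : euclid R d -> R) : cube_fun g ->
  (lebesgue R d).-integrable setT (EFin \o g).
Proof.
move=> [mg [B gB] g0].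
have : (lebesgue R d).-integrable (@cube d) (EFin \o g).
  apply: measurable_bounded_integrable.
  - exact: measurable_cube.
  - exact: lebesgue_cube.
  - exact: measurable_funTS.
  - exists B; split; first exact: num_real.
    by move=> y By x _ /=; rewrite (le_trans (gB x))// ltW.
rewrite integrable_mkcond; last exact: measurable_cube.
congr (_.-integrable _ _); apply/funext => x /=.
by rewrite patchE; case: ifPn => //; rewrite notin_setE => /g0 ->.
Qed.

Lemma tnth_cons0 d (a : measurableTypeR R) (y : euclid R d) :
  tnth (tuple_cons (a, y)) ord0 = a.
Proof. by rewrite (tnth_nth 0). Qed.

Lemma tnth_consS d (a : measurableTypeR R) (y : euclid R d) k :
  tnth (tuple_cons (a, y)) (lift ord0 k) = tnth y k.
Proof. by rewrite !(tnth_nth 0). Qed.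

Lemma cons_upd0 d (a : measurableTypeR R) (y : euclid R d) :
  tuple_cons (a, y) = upd (tuple_cons (0 : measurableTypeR R, y)) ord0 a.
Proof.
apply: eq_from_tnth => i; rewrite tnth_upd.
case: (unliftP ord0 i) => [j ->|->]; last by rewrite tnth_cons0.
by rewrite (eq_sym (lift _ _)) (negbTE (neq_lift _ _)) !tnth_consS.
Qed.

Lemma cons_upd_lift d (a b : measurableTypeR R) (y : euclid R d) i :
  tuple_cons (a, upd y i b) = upd (tuple_cons (a, y)) (lift ord0 i) b.
Proof.
apply: eq_from_tnth => j; rewrite tnth_upd.
case: (unliftP ord0 j) => [k ->|->]; last by rewrite (negbTE (neq_lift _ _)) !tnth_cons0.
by rewrite (inj_eq lift_inj) !tnth_consS tnth_upd.
Qed.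

(** Whichever coordinate is integrated first, the iterated integral is the same. *)
Lemma integral_coordinate0 d (i : 'I_d) (g : euclid R d -> R) : cube_fun g ->
  (forall x : euclid R d, (\int[mu]_a (g (upd x i a))%:E = 0)%E) ->
  (\int[lebesgue R d]_x (g x)%:E = 0)%E.
Proof.
elim: d i g => [[]//|d IH] i g cg H.
have ig := cube_fun_integrable cg; have [mg [B gB] g0] := cg.
have [F1 F2] := tuple_fubini ig.
case: (unliftP ord0 i) => [j ij|i0].
- rewrite [LHS]F1 integral0_eq// => a _; apply: (IH j (fun y => g (tuple_cons (a : measurableTypeR R, y)))).
    split; last first.
    + move=> y cy; apply: g0 => cay; apply: cy => k.
      by have := cay (lift ord0 k); rewrite !(tnth_nth 0).
    + by exists B => y.
    apply: (measurableT_comp mg); apply: (measurableT_comp (@measurable_tuple_cons _ _ d)).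
    exact: pair1_measurable.
  move=> y; rewrite -[RHS](H (tuple_cons (a : measurableTypeR R, y))); apply: eq_integral => b _.
  by rewrite cons_upd_lift ij.
- rewrite [LHS]F2 integral0_eq// => y _; rewrite -[RHS](H (tuple_cons (0 : measurableTypeR R, y))); apply: eq_integral => a _.
  by rewrite cons_upd0 i0.
Qed.

End cube_integrals.

(** * Powers of the positive part *)

Section positive_part_power.
Context {R : realType}.
Implicit Types t g : R.

Definition pospow g t : R := Num.max t 0 `^ g.

Lemma pospow_le0 g t : g != 0 -> t <= 0 -> pospow g t = 0.
Proof. by move=> g0 t0; rewrite /pospow (max_idPr t0) powR0. Qed.

Lemma pospow_gt0 g t : 0 < t -> pospow g t = t `^ g.
Proof. by move=> t0; rewrite /pospow (max_idPl (ltW t0)). Qed.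

Lemma pospow_ge0 g t : 0 <= pospow g t.
Proof. exact: powR_ge0. Qed.

Lemma pospowS g t : 0 < g -> pospow (g + 1) t = t * pospow g t.
Proof.
move=> g0; have [t0|t0] := leP t 0.
  by rewrite !pospow_le0 ?mulr0 ?gt_eqF ?addr_gt0.
rewrite !pospow_gt0// powRD; last by rewrite (gt_eqF t0) implybT.
by rewrite powRr1 ?ltW// mulrC.
Qed.

Lemma pospow_small g (e : R) : 0 < g -> 0 < e ->
  exists2 r, 0 < r & forall t, t < r -> pospow g t < e.
Proof.
move=> g0 e0; exists (e `^ g^-1); first by rewrite powR_gt0.
move=> t te; have [t0|t0] := leP t 0; first by rewrite pospow_le0 ?gt_eqF.
rewrite pospow_gt0//.
have := @gt0_ltr_powR _ _ g0 t (e `^ g^-1); rewrite !nnegrE (ltW t0) powR_ge0.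
by move=> /(_ isT isT te); rewrite -powRrM mulVf ?gt_eqF// powRr1// ltW.
Qed.

Lemma continuous_pospow g : 0 < g -> continuous (pospow g : R -> R).
Proof.
move=> g0 t; have [t0|t0] := leP t 0; last first.
  have dt : derivable (fun u : R => u `^ g) t 1 by case: (is_derive1_powR g t0).
  have ct : {for t, continuous (fun u : R => u `^ g)}.
    by apply: differentiable_continuous; apply/derivable1_diffP.
  apply/cvgrPdist_lt => e e0; move/cvgrPdist_lt : ct => /(_ e e0) H.
  near=> u; rewrite !pospow_gt0//; last by near: u; exact: lt_nbhsr.
  by near: u.
apply/cvgrPdist_lt => e e0; rewrite (pospow_le0 _ t0) ?gt_eqF//.
have [r r0 H] := pospow_small g0 e0.
near=> u; rewrite sub0r normrN ger0_norm ?pospow_ge0//; apply: H.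
near: u; apply: lt_nbhsl; exact: le_lt_trans r0.
Unshelve. all: by end_near. Qed.

Lemma is_derive_pospow g t : 0 < g ->
  is_derive t 1 (pospow (g + 1) : R -> R) ((g + 1) * pospow g t).
Proof.
move=> g0; have [t0|t0] := leP t 0; last first.
  have : is_derive t 1 (fun u : R => u `^ (g + 1)) ((g + 1) * pospow g t).
    have := is_derive1_powR (g + 1) t0; rewrite addrK => H.
    by rewrite pospow_gt0.
  apply: near_eq_is_derive; near=> u; rewrite pospow_gt0//.
  by near: u; exact: lt_nbhsr.
rewrite (pospow_le0 _ t0) ?gt_eqF// mulr0.
have cv : h^-1 *: (((pospow (g + 1) : R -> R) \o shift t) (h *: 1) - pospow (g + 1) t)
    @[h --> 0^'] --> (0 : R).
  rewrite (pospow_le0 _ t0) ?gt_eqF ?addr_gt0//.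
  apply/cvgrPdist_lt => e e0; have [r r0 H] := pospow_small g0 e0.
  near=> h; have h0 : h != 0 by near: h; exact: nbhs_dnbhs_neq.
  have hr : `|h| < r.
    by near: h; apply: dnbhs0_lt.
  rewrite sub0r normrN subr0 /= [h *: 1]mulr1 normrM normfV.
  rewrite pospowS// normrM [X in _ * (_ * X)]ger0_norm ?pospow_ge0//.
  have [ht|ht] := leP (h + t) 0.
    by rewrite (pospow_le0 _ ht) ?gt_eqF// !mulr0.
  rewrite mulrA (@le_lt_trans _ _ (1 * pospow g (h + t)))//; last first.
    by rewrite mul1r; apply: H; rewrite (le_lt_trans _ hr)// (le_trans _ (ler_norm _))//; lra.
  rewrite ler_wpM2r ?pospow_ge0// mulrC ler_pdivrMr ?normr_gt0// mul1r.
  by rewrite gtr0_norm// (le_trans _ (ler_norm _))//; lra.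
by apply: DeriveDef; [apply/cvg_ex; exists 0|exact: cvg_lim].
Unshelve. all: by end_near. Qed.

(** The integrand is the derivative of a -> P(a) (c - a^2)_+^(g+1), which vanishes
    off [-1, 1]. *)
Lemma integral_derivative_vanish (c g : R) (P P' : R -> R) : c <= 1 -> 0 < g ->
  (forall a : R, is_derive a 1 P (P' a)) -> (forall a : R, derivable P' a 1) ->
  (\int[@lebesgue_measure R]_a
     (P' a * pospow (g + 1) (c - a ^+ 2) -
      2 * (g + 1) * (a * P a * pospow g (c - a ^+ 2)))%:E = 0)%E.
Proof.
move=> c1 g0 dP dP'.
pose f a := P' a * pospow (g + 1) (c - a ^+ 2) -
  2 * (g + 1) * (a * P a * pospow g (c - a ^+ 2)).
suff : (\int[@lebesgue_measure R]_a (f a)%:E = 0)%E by [].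
pose F a := P a * pospow (g + 1) (c - a ^+ 2).
have f0 a : ~ (-2 <= a <= 2) -> f a = 0.
  move=> ha; have a2 : c - a ^+ 2 <= 0.
    have [|a2] := ltP a (-2); first by nra.
    have [|a2'] := ltP 2 a; first by nra.
    by exfalso; apply: ha; rewrite a2 a2'.
  by rewrite /f !pospow_le0 ?gt_eqF ?addr_gt0// !mulr0 subrr.
have dF (a : R) : is_derive a 1 F (f a).
  have d1 : is_derive a 1 (fun u : R => c - u ^+ 2) (- (2 * a)).
    have H := is_deriveB (is_derive_cst c a 1) (is_deriveX 2 (is_derive_id a (1 : R))).
    by apply: (is_derive_eq H); rewrite /= expr1 sub0r /GRing.scale /= mulr1.
  have H := is_deriveM (dP a) (@is_derive1_comp R (pospow (g + 1)) (fun u : R => c - u ^+ 2) a _ _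
    (is_derive_pospow (c - a ^+ 2) g0) d1).
  by apply: (is_derive_eq H); rewrite /f /= /GRing.scale /=; ring.
have cont (h : R -> R) : (forall a : R, derivable h a 1) -> continuous h.
  by move=> dh a; apply: differentiable_continuous; apply/derivable1_diffP.
have cf : continuous f.
  move=> a; apply: cvgB.
    apply: cvgM; first exact: cont.
    apply: (cvg_comp (fun a : R => c - a ^+ 2) (pospow (g + 1))); last first.
      by apply: continuous_pospow; rewrite addr_gt0.
    by apply: cvgB; [exact: cvg_cst|exact: exprn_continuous].
  apply: cvgMr; apply: cvgM.
    apply: cvgM; first exact: cvg_id.
    by apply: cont => b; case: (dP b).
  apply: (cvg_comp (fun a : R => c - a ^+ 2) (pospow g)); last exact: continuous_pospow.
  by apply: cvgB; [exact: cvg_cst|exact: exprn_continuous].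
have -> : (\int[@lebesgue_measure R]_a (f a)%:E =
    \int[@lebesgue_measure R]_(a in `[(-2)%R, 2%R]) (f a)%:E)%E.
  rewrite [RHS]integral_mkcond; apply: eq_integral => a _.
  rewrite patchE; case: ifPn => //; rewrite notin_setE /= in_itv/= => /negP ha.
  by rewrite f0//; exact/negP.
have cF : continuous F by apply: cont => b; case: (dF b).
rewrite (continuous_FTC2 (F := F))//; first 1 last.
- by lra.
- exact: continuous_subspaceT.
- split; first by move=> a _; case: (dF a).
    exact/cvg_at_right_filter/cF.
  exact/cvg_at_left_filter/cF.
- by move=> a _; rewrite derive1E; case: (dF a).
have F0 a : a ^+ 2 = 4 -> F a = 0.
  by move=> a4; rewrite /F a4 pospow_le0 ?mulr0 ?gt_eqF ?addr_gt0//; lra.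
by rewrite !F0 ?subee//; lra.
Qed.

End positive_part_power.

(** * Weighted integrals of polynomials *)

Section weighted_functional.
Context {R : realType}.
Variables (d : nat) (alpha : R).
Hypothesis alpha_gt0 : 0 < alpha.
Implicit Types (p q h : mpoly d R) (i : 'I_d) (x : euclid R d).
Local Notation X i := (mpolyX R (mnm1 i)).
Local Notation r2 := (sqnorm_poly d).

Let alpha2 : 0 < alpha / 2. Proof. by rewrite divr_gt0. Qed.

Lemma peval_sqnorm x : peval r2 x = sqnorm x.
Proof.
rewrite /peval /sqnorm_poly (big_morph (meval (Defs.coord x)) (mevalD _) (meval0 _)).
by apply: eq_bigr => i _; rewrite expr2 mevalM mevalXU.
Qed.

Lemma pevalD p q x : peval (p + q) x = peval p x + peval q x.
Proof. exact: mevalD. Qed.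

Lemma pevalM p q x : peval (p * q) x = peval p x * peval q x.
Proof. exact: mevalM. Qed.

Lemma pevalZ c p x : peval (c *: p) x = c * peval p x.
Proof. exact: mevalZ. Qed.

Lemma pevalB p q x : peval (p - q) x = peval p x - peval q x.
Proof. exact: mevalB. Qed.

Lemma measurable_peval p : measurable_fun setT (peval p).
Proof.
apply: (eq_measurable_fun (fun x => \sum_(m <- msupp p) mcoeff m p *
    \prod_(i < d) (tnth x i : R) ^+ m i)) => [x _|]; first by rewrite /peval mevalE.
apply: measurable_sum => m; apply: measurable_funM; first exact: measurable_cst.
by apply: measurable_prod => i _; apply: measurable_funX; exact: measurable_tnth.
Qed.

Lemma weightE x : weight alpha x = pospow (alpha / 2) (1 - sqnorm x).
Proof. by []. Qed.

Lemma measurable_weight : measurable_fun setT (@weight R d alpha).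
Proof.
apply: (measurableT_comp (f := pospow (alpha / 2))).
  by apply: continuous_measurable_fun; exact: continuous_pospow.
apply: measurable_funB => //; apply: (eq_measurable_fun (peval r2)).
  by move=> x _; rewrite peval_sqnorm.
exact: measurable_peval.
Qed.

Lemma sqnorm_ge0 x : 0 <= sqnorm x.
Proof. by apply: sumr_ge0 => i _; exact: sqr_ge0. Qed.

Lemma sqnorm_coord x i : Defs.coord x i ^+ 2 <= sqnorm x.
Proof.
by rewrite /sqnorm (bigD1 i)//= lerDl; apply: sumr_ge0 => j _; exact: sqr_ge0.
Qed.

Lemma unit_ball_cube x : unit_ball x -> cube x.
Proof.
move=> /= x1 i; have := sqnorm_coord x i; rewrite -/(Defs.coord x i) => H.
have : Defs.coord x i ^+ 2 <= 1 by exact: le_trans H (ltW x1).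
by rewrite -real_normK ?num_real// expr_le1// ler_norml.
Qed.

Lemma weight0 x : ~ unit_ball x -> weight alpha x = 0.
Proof.
move=> /negP; rewrite -leNgt => x1; rewrite weightE pospow_le0 ?gt_eqF//.
by rewrite subr_le0.
Qed.

Lemma weight_ge0 x : 0 <= weight alpha x.
Proof. exact: pospow_ge0. Qed.

Lemma weight_le1 x : weight alpha x <= 1.
Proof.
rewrite weightE; have [t0|t0] := leP (1 - sqnorm x) 0.
  by rewrite pospow_le0 ?gt_eqF.
have s1 : 1 - sqnorm x <= 1 by rewrite lerBlDr lerDl sqnorm_ge0.
rewrite pospow_gt0//; apply: le_trans (ge0_ler_powR (ltW alpha2) _ _ s1) _.
- by rewrite nnegrE ltW.
- by rewrite nnegrE.
- by rewrite powR1.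
Qed.

Lemma cube_fun_poly p : cube_fun (fun x => peval p x * weight alpha x).
Proof.
have w0 x : ~ cube x -> weight alpha x = 0.
  by move=> cx; apply: weight0 => /unit_ball_cube.
split; last by move=> x /w0 ->; rewrite mulr0.
  by apply: measurable_funM; [exact: measurable_peval|exact: measurable_weight].
have [W HW] := meval_bounded p; exists (Num.max W 0) => x.
have [cx|cx] := pselect (cube x); last by rewrite w0// mulr0 normr0 le_max lexx orbT.
rewrite normrM (ger0_norm (weight_ge0 _)) (@le_trans _ _ (W * 1))//; last first.
  by rewrite mulr1 le_max lexx.
rewrite ler_pM// ?weight_ge0 ?weight_le1//; apply: HW => i.
by rewrite ler_norml; exact: cx.
Qed.

Definition weighted_integral p : R := \int[lebesgue R d]_x (peval p x * weight alpha x).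

Let intg p : (lebesgue R d).-integrable setT
  (EFin \o (fun x => peval p x * weight alpha x)).
Proof. exact/cube_fun_integrable/cube_fun_poly. Qed.

Lemma weighted_integralD p q : weighted_integral (p + q) = weighted_integral p + weighted_integral q.
Proof.
rewrite /weighted_integral -(RintegralD _ (intg p) (intg q))//.
by apply: eq_Rintegral => x _; rewrite pevalD mulrDl.
Qed.

Lemma weighted_integralZ c p : weighted_integral (c *: p) = c * weighted_integral p.
Proof.
rewrite /weighted_integral -(RintegralZl _ _ (intg p))//.
by apply: eq_Rintegral => x _; rewrite pevalZ mulrA.
Qed.

Lemma weighted_integralN p : weighted_integral (- p) = - weighted_integral p.
Proof. by rewrite -scaleN1r weighted_integralZ mulN1r. Qed.

Lemma weighted_integralB p q : weighted_integral (p - q) = weighted_integral p - weighted_integral q.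
Proof. by rewrite weighted_integralD weighted_integralN. Qed.

Lemma weighted_integral0 : weighted_integral 0 = 0.
Proof. by rewrite -(scale0r 0) weighted_integralZ mul0r. Qed.

Lemma weighted_integral_sum I (r : seq I) (P : pred I) (F : I -> mpoly d R) :
  weighted_integral (\sum_(j <- r | P j) F j) = \sum_(j <- r | P j) weighted_integral (F j).
Proof. exact: (big_morph weighted_integral weighted_integralD weighted_integral0). Qed.

Lemma is_derive_meval i (v : 'I_d -> R) p (a : R) :
  is_derive a 1 (fun b => meval (updf v i b) p) (meval (updf v i a) (mderiv i p)).
Proof.
elim/mpolyind: p => [|c m p _ _ IH].
  rewrite mderiv0 meval0 (_ : (fun _ => _) = cst 0); first exact: is_derive_cst.
  by apply/funext => b; rewrite meval0.
pose K : R := \prod_(j < d | j != i) v j ^+ m j.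
have mE b (m' : multinom d) : (forall j, j != i -> m' j = m j) ->
    \prod_(j < d) updf v i b j ^+ m' j = b ^+ m' i * K.
  move=> mm'; rewrite (bigD1 i)//= /updf eqxx; congr (_ * _).
  by apply: eq_bigr => j ji; rewrite (negbTE ji) mm'.
rewrite mderivD mderivZ mderivX mevalD !mevalZ mevalX mE; last first.
  by move=> j ji; rewrite mnmBE mnm1E eq_sym (negbTE ji) subn0.
rewrite mnmBE mnm1E eqxx subn1.
rewrite (_ : (fun b => _) =
  (fun b => (c * K) * b ^+ m i) \+ (fun b => meval (updf v i b) p)); last first.
  by apply/funext => b; rewrite mevalD mevalZ mevalX mE//= mulrA [c * K * _]mulrAC.
apply: is_deriveD.
have H := is_deriveM (is_derive_cst (c * K) a 1) (is_deriveX (m i) (is_derive_id a (1 : R))).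
have fE : (fun b : R => c * K * b ^+ m i) = cst (c * K) * id ^+ m i.
  by apply/funext => b /=; rewrite /GRing.mul /= fctE.
rewrite fE; apply: (is_derive_eq H); rewrite /GRing.scale /= fctE; ring.
Qed.

Lemma coord_upd x i (a : R) :
  Defs.coord (upd x i (a : measurableTypeR R)) = updf (Defs.coord x) i a.
Proof. by apply/funext => j; rewrite /Defs.coord tnth_upd. Qed.

(** (1 - |x|^2) w vanishes on the sphere and its derivative along the i-th
    coordinate is -(alpha + 2) x_i w; on each line parallel to that axis this is the
    one-variable statement. *)
Lemma weighted_integral_by_parts i p :
  weighted_integral ((1 - r2) * mderiv i p) = (alpha + 2) * weighted_integral (X i * p).
Proof.
apply/eqP; rewrite -subr_eq0 -weighted_integralZ -weighted_integralB; apply/eqP.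
rewrite /weighted_integral /Rintegral (integral_coordinate0 (i := i))//; first exact: cube_fun_poly.
move=> x; pose c := 1 - \sum_(j < d | j != i) Defs.coord x j ^+ 2.
have c1 : c <= 1 by rewrite gerBl sumr_ge0// => j _; exact: sqr_ge0.
pose P a := meval (updf (Defs.coord x) i a) p.
pose P' a := meval (updf (Defs.coord x) i a) (mderiv i p).
have dP (a : R) : is_derive a 1 P (P' a) by exact: is_derive_meval.
have dP' (a : R) : derivable P' a 1.
  by case: (is_derive_meval i (Defs.coord x) (mderiv i p) a).
rewrite -[RHS](integral_derivative_vanish c1 alpha2 dP dP').
apply: eq_integral => a _; congr (_%:E).
have sq : sqnorm (upd x i (a : measurableTypeR R)) = 1 - (c - a ^+ 2).
  rewrite /sqnorm (bigD1 i)//= coord_upd {1}/updf eqxx.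
  rewrite (eq_bigr (fun j => Defs.coord x j ^+ 2)) => [|j ji]; last first.
    by rewrite /updf (negbTE ji).
  by rewrite /c; ring.
rewrite weightE pevalB pevalZ !pevalM pevalB peval_sqnorm sq.
have -> : peval 1 (upd x i (a : measurableTypeR R)) = 1 by exact: meval1.
have -> : 1 - (1 - (c - a ^+ 2)) = c - a ^+ 2 by ring.
have -> : peval (mderiv i p) (upd x i (a : measurableTypeR R)) = P' a.
  by rewrite /peval coord_upd.
have -> : peval p (upd x i (a : measurableTypeR R)) = P a by rewrite /peval coord_upd.
have -> : peval (X i) (upd x i (a : measurableTypeR R)) = a.
  by rewrite /peval coord_upd mevalXU /updf eqxx.
rewrite (pospowS _ alpha2); lra.
Qed.

End weighted_functional.

(** * Orthogonality and span of the blocks *)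

Section ball_orthogonality.
Context {R : realType}.
Variables (d : nat) (alpha : R).
Hypothesis alpha_gt0 : 0 < alpha.
Implicit Types (p q h : mpoly d R) (i : 'I_d) (l n : nat).
Local Notation X i := (mpolyX R (mnm1 i)).
Local Notation r2 := (sqnorm_poly d).
Local Notation lam := (@weighted_integral R d alpha).

Lemma ball_operator_green p q : lam (q * ball_operator alpha p) =
  - lam ((1 - r2) * \sum_(i < d) mderiv i q * mderiv i p).
Proof.
have H : \sum_(i < d) lam ((1 - r2) * mderiv i (q * mderiv i p)) =
    \sum_(i < d) (alpha + 2) * lam (X i * (q * mderiv i p)).
  by apply: eq_bigr => i _; rewrite weighted_integral_by_parts.
move: H; rewrite -mulr_sumr -!weighted_integral_sum// -mulr_sumr.
have -> : \sum_(i < d) mderiv i (q * mderiv i p) =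
    \sum_(i < d) mderiv i q * mderiv i p + q * laplacian p.
  rewrite /laplacian mulr_sumr -big_split /=; apply: eq_bigr => i _.
  by rewrite mderivM.
have -> : \sum_(i < d) X i * (q * mderiv i p) = q * euler p.
  by rewrite /euler mulr_sumr; apply: eq_bigr => i _; rewrite mulrCA.
rewrite mulrDr weighted_integralD// => H.
have -> : q * ball_operator alpha p =
    (1 - r2) * (q * laplacian p) - (alpha + 2) *: (q * euler p).
  by rewrite /ball_operator mulrBr mulrCA scalerAr.
by rewrite weighted_integralB// weighted_integralZ// -H; ring.
Qed.

(** The operator is symmetric because the factor 1 - |x|^2 gained by the weight
    kills the boundary term. *)
Lemma ball_operator_sym p q :
  lam (q * ball_operator alpha p) = lam (p * ball_operator alpha q).
Proof.
rewrite !ball_operator_green; congr (- lam (_ * _)).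
by apply: eq_bigr => i _; rewrite mulrC.
Qed.

Lemma eigen_orthogonal p q (mu nu : R) : mu != nu ->
  ball_operator alpha p = - mu *: p -> ball_operator alpha q = - nu *: q ->
  lam (p * q) = 0.
Proof.
move=> mn pE qE; have := ball_operator_sym p q.
rewrite pE qE -!scalerAr !weighted_integralZ// [q * p]mulrC => /eqP.
rewrite -subr_eq0 -mulrBl mulf_eq0 => /orP[|/eqP//].
by rewrite opprK addrC subr_eq0 eq_sym (negbTE mn).
Qed.

(** Integration by parts of the field x q, whose divergence is (d + k) q. *)
Lemma weighted_integral_sqnorm k q : q \is ishomog1 k mdeg ->
  (d%:R + k%:R) * lam q = (d%:R + k%:R + alpha + 2) * lam (r2 * q).
Proof.
move=> qk.
have H : \sum_(i < d) lam ((1 - r2) * mderiv i (X i * q)) =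
    \sum_(i < d) (alpha + 2) * lam (X i * (X i * q)).
  by apply: eq_bigr => i _; rewrite weighted_integral_by_parts.
move: H; rewrite -mulr_sumr -!weighted_integral_sum// -mulr_sumr.
have -> : \sum_(i < d) mderiv i (X i * q) = (d%:R + k%:R) *: q.
  rewrite scalerDl -(euler_homog qk) /euler scaler_nat.
  have -> : q *+ d = \sum_(i < d) q by rewrite sumr_const card_ord.
  rewrite -big_split /=.
  by apply: eq_bigr => i _; rewrite mderivM mderiv_var eqxx mul1r.
have -> : \sum_(i < d) X i * (X i * q) = r2 * q.
  by rewrite mulr_suml; apply: eq_bigr => i _; rewrite mulrA.
by rewrite -scalerAr weighted_integralZ// mulrBl mul1r weighted_integralB//; lra.
Qed.

Lemma weighted_integral_radial k q phi : q \is ishomog1 k mdeg -> lam q = 0 ->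
  lam (q * radial d phi) = 0.
Proof.
move=> qk q0.
have pow n : r2 ^+ n * q \is ishomog1 (2 * n + k)%N mdeg /\ lam (r2 ^+ n * q) = 0.
  elim: n => [|n [qn IH]]; first by rewrite expr0 mul1r.
  split; first by rewrite exprS -mulrA mulnS -addnA dhomogM ?sqnorm_poly_homog.
  have := weighted_integral_sqnorm qn; rewrite IH mulr0 mulrA -exprS => /esym/eqP.
  rewrite mulf_eq0 => /orP[|/eqP//].
  have : 0 <= d%:R + (2 * n + k)%:R :> R by rewrite addr_ge0.
  by move=> D0; rewrite gt_eqF// addr_gt0// ltr_wpDl.
rewrite -[phi]coefK poly_def (big_morph (@radial R d) (radialD _) (rmorph0 _)).
rewrite mulr_sumr weighted_integral_sum// big1// => n _.
by rewrite radialZ -scalerAr weighted_integralZ// radialXn [q * _]mulrC (pow n).2 mulr0.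
Qed.

Lemma solid_harmonic_eigen l h : solid_harmonic l h ->
  ball_operator alpha h = - ((alpha + 2) * l%:R) *: h.
Proof.
move=> [hl h0]; rewrite /ball_operator h0 mulr0 sub0r (euler_homog hl).
by rewrite scalerA scaleNr.
Qed.

(** For l <> l', orthogonality of the two harmonic factors suffices, as the radial
    factors preserve the vanishing of the integral; for l = l', the eigenvalues of the
    ball operator differ. *)
Lemma ball_mpoly_orthogonal l l' n n' h h' :
  solid_harmonic l h -> solid_harmonic l' h' -> (l, n) != (l', n') ->
  lam (ball_mpoly alpha l n h * ball_mpoly alpha l' n' h') = 0.
Proof.
move=> hl hl'; have [E|ll'] := eqVneq l l'; last first.
  move=> _; rewrite /ball_mpoly mulrACA -radialM.
  apply: (@weighted_integral_radial (l + l')%N); first by rewrite dhomogM ?hl.1 ?hl'.1.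
  apply: (@eigen_orthogonal _ _ ((alpha + 2) * l%:R) ((alpha + 2) * l'%:R));
    [|exact: solid_harmonic_eigen..].
  rewrite -subr_eq0 -mulrBr mulf_neq0 ?subr_eq0 ?eqr_nat//.
  by rewrite gt_eqF// addr_gt0.
subst l'; rewrite xpair_eqE eqxx /= => nn'.
apply: (eigen_orthogonal _ (ball_operator_eigen _ _ hl) (ball_operator_eigen _ _ hl')).
rewrite /ball_eigenvalue; apply: contra_neq nn' => E.
have pos (k m : nat) : 0 < k%:R + m%:R + alpha / 2 + d%:R / 2 + l%:R :> R.
  by rewrite ltr_pwDl// ltr_pwDl// ltr_wpDl ?divr_gt0// addr_ge0.
have : (n%:R - n'%:R) * (n%:R + n'%:R + alpha / 2 + d%:R / 2 + l%:R) = 0 :> R by lra.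
by move/eqP; rewrite mulf_eq0 (gt_eqF (pos _ _)) orbF subr_eq0 eqr_nat => /eqP.
Qed.

End ball_orthogonality.

Section ball_expansion.
Context {R : realType}.
Variables (d : nat) (alpha : R).
Hypothesis d_gt0 : (0 < d)%N.
Hypothesis alpha_gt0 : 0 < alpha.
Implicit Types (p q h : mpoly d R) (l n : nat).
Implicit Type Y : nat -> nat -> mpoly d R.

Lemma solid_harmonic0 l : solid_harmonic l (0 : mpoly d R).
Proof. by split; [exact: rpred0|rewrite /laplacian big1// => i _; rewrite !mderiv0]. Qed.

Lemma solid_harmonicD l h1 h2 : solid_harmonic l h1 -> solid_harmonic l h2 ->
  solid_harmonic l (h1 + h2).
Proof.
move=> [h1l h10] [h2l h20]; split; first exact: rpredD.
by rewrite laplacianD h10 h20 addr0.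
Qed.

Lemma solid_harmonicZ l c h : solid_harmonic l h -> solid_harmonic l (c *: h).
Proof. by move=> [hl h0]; split; [exact: rpredZ|rewrite laplacianZ h0 scaler0]. Qed.

Lemma ball_mpoly0 l n : ball_mpoly alpha l n 0 = 0 :> mpoly d R.
Proof. exact: mul0r. Qed.

Lemma ball_mpolyD l n h1 h2 :
  ball_mpoly alpha l n (h1 + h2) = ball_mpoly alpha l n h1 + ball_mpoly alpha l n h2.
Proof. exact: mulrDl. Qed.

Lemma ball_mpolyZ l n c h :
  ball_mpoly alpha l n (c *: h) = c *: ball_mpoly alpha l n h.
Proof. by rewrite /ball_mpoly -scalerAl. Qed.

Definition ball_sum Y L N : mpoly d R :=
  \sum_(l < L.+1) \sum_(n < N.+1) ball_mpoly alpha l n (Y l n).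

Lemma ball_sumD Y1 Y2 L N :
  ball_sum (fun l n => Y1 l n + Y2 l n) L N = ball_sum Y1 L N + ball_sum Y2 L N.
Proof.
rewrite /ball_sum -big_split /=; apply: eq_bigr => l _.
by rewrite -big_split /=; apply: eq_bigr => n _; rewrite ball_mpolyD.
Qed.

Lemma ball_sumZ c Y L N :
  ball_sum (fun l n => c *: Y l n) L N = c *: ball_sum Y L N.
Proof.
rewrite /ball_sum scaler_sumr; apply: eq_bigr => l _.
by rewrite scaler_sumr; apply: eq_bigr => n _; rewrite ball_mpolyZ.
Qed.

Lemma ball_sum_delta l0 n0 h L N : (l0 <= L)%N -> (n0 <= N)%N ->
  ball_sum (fun l n => if (l == l0) && (n == n0) then h else 0) L N =
  ball_mpoly alpha l0 n0 h.
Proof.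
move=> lL nN; rewrite /ball_sum (bigD1 (Ordinal (n := L.+1) lL))//= [X in _ + X]big1.
  rewrite addr0 (bigD1 (Ordinal (n := N.+1) nN))//= [X in _ + X]big1 ?eqxx ?addr0//.
  by move=> n; rewrite -val_eqE /= => /negbTE ->; rewrite /= ?andbF ball_mpoly0.
move=> l; rewrite -val_eqE /= => /negbTE ->.
by rewrite big1// => n _; rewrite ball_mpoly0.
Qed.

(** In the decomposition of p into terms |x|^(2j) h, the power t^j is a combination of
    the Jacobi polynomials of degree at most j, which depend on the degree l of h. *)
Lemma ball_sum_span K L N p : (K <= N)%N -> (K <= L)%N -> (msize p <= K.+1)%N ->
  exists2 Y, forall l n, solid_harmonic l (Y l n) & p = ball_sum Y L N.
Proof.
move=> KN KL.
pose S q := exists2 Y, forall l n, solid_harmonic l (Y l n) & q = ball_sum Y L N.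
have S0 : S 0.
  exists (fun _ _ => 0); first by move=> l n; exact: solid_harmonic0.
  by rewrite /ball_sum big1// => l _; rewrite big1// => n _; rewrite ball_mpoly0.
have SD q1 q2 : S q1 -> S q2 -> S (q1 + q2).
  move=> [Y1 H1 ->] [Y2 H2 ->]; exists (fun l n => Y1 l n + Y2 l n).
    by move=> l n; exact: solid_harmonicD.
  by rewrite ball_sumD.
have SZ c q : S q -> S (c *: q).
  move=> [Y H ->]; exists (fun l n => c *: Y l n); last by rewrite ball_sumZ.
  by move=> l n; exact: solid_harmonicZ.
apply: (almansi d_gt0 S0 SD) => j l h ljK hl.
rewrite -radialXn mulrC.
apply: (@jacobi_poly_span R (fun phi => S (h * radial d phi)) (alpha / 2)
  (d%:R / 2 + l%:R - 1) j).
- by rewrite (lt_trans (ltrN10 _))// divr_gt0.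
- by rewrite ltrBrDl subrr ltr_wpDr// divr_gt0// ltr0n.
- by rewrite /radial rmorph0 mulr0.
- by move=> p1 p2 H1 H2; rewrite radialD mulrDr; exact: SD.
- by move=> c p1 H; rewrite radialZ -scalerAr; exact: SZ.
- move=> i ij; exists (fun l' n => if (l' == l) && (n == i) then h else 0).
    by move=> l' n; case: ifP => [/andP[/eqP -> _]//|_]; exact: solid_harmonic0.
  by rewrite ball_sum_delta//; lia.
- by rewrite size_polyXn.
Qed.

End ball_expansion.

(** * Lower bound of the eigenvalues *)

Section gamma_bounds.
Context {R : realType}.
Implicit Types (x t : R) (n : nat).
Local Notation mu := (@lebesgue_measure R).

(** An antiderivative of t^n exp(-t), by repeated integration by parts. *)
Fixpoint gamma_primitive n t : R :=
  if n is m.+1 then - (t ^+ n * expR (- t)) + n%:R * gamma_primitive m t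
  else - expR (- t).

Lemma is_derive_expRN (t : R) : is_derive t 1 (fun s : R => expR (- s)) (- expR (- t)).
Proof.
have H : is_derive t 1 (fun s : R => - s) (-1) by apply: is_deriveNid.
have := is_derive1_comp (is_derive_expR (- t)) H; rewrite mulrN1.
by [].
Qed.

Lemma is_derive_gamma_primitive n (t : R) :
  is_derive t 1 (gamma_primitive n) (t ^+ n * expR (- t)).
Proof.
elim: n => [|n IH].
  have H := is_deriveN (is_derive_expRN t).
  by apply: (is_derive_eq H); rewrite opprK expr0 mul1r.
have -> : gamma_primitive n.+1 = - ((id ^+ n.+1) * (fun s : R => expR (- s))) +
    cst n.+1%:R * gamma_primitive n.
  by apply/funext => s; rewrite /= !fctE.
have H := is_deriveD (is_deriveN (is_deriveM (is_deriveX n.+1 (is_derive_id t (1 : R)))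
  (is_derive_expRN t))) (is_deriveM (is_derive_cst (n.+1%:R : R) t 1) IH).
apply: (is_derive_eq H); rewrite /GRing.scale /= fctE exprS; ring.
Qed.

Lemma cvg_powR_expRN n : (t ^+ n * expR (- t) : R) @[t --> +oo] --> (0 : R).
Proof.
apply/cvgrPdist_lt => e e0; near=> t.
have t0 : 0 < t by near: t; exact: nbhs_pinfty_gt.
have te : n.+1`!%:R / e < t by near: t; apply: nbhs_pinfty_gt; exact: num_real.
have f0 : 0 < n.+1`!%:R :> R by rewrite ltr0n fact_gt0.
have H := expR_ge1Dxn n (ltW t0).
rewrite sub0r normrN ger0_norm; last by rewrite mulr_ge0 ?expR_ge0// exprn_ge0 ?ltW.
rewrite expRN -ltr_pdivlMr ?invr_gt0 ?expR_gt0// invrK.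
have : t ^+ n.+1 / n.+1`!%:R < expR t by lra.
rewrite ltr_pdivrMr// exprS => H1.
have H2 : n.+1`!%:R < t * e by rewrite -ltr_pdivrMr.
rewrite -(ltr_pM2l t0) (lt_trans H1)// mulrC mulrA ltr_pM2r ?expR_gt0//.
Unshelve. all: by end_near. Qed.

Lemma cvg_gamma_primitive n : gamma_primitive n t @[t --> +oo] --> (0 : R).
Proof.
elim: n => [|n IH] /=; first by rewrite -oppr0; apply: cvgN; exact: cvgr_expR.
rewrite -[X in _ --> X](_ : - 0 + n.+1%:R * 0 = 0); last by rewrite oppr0 mulr0 addr0.
apply: cvgD; last by apply: cvgM => //; exact: cvg_cst.
by apply: cvgN; exact: cvg_powR_expRN.
Qed.

Lemma gamma_primitive0 n : gamma_primitive n 0 = - n`!%:R.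
Proof.
elim: n => [|n IH] /=; first by rewrite oppr0 expR0.
by rewrite expr0n mul0r oppr0 add0r IH factS natrM mulrN.
Qed.

Lemma continuous_gamma_integrand n : continuous (fun t : R => t ^+ n * expR (- t)).
Proof.
move=> t; have c : {for t, continuous (fun s : R => expR (- s))}.
  apply: differentiable_continuous.
  by apply/derivable1_diffP; case: (is_derive_expRN t).
by apply: cvgM; [exact: exprn_continuous|exact: c].
Qed.

Lemma gamma_integral_fact n :
  (\int[mu]_(t in `]0%R, +oo[) (t ^+ n * expR (- t))%:E = n`!%:R%:E)%E.
Proof.
have c := @continuous_gamma_integrand n.
rewrite integral_itv_obnd_cbnd; last first.
  apply/measurable_EFinP; apply: measurable_funTS.
  exact: continuous_measurable_fun.
rewrite (@ge0_continuous_FTC2y _ _ (gamma_primitive n) _ 0).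
- by rewrite gamma_primitive0 -EFinB sub0r opprK.
- by move=> t t0; rewrite mulr_ge0 ?expR_ge0// exprn_ge0.
- by apply: continuous_subspaceT.
- exact: cvg_gamma_primitive.
- by move=> t _; case: (is_derive_gamma_primitive n t).
- apply: cvg_at_right_filter; apply: differentiable_continuous.
  by apply/derivable1_diffP; case: (is_derive_gamma_primitive n 0).
- move=> t _; rewrite derive1E.
  exact: (@derive_val _ _ _ _ _ _ _ (is_derive_gamma_primitive n t)).
Qed.

Lemma gamma_integrable_nat n :
  mu.-integrable `]0%R, +oo[ (EFin \o (fun t : R => t ^+ n * expR (- t))).
Proof.
apply/integrableP; split.
  apply/measurable_EFinP; apply: measurable_funTS.
  by apply: continuous_measurable_fun; exact: continuous_gamma_integrand.
under eq_integral => t.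
  rewrite inE /= in_itv/= andbT => t0.
  rewrite ger0_norm; last by rewrite mulr_ge0 ?expR_ge0// exprn_ge0// ltW.
  over.
by rewrite gamma_integral_fact ltry.
Qed.

Lemma powR_le_1Dpow (t y z : R) : 0 < t -> y <= z -> 0 <= y -> t `^ y <= 1 + t `^ z.
Proof.
move=> t0 yz y0; have [t1|t1] := leP t 1.
  apply: (@le_trans _ _ 1); last by rewrite lerDl powR_ge0.
  have := ge0_ler_powR y0 _ _ t1; rewrite powR1; apply; rewrite nnegrE//.
  exact: ltW.
by apply: (@le_trans _ _ (t `^ z)); rewrite ?ler_powR ?lerDr// ltW.
Qed.

Lemma gamma_integrable x : 1 <= x ->
  mu.-integrable `]0%R, +oo[ (EFin \o (fun t : R => t `^ (x - 1) * expR (- t))).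
Proof.
move=> x1; pose m := (Num.trunc (x - 1)).+1.
have xm : x - 1 <= m%:R by rewrite ltW// truncnS_gt.
pose g (k : nat) (t : R) := t ^+ k * expR (- t).
have I : mu.-integrable `]0%R, +oo[ ((EFin \o g 0%N) \+ (EFin \o g m))%E.
  by apply: integrableD => //; exact: gamma_integrable_nat.
apply: (le_integrable _ _ _ I) => //.
  apply/measurable_EFinP; apply: measurable_funM.
    apply: measurable_funTS; exact: measurable_powR.
  apply: measurable_funTS; apply: measurableT_comp => //.
move=> t; rewrite /= in_itv/= andbT => t0.
rewrite lee_fin !ger0_norm; last 2 first.
- by rewrite addr_ge0// mulr_ge0 ?expR_ge0// exprn_ge0// ltW.
- by rewrite mulr_ge0 ?expR_ge0 ?powR_ge0.
rewrite /g expr0 -mulrDl ler_pM2r ?expR_gt0// -(powR_mulrn _ (ltW t0)).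
by rewrite powR_le_1Dpow// subr_ge0.
Qed.

Lemma gamma_fact n : Gamma (1 + n%:R) = n`!%:R :> R.
Proof.
rewrite /Gamma /Rintegral [1 + _]addrC addrK.
under eq_integral => t.
  rewrite inE /= in_itv/= andbT => t0.
  rewrite powR_mulrn; last exact: ltW.
  over.
by rewrite gamma_integral_fact.
Qed.

Lemma gamma_ge x : 1 <= x -> expR (- 2) <= Gamma x.
Proof.
move=> x1; have I := gamma_integrable x1.
rewrite -lee_fin /Gamma /Rintegral fineK; last exact: integrable_fin_num.
have sub : `[(1 : R), 2]%classic `<=` `]0, +oo[%classic.
  by move=> t /=; rewrite !in_itv/= andbT => /andP[t1 _]; exact: lt_le_trans t1.
have mf := measurable_int mu I.
apply: (@le_trans _ _ (\int[mu]_(t in `[1%R, 2%R]) (t `^ (x - 1) * expR (- t))%:E)%E); last first.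
  apply: ge0_subset_integral => // t _.
  by rewrite lee_fin mulr_ge0 ?expR_ge0 ?powR_ge0.
apply: (@le_trans _ _ (\int[mu]_(t in `[1%R, 2%R]) (expR (- 2))%:E)%E).
  rewrite integral_cst//= lebesgue_measure_itv/= lte_fin ltr1n.
  by rewrite -EFinB -EFinM lee_fin (_ : 2 - 1 = 1) ?mulr1//; lra.
apply: ge0_le_integral => //.
- by move: mf; apply: measurable_funS.
- move=> t /=; rewrite in_itv/= => /andP[t1 t2].
  rewrite lee_fin -[leLHS]mul1r ler_pM ?expR_ge0// ?ler_expR ?lerN2//.
  by rewrite -[leLHS](powRr0 t) ler_powR// subr_ge0.
Qed.

Lemma gamma_leD x b : 1 <= x -> 0 <= b -> Gamma x <= Gamma (x + b) + 1.
Proof.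
move=> x1 b0; have xb : 1 <= x + b by lra.
have I := gamma_integrable x1; have Ib := gamma_integrable xb.
have I0 := gamma_integrable_nat 0.
have <- : \int[mu]_(t in `]0%R, +oo[) (t ^+ 0 * expR (- t)) = 1.
  by rewrite /Rintegral gamma_integral_fact.
rewrite /Gamma -RintegralD//; apply: le_Rintegral => //.
  have I3 := @integrableD _ _ R mu _ _ _ _ Ib I0.
  by apply: (eq_integrable _ _ _ _ (I3 _)).
move=> t /=; rewrite in_itv/= andbT => t0.
rewrite expr0 -mulrDl ler_pM2r ?expR_gt0// [_ `^ _ + 1]addrC powR_le_1Dpow//; lra.
Qed.

(** Raising the argument cannot make the Gamma function small: the integrand only
    decreases on ]0, 1[, where its integral is at most 1, while Gamma stays above
    a positive constant. *)
Lemma gamma_ratio x b : 1 <= x -> 0 <= b ->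
  (1 + expR 2)^-1 * Gamma x <= Gamma (x + b).
Proof.
move=> x1 b0; have H := gamma_leD x1 b0.
have xb : 1 <= x + b by lra.
have := gamma_ge xb; rewrite expRN => G.
have e0 : 0 < expR 2 :> R by exact: expR_gt0.
rewrite mulrC ler_pdivrMr; last by rewrite addr_gt0.
have : 1 <= Gamma (x + b) * expR 2.
  by rewrite -ler_pdivrMr// mul1r.
by lra.
Qed.

(** The eigenvalue is 2^alpha times two ratios Gamma(x + alpha/2) / Gamma(x), at
    x = 1 + n and x = d/2 + l + n; both arguments are at least 1 since d >= 2. *)
Lemma eigenvalue_lower_bound d (alpha : R) : (1 < d)%N -> 0 < alpha ->
  exists2 c : R, 0 < c & forall l n, c <= Defs.eigenvalue d alpha l n.
Proof.
move=> d1 a0; pose k : R := (1 + expR 2)^-1.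
have k0 : 0 < k by rewrite invr_gt0 addr_gt0 ?expR_gt0.
exists (2 `^ alpha * k * k); first by rewrite !mulr_gt0 ?powR_gt0.
move=> l n; rewrite /Defs.eigenvalue; set delta : R := (d + l.*2)%:R.
have a2 : 0 <= alpha / 2 by rewrite divr_ge0 ?ltW.
have dl : 1 <= delta / 2 + n%:R.
  have : 2 <= delta by rewrite ler_nat; lia.
  by have : 0 <= n%:R :> R by []; lra.
have n1 : 1 <= 1 + n%:R :> R by rewrite lerDl.
have G1 := gamma_ratio n1 a2; have G2 := gamma_ratio dl a2.
rewrite gamma_fact in G1.
have Gd : 0 < Gamma (delta / 2 + n%:R) by exact: lt_le_trans (expR_gt0 _) (gamma_ge dl).
have f0 : 0 < n`!%:R :> R by rewrite ltr0n fact_gt0.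
rewrite ler_pdivlMr ?mulr_gt0//.
have -> : 1 + alpha / 2 + n%:R = 1 + n%:R + alpha / 2 by ring.
have -> : (delta + alpha) / 2 + n%:R = delta / 2 + n%:R + alpha / 2 by lra.
rewrite -/k in G1 G2.
rewrite (_ : _ * k * k * _ = 2 `^ alpha * (k * n`!%:R) * (k * Gamma (delta / 2 + n%:R))); last by ring.
have p2 : 0 < 2 `^ alpha :> R by exact: powR_gt0.
apply: ler_pM => //; last by rewrite ler_pM2l.
  by apply: ltW; rewrite !mulr_gt0.
by apply: ltW; rewrite mulr_gt0.
Qed.

End gamma_bounds.

(** * The norm of the weighted space *)

Section ball_energy.
Context {R : realType}.
Variables (d : nat) (alpha : R).
Hypothesis alpha_gt0 : 0 < alpha.
Implicit Types (p q : mpoly d R) (g h : euclid R d -> R).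
Local Notation mu := (lebesgue R d).
Local Notation ball := (@unit_ball R d).

Lemma measurable_unit_ball : measurable ball.
Proof.
have m : measurable_fun setT (@sqnorm R d).
  apply: (eq_measurable_fun (peval (sqnorm_poly d))); last exact: measurable_peval.
  by move=> x _; rewrite peval_sqnorm.
rewrite (_ : ball = @sqnorm R d @^-1` `]-oo, 1[%classic).
  by rewrite -[_ @^-1` _]setTI; exact: m.
by apply/seteqP; split => x /=; rewrite in_itv.
Qed.

Lemma lebesgue_unit_ball : (mu ball <= mu (@cube R d))%E.
Proof.
apply: le_measure; rewrite ?inE; [exact: measurable_unit_ball|exact: measurable_cube|].
exact: unit_ball_cube.
Qed.

Lemma ball_integrable g : measurable_fun ball g ->
  (exists B, forall x, ball x -> `|g x| <= B) -> mu.-integrable ball (EFin \o g).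
Proof.
move=> mg [B gB]; apply: measurable_bounded_integrable => //.
- exact: measurable_unit_ball.
- exact: le_lt_trans lebesgue_unit_ball (lebesgue_cube _).
- exists B; split; first exact: num_real.
  by move=> y By x /gB H; exact: le_trans H (ltW By).
Qed.

(** The square of the weighted norm, which avoids roots of extended reals. *)
Definition energy g : \bar R :=
  (\int[mu]_(x in ball) (`|g x| ^+ 2 * weight alpha x)%:E)%E.

Lemma energy_density_ge0 g x : (0 <= (`|g x| ^+ 2 * weight alpha x)%:E)%E.
Proof. by rewrite lee_fin mulr_ge0 ?sqr_ge0 ?weight_ge0. Qed.

Lemma energy_ge0 g : (0 <= energy g)%E.
Proof. by apply: integral_ge0 => x _; exact: energy_density_ge0. Qed.

Lemma measurable_energy_density g : measurable_fun ball g ->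
  measurable_fun ball (fun x => `|g x| ^+ 2 * weight alpha x).
Proof.
move=> mg; apply: measurable_funM.
  by apply: measurable_funX; exact: measurableT_comp.
by apply: measurable_funTS; exact: measurable_weight.
Qed.

(** A substitute for the triangle inequality, from (a + b)^2 <= 2 a^2 + 2 b^2, which
    holds without any finiteness assumption. *)
Lemma energy_perturb g h h1 h2 (e : R) :
  measurable_fun ball h -> measurable_fun ball h1 -> measurable_fun ball h2 ->
  (forall x, ball x -> g x = h x + h1 x - h2 x) ->
  (energy h1 <= e%:E)%E -> (energy h2 <= e%:E)%E ->
  (energy g <= 2%:E * energy h + (8 * e)%:E)%E.
Proof.
move=> mh mh1 mh2 gE e1 e2.
pose D (k : euclid R d -> R) x := (`|k x| ^+ 2 * weight alpha x)%:E.
have D0 k (c : R) x : 0 <= c -> ball x -> (0 <= c%:E * D k x)%E.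
  by move=> c0 _; rewrite mule_ge0 ?lee_fin// mulr_ge0 ?sqr_ge0 ?weight_ge0.
have mD k (c : R) : measurable_fun ball k -> measurable_fun ball (fun x => c%:E * D k x)%E.
  move=> mk; apply: measurable_funeM; apply/measurable_EFinP.
  exact: measurable_energy_density.
have iZ k (c : R) : 0 <= c -> measurable_fun ball k ->
    (\int[mu]_(x in ball) (c%:E * D k x) = c%:E * energy k)%E.
  move=> c0 mk; rewrite ge0_integralZl//; first exact: measurable_unit_ball.
    by apply/measurable_EFinP; exact: measurable_energy_density.
  by move=> x _; exact: energy_density_ge0.
apply: (@le_trans _ _ (\int[mu]_(x in ball)
    (2%:E * D h x + (4%:E * D h1 x + 4%:E * D h2 x)))%E).
  apply: ge0_le_integral.
  - exact: measurable_unit_ball.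
  - by move=> x _; exact: energy_density_ge0.
  - apply/measurable_EFinP; apply: measurable_energy_density.
    apply: (eq_measurable_fun (fun x => h x + h1 x - h2 x)).
      by move=> x; rewrite inE => /gE.
    by apply: measurable_funB => //; exact: measurable_funD.
  - by apply: emeasurable_funD; [exact: mD|apply: emeasurable_funD; exact: mD].
  - move=> x Bx; rewrite /D -!EFinM -!EFinD lee_fin !(mulrA _ _ (weight alpha x)) -!mulrDl.
    rewrite ler_wpM2r ?weight_ge0// !real_normK ?num_real// gE//.
    move: (h x) (h1 x) (h2 x) => a b c; rewrite -subr_ge0.
    have -> : 2 * a ^+ 2 + (4 * b ^+ 2 + 4 * c ^+ 2) - (a + b - c) ^+ 2 =
      (a - b + c) ^+ 2 + 2 * (b + c) ^+ 2 by ring.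
    by rewrite addr_ge0 ?sqr_ge0// mulr_ge0// sqr_ge0.
have mB := measurable_unit_ball.
rewrite ge0_integralD ?ge0_integralD ?iZ//.
- have -> : (8 * e)%:E = (4%:E * e%:E + 4%:E * e%:E)%E :> \bar R.
    by rewrite -!EFinM -EFinD; congr EFin; ring.
  by rewrite leeD2l// leeD// lee_pmul2l.
- by move=> x; exact: D0.
- exact: mD.
- by move=> x; exact: D0.
- exact: mD.
- by move=> x; exact: D0.
- exact: mD.
- by move=> x Bx; rewrite adde_ge0// D0.
- by apply: emeasurable_funD; exact: mD.
Qed.

Lemma energy_peval p : energy (peval p) = (weighted_integral alpha (p * p))%:E.
Proof.
rewrite /weighted_integral /Rintegral fineK; last first.
  apply: integrable_fin_num => //.
  exact/cube_fun_integrable/cube_fun_poly.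
rewrite /energy [LHS]integral_mkcond; apply: eq_integral => x _.
rewrite patchE pevalM -expr2; case: ifPn => [_|]; first by rewrite real_normK ?num_real.
by rewrite notin_setE => /(weight0 alpha_gt0) ->; rewrite mulr0.
Qed.

Lemma energy_cvg0 {I : Type} (F : set_system I) {FF : Filter F}
    (G : I -> euclid R d -> R) (e : R) : 0 < e ->
  normL2 ball (weight alpha) (G i) @[i --> F] --> 0%E ->
  \forall i \near F, (energy (G i) <= e%:E)%E.
Proof.
move=> e0 /fine_cvgP[fin /cvgrPdist_lt /(_ (Num.sqrt e))].
rewrite sqrtr_gt0 => /(_ e0) sm; near=> i.
have fi : normL2 ball (weight alpha) (G i) \is a fin_num by near: i.
have : `|0 - fine (normL2 ball (weight alpha) (G i))| < Num.sqrt e by near: i.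
have -> : energy (G i) = (normL2 ball (weight alpha) (G i) `^ 2)%E.
  by rewrite /normL2 -poweRrM mulVf// poweRe1// energy_ge0.
rewrite -(fineK fi) poweR_EFin lee_fin sub0r normrN => H.
have r0 : 0 <= fine (normL2 ball (weight alpha) (G i)).
  by apply: fine_ge0; exact: poweR_ge0.
rewrite powR_mulrn// -(sqr_sqrtr (ltW e0)).
rewrite ger0_norm// in H.
by rewrite ler_pXn2r ?nnegrE ?sqrtr_ge0// ltW.
Unshelve. all: by end_near. Qed.

End ball_energy.

(** * Stability of the solution operator *)

Section spectral_stability.
Context {R : realType}.
Variables (d : nat) (alpha : R) (M : nat -> nat).
Variable V : forall l, 'I_(M l) -> mpoly d R.
Hypothesis alpha_gt0 : 0 < alpha.
Hypothesis HV : forall l, orthonormal_harmonic_basis l (@V l).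
Implicit Types (p q : mpoly d R) (f g u v : euclid R d -> R) (l n L N : nat).
Implicit Types (Y : nat -> nat -> mpoly d R) (c : forall l, 'I_(M l) -> nat -> R).
Local Notation ball := (@unit_ball R d).
Local Notation lam := (@weighted_integral R d alpha).
Local Notation energy := (@energy R d alpha).

Definition harmonic_part c l n : mpoly d R := \sum_(m < M l) c l m n *: V m.

Lemma harmonic_part_solid c l n : solid_harmonic l (harmonic_part c l n).
Proof.
have [HV1 _ _] := HV l; rewrite /harmonic_part.
elim/big_ind: _ => [||m _]; first exact: solid_harmonic0.
  by move=> *; exact: solid_harmonicD.
exact/solid_harmonicZ/HV1.
Qed.

Lemma peval_sum I (r : seq I) (P : pred I) (F : I -> mpoly d R) x :
  peval (\sum_(i <- r | P i) F i) x = \sum_(i <- r | P i) peval (F i) x.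
Proof. exact: (big_morph (meval (Defs.coord x)) (mevalD _) (meval0 _)). Qed.

Lemma peval_radial (phi : {poly R}) (x : euclid R d) :
  peval (radial d phi) x = phi.[sqnorm x].
Proof.
elim/poly_ind: phi => [|phi c IH].
  by rewrite /radial rmorph0 horner0; exact: meval0.
rewrite radialD radialM radialX radialC pevalD pevalM IH peval_sqnorm.
by rewrite hornerMXaddC; congr (_ + _); exact: mevalC.
Qed.

Lemma ball_poly_sumE c L N x :
  ball_poly_sum alpha V c L N x = peval (ball_sum alpha (harmonic_part c) L N) x.
Proof.
rewrite peval_sum; apply: eq_bigr => l _; rewrite peval_sum; apply: eq_bigr => n _.
rewrite /ball_mpoly pevalM /harmonic_part peval_sum mulr_suml; apply: eq_bigr => m _.
by rewrite /ball_poly jacobi_polyE pevalZ peval_radial mulrA.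
Qed.

Lemma measurable_ball_poly_sum c L N : measurable_fun ball (ball_poly_sum alpha V c L N).
Proof.
apply: (eq_measurable_fun (peval (ball_sum alpha (harmonic_part c) L N))).
  by move=> x _; rewrite ball_poly_sumE.
by apply: measurable_funTS; exact: measurable_peval.
Qed.

Lemma weighted_integral_sqr_ge0 p : 0 <= lam (p * p).
Proof. by rewrite -lee_fin -energy_peval//; exact: energy_ge0. Qed.

Lemma weighted_integral_ball_sum_sqr Y L N : (forall l n, solid_harmonic l (Y l n)) ->
  lam (ball_sum alpha Y L N * ball_sum alpha Y L N) =
  \sum_(l < L.+1) \sum_(n < N.+1)
    lam (ball_mpoly alpha l n (Y l n) * ball_mpoly alpha l n (Y l n)).
Proof.
move=> HY; rewrite /ball_sum !pair_bigA mulr_suml weighted_integral_sum//; apply: eq_bigr => -[l n] _.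
rewrite mulr_sumr weighted_integral_sum// (bigD1 (l, n))//= big1 ?addr0// => -[l' n'] ne.
apply: ball_mpoly_orthogonal => //; apply: contra_neq ne => -[E1 E2].
by congr pair; exact: val_inj.
Qed.

(** The norm of a sum over the blocks (l, n) dominates, up to the factor s, the
    norm of the sum of the blocks divided by multipliers bounded below by s. *)
Lemma ball_sum_multiplier Y (mu : nat -> nat -> R) (s : R) L N : 0 <= s ->
  (forall l n, s <= mu l n) -> (forall l n, solid_harmonic l (Y l n)) ->
  s ^+ 2 * lam (ball_sum alpha Y L N * ball_sum alpha Y L N) <=
  lam (ball_sum alpha (fun l n => mu l n *: Y l n) L N *
       ball_sum alpha (fun l n => mu l n *: Y l n) L N).
Proof.
move=> s0 smu HY; rewrite !weighted_integral_ball_sum_sqr//; last first.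
  by move=> l n; exact: solid_harmonicZ.
rewrite mulr_sumr; apply: ler_sum => l _; rewrite mulr_sumr; apply: ler_sum => n _.
rewrite ball_mpolyZ -[X in _ <= lam X]scalerAl -[X in _ <= lam (_ *: X)]scalerAr !weighted_integralZ// [leRHS]mulrA.
apply: ler_wpM2r; first exact: weighted_integral_sqr_ge0.
by rewrite expr2; apply: ler_pM.
Qed.

Lemma ball_sumB Y1 Y2 L N :
  ball_sum alpha Y1 L N - ball_sum alpha Y2 L N =
  ball_sum alpha (fun l n => Y1 l n - Y2 l n) L N.
Proof.
rewrite -scaleN1r -ball_sumZ -ball_sumD; apply: eq_bigr => l _.
by apply: eq_bigr => n _; rewrite scaleN1r.
Qed.

(** The partial sums of the differences v - u and g - f have the same blocks up to the
    eigenvalues, so ball_sum_multiplier compares them; the bound passes to the limit.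
    The factor 4 comes from using energy_perturb twice. *)
Lemma expansion_stable (a b : forall l, 'I_(M l) -> nat -> R) f g u v (s : R) :
  0 < s -> (forall l n, s <= Defs.eigenvalue d alpha l n) ->
  has_expansion alpha V (fun l m n => a l m n * Defs.eigenvalue d alpha l n) f ->
  has_expansion alpha V (fun l m n => b l m n * Defs.eigenvalue d alpha l n) g ->
  has_expansion alpha V a u -> has_expansion alpha V b v ->
  (energy (v \- u)%R <= (4 / s ^+ 2)%:E * energy (g \- f)%R)%E.
Proof.
move=> s0 sle [mf cf] [mg cg] [mu cu] [mv cv].
apply/lee_addgt0Pr => e e0.
pose K := 8 + 16 / s ^+ 2; have K0 : 0 < K by rewrite addr_gt0// divr_gt0// exprn_gt0.
pose eta := e / K; have eta0 : 0 < eta by rewrite divr_gt0.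
have [[L N] [ef eg eu ev]] : exists LN : nat * nat,
    [/\ (energy (f \- ball_poly_sum alpha V
           (fun l m n => a l m n * Defs.eigenvalue d alpha l n) LN.1 LN.2)%R <= eta%:E)%E,
        (energy (g \- ball_poly_sum alpha V
           (fun l m n => b l m n * Defs.eigenvalue d alpha l n) LN.1 LN.2)%R <= eta%:E)%E,
        (energy (u \- ball_poly_sum alpha V a LN.1 LN.2)%R <= eta%:E)%E &
        (energy (v \- ball_poly_sum alpha V b LN.1 LN.2)%R <= eta%:E)%E].
  apply: (@filter_ex _ (filter_prod \oo \oo)).
  near=> LN; split; near: LN; exact: energy_cvg0.
move: ef eg eu ev => /=.
set Sf := ball_poly_sum _ _ _ _ _; set Sg := ball_poly_sum _ _ _ _ _.
set Su := ball_poly_sum _ _ _ _ _; set Sv := ball_poly_sum _ _ _ _ _.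
move=> ef eg eu ev.
pose Y l n := harmonic_part b l n - harmonic_part a l n.
have HY l n : solid_harmonic l (Y l n).
  rewrite /Y -scaleN1r; apply: solid_harmonicD; first exact: harmonic_part_solid.
  exact/solid_harmonicZ/harmonic_part_solid.
pose D := ball_sum alpha Y L N.
pose D' := ball_sum alpha (fun l n => Defs.eigenvalue d alpha l n *: Y l n) L N.
have DE x : peval D x = Sv x - Su x.
  by rewrite /Sv /Su !ball_poly_sumE -pevalB ball_sumB.
have D'E x : peval D' x = Sg x - Sf x.
  rewrite /Sg /Sf !ball_poly_sumE -pevalB ball_sumB; congr (peval _ x).
  apply: eq_bigr => l _; apply: eq_bigr => n _; congr ball_mpoly.
  rewrite /Y scalerBr /harmonic_part !scaler_sumr.
  by congr (_ - _); apply: eq_bigr => m _; rewrite scalerA mulrC.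
have mS c : measurable_fun ball (ball_poly_sum alpha V c L N).
  exact: measurable_ball_poly_sum.
have mp p : measurable_fun ball (peval p).
  by apply: measurable_funTS; exact: measurable_peval.
have H1 : (energy (v \- u)%R <= 2%:E * energy (peval D) + (8 * eta)%:E)%E.
  apply: (@energy_perturb _ _ _ _ _ _ (v \- Sv) (u \- Su)) => //.
  - by apply: measurable_funB => //; exact: mS.
  - by apply: measurable_funB => //; exact: mS.
  - by move=> x _ /=; rewrite DE; ring.
have H2 : (energy (peval D') <= 2%:E * energy (g \- f)%R + (8 * eta)%:E)%E.
  apply: (@energy_perturb _ _ _ _ _ _ (f \- Sf) (g \- Sg)) => //.
  - by apply: measurable_funB => //; exact: mS.
  - by apply: measurable_funB => //; exact: mS.
  - by apply: measurable_funB => //; exact: mS.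
  - by move=> x _ /=; rewrite D'E; ring.
have s2 : 0 < s ^+ 2 by rewrite exprn_gt0.
have H3 : (energy (peval D) <= (s ^+ 2)^-1%:E * energy (peval D'))%E.
  rewrite !energy_peval// -EFinM lee_fin [leRHS]mulrC ler_pdivlMr// [leLHS]mulrC.
  by apply: ball_sum_multiplier => //; exact: ltW.
apply: (le_trans H1).
have H4 : (2%:E * energy (peval D) <=
    (2 / s ^+ 2)%:E * (2%:E * energy (g \- f)%R + (8 * eta)%:E))%E.
  apply: (@le_trans _ _ (2%:E * ((s ^+ 2)^-1%:E * energy (peval D')))%E).
    by rewrite lee_pmul2l.
  by rewrite muleA -EFinM lee_pmul2l// lte_fin divr_gt0.
apply: (le_trans (leeD H4 (lexx _))).
rewrite ge0_muleDr ?lee_fin; last 2 first.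
- by rewrite mule_ge0// energy_ge0.
- by rewrite mulr_ge0// ltW.
rewrite muleA -!EFinM -addeA -EFinD.
have -> : 2 / s ^+ 2 * 2 = 4 / s ^+ 2 by rewrite mulrAC -natrM.
have -> // : 2 / s ^+ 2 * (8 * eta) + 8 * eta = e.
have <- : eta * K = e by rewrite /eta divfK// gt_eqF.
by rewrite /K; ring.
Unshelve. all: by end_near. Qed.

End spectral_stability.

(** * Error of the spectral method *)

Section spectral_error.
Context {R : realType}.
Variables (d : nat) (alpha : R) (M : nat -> nat).
Variable V : forall l, 'I_(M l) -> mpoly d R.
Hypothesis d_gt0 : (0 < d)%N.
Hypothesis alpha_gt0 : 0 < alpha.
Hypothesis HV : forall l, orthonormal_harmonic_basis l (@V l).
Implicit Types (p q : mpoly d R) (f g r u v : euclid R d -> R) (l n L N : nat).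
Local Notation ball := (@unit_ball R d).
Local Notation mu := (lebesgue R d).
Local Notation energy := (@energy R d alpha).
Local Notation ball_bounded g := (exists B : R, forall x, ball x -> `|g x| <= B).

Lemma ball_bounded_peval p : ball_bounded (peval p).
Proof.
have [W HW] := meval_bounded p; exists W => x /unit_ball_cube cx.
by apply: HW => i; rewrite ler_norml; exact: cx.
Qed.

Lemma ball_boundedM f g : ball_bounded f -> ball_bounded g ->
  ball_bounded (fun x => f x * g x).
Proof.
move=> [A HA] [B HB]; exists (A * B) => x Bx.
by rewrite normrM ler_pM ?HA ?HB.
Qed.

Lemma ball_boundedB f g : ball_bounded f -> ball_bounded g -> ball_bounded (f \- g).
Proof.
move=> [A HA] [B HB]; exists (A + B) => x Bx.
by rewrite (le_trans (ler_normB _ _))// lerD ?HA ?HB.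
Qed.

Lemma ball_bounded_weight : ball_bounded (weight alpha).
Proof. by exists 1 => x _; rewrite ger0_norm ?weight_ge0 ?weight_le1. Qed.

Definition pairing r p : R := \int[mu]_(x in ball) (r x * peval p x * weight alpha x).

Section pairing.
Variable r : euclid R d -> R.
Hypotheses (mr : measurable_fun ball r) (br : ball_bounded r).

Lemma pairing_integrable p :
  mu.-integrable ball (EFin \o (fun x => r x * peval p x * weight alpha x)).
Proof.
apply: ball_integrable.
  apply: measurable_funM; last by apply: measurable_funTS; exact: measurable_weight.
  by apply: measurable_funM => //; apply: measurable_funTS; exact: measurable_peval.
by apply: ball_boundedM ball_bounded_weight; apply: ball_boundedM br (ball_bounded_peval p).
Qed.

Lemma pairingD p q : pairing r (p + q) = pairing r p + pairing r q.
Proof.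
rewrite /pairing -RintegralD//; [|exact: measurable_unit_ball|exact: pairing_integrable..].
by apply: eq_Rintegral => x _; rewrite pevalD mulrDr mulrDl.
Qed.

Lemma pairingZ c p : pairing r (c *: p) = c * pairing r p.
Proof.
rewrite /pairing -RintegralZl//; [|exact: measurable_unit_ball|exact: pairing_integrable].
by apply: eq_Rintegral => x _; rewrite pevalZ; ring.
Qed.

Lemma pairing_sum I (s : seq I) (P : pred I) (F : I -> mpoly d R) :
  pairing r (\sum_(i <- s | P i) F i) = \sum_(i <- s | P i) pairing r (F i).
Proof.
apply: (big_morph _ pairingD); by rewrite -(scale0r 0) pairingZ mul0r.
Qed.

End pairing.

Lemma projection_orthogonal L N f g (c : forall l, 'I_(M l) -> nat -> R) :
  measurable_fun ball f -> ball_bounded f -> measurable_fun ball g ->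
  spectral_projection alpha V L N f g ->
  pairing (f \- g) (ball_sum alpha (harmonic_part V c) L N) = 0.
Proof.
move=> mf bf mg [[c' gE] orth].
have bg : ball_bounded g.
  have [B HB] := ball_bounded_peval (ball_sum alpha (harmonic_part V c') L N).
  by exists B => x Bx; rewrite gE// ball_poly_sumE; exact: HB.
have mr := measurable_funB mf mg; have br := ball_boundedB bf bg.
rewrite /ball_sum pairing_sum// big1// => l _; rewrite pairing_sum// big1// => n _.
rewrite /harmonic_part /ball_mpoly mulr_suml pairing_sum// big1// => m _.
rewrite -scalerAl pairingZ// -[X in c l m n * X](_ : 0 = _) ?mulr0//.
rewrite -(orth l m n); [|by rewrite -ltnS|by rewrite -ltnS].
apply: eq_Rintegral => x _.
by rewrite /ball_poly jacobi_polyE pevalM peval_radial.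
Qed.

Lemma energy_Rintegral g : measurable_fun ball g -> ball_bounded g ->
  mu.-integrable ball (EFin \o (fun x => `|g x| ^+ 2 * weight alpha x)) /\
  energy g = (\int[mu]_(x in ball) (`|g x| ^+ 2 * weight alpha x))%:E.
Proof.
move=> mg [B HB].
have I : mu.-integrable ball (EFin \o (fun x => `|g x| ^+ 2 * weight alpha x)).
  apply: ball_integrable; first exact: measurable_energy_density.
  apply: ball_boundedM ball_bounded_weight; exists (B ^+ 2) => x Bx.
  rewrite ger0_norm ?sqr_ge0// ler_pXn2r ?nnegrE ?HB//.
  exact: le_trans (HB _ Bx).
split => //; rewrite /Rintegral fineK//; apply: integrable_fin_num => //.
exact: measurable_unit_ball.
Qed.

(** An orthogonal projection is a best approximation: the error of any competitor
    differs from that of the projection by an element orthogonal to the latter. *)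
Lemma projection_best L N f g (c : forall l, 'I_(M l) -> nat -> R) :
  measurable_fun ball f -> ball_bounded f -> measurable_fun ball g ->
  spectral_projection alpha V L N f g ->
  (energy (g \- f)%R <= energy (ball_poly_sum alpha V c L N \- f)%R)%E.
Proof.
move=> mf bf mg pr; have [[c' gE] _] := pr.
pose p := ball_sum alpha (harmonic_part V c) L N.
pose p' := ball_sum alpha (harmonic_part V c') L N.
have bg : ball_bounded g.
  have [B HB] := ball_bounded_peval p'.
  by exists B => x Bx; rewrite gE// ball_poly_sumE; exact: HB.
have mq := @measurable_ball_poly_sum _ _ alpha _ V c L N.
have bq : ball_bounded (ball_poly_sum alpha V c L N).
  have [B HB] := ball_bounded_peval p.
  by exists B => x Bx; rewrite ball_poly_sumE; exact: HB.
have [I1 ->] := energy_Rintegral (measurable_funB mg mf) (ball_boundedB bg bf).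
have [I2 ->] := energy_Rintegral (measurable_funB mq mf) (ball_boundedB bq bf).
have mr := measurable_funB mf mg; have br := ball_boundedB bf bg.
have I3 := pairing_integrable mr br (2 *: (p - p')).
have z : pairing (f \- g) (2 *: (p - p')) = 0.
  rewrite pairingZ// -scaleN1r pairingD// pairingZ//.
  by rewrite !projection_orthogonal// mulr0 addr0 mulr0.
rewrite lee_fin -[leRHS]addr0 -[X in _ + X]z /pairing.
have mB := @measurable_unit_ball R d.
rewrite -(RintegralD mB I2 I3).
apply: le_Rintegral => //.
  have I4 := integrableD mB I2 I3.
  exact: (eq_integrable _ _ _ _ I4).
move=> x Bx; rewrite -mulrDl ler_wpM2r ?weight_ge0// !real_normK ?num_real//=.
rewrite pevalZ pevalB -!ball_poly_sumE -gE//.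
move: (f x) (g x) (ball_poly_sum _ _ _ _ _ x) => a b y.
rewrite -subr_ge0.
have -> : (y - a) ^+ 2 + (a - b) * (2 * (y - b)) - (b - a) ^+ 2 = (y - b) ^+ 2 by ring.
exact: sqr_ge0.
Qed.

Lemma energy_le_sup g (E : R) : measurable_fun ball g ->
  (forall x, ball x -> `|g x| <= E) ->
  (energy g <= (E ^+ 2)%:E * mu (@cube R d))%E.
Proof.
move=> mg gE; have mB := @measurable_unit_ball R d.
apply: (@le_trans _ _ (\int[mu]_(x in ball) (E ^+ 2)%:E)%E).
  apply: ge0_le_integral => //.
  - by move=> x _; exact: energy_density_ge0.
  - by apply/measurable_EFinP; exact: measurable_energy_density.
  - move=> x Bx; rewrite lee_fin -[leRHS]mulr1 ler_pM ?weight_ge0 ?weight_le1 ?sqr_ge0//.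
    by rewrite ler_pXn2r ?nnegrE ?gE// (le_trans _ (gE _ Bx)).
rewrite integral_cst// lee_pmul// ?lee_fin ?sqr_ge0//.
exact: lebesgue_unit_ball.
Qed.

(** As the weight is at most 1, w ^ 2 <= w, so that the unweighted norm of w g is
    at most the weighted norm of g. *)
Lemma normL2_weight_le g h (A : R) : 0 <= A -> measurable_fun ball g ->
  (forall x, ball x -> h x = weight alpha x * g x) ->
  (energy g <= (A ^+ 2)%:E)%E ->
  (normL2 ball (cst 1%R) h <= A%:E)%E.
Proof.
move=> A0 mg hE gA; have mB := @measurable_unit_ball R d.
have H : (\int[mu]_(x in ball) (`|h x| ^+ 2 * cst 1%R x)%:E <= (A ^+ 2)%:E)%E.
  apply: le_trans gA; apply: ge0_le_integral => //.
  - by move=> x _; rewrite lee_fin mulr1 sqr_ge0.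
  - apply/measurable_EFinP.
    apply: (eq_measurable_fun (fun x => (weight alpha x * g x) ^+ 2)).
      by move=> x; rewrite inE => Bx /=; rewrite mulr1 hE// real_normK ?num_real.
    apply: measurable_funX; apply: measurable_funM => //.
    by apply: measurable_funTS; exact: measurable_weight.
  - by apply/measurable_EFinP; exact: measurable_energy_density.
  - move=> x Bx; rewrite /= mulr1 hE// lee_fin normrM exprMn mulrC.
    rewrite ler_wpM2l ?sqr_ge0// ger0_norm ?weight_ge0// expr2.
    by rewrite ler_piMr ?weight_ge0 ?weight_le1.
rewrite /normL2.
have -> : A%:E = ((A ^+ 2)%:E `^ 2^-1)%E.
  by rewrite poweR_EFin -powR_mulrn// -powRrM divff ?powRr1.
apply: gt0_ler_poweR => //; rewrite in_itv /= leey andbT.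
- by apply: integral_ge0 => x _; rewrite lee_fin mulr1 sqr_ge0.
- by rewrite lee_fin sqr_ge0.
Qed.

(** The added 1 under the square root keeps the constant positive. *)
Lemma spectral_error K N L p (s E : R) f fNL u uNL :
  0 < s -> (forall l n, s <= Defs.eigenvalue d alpha l n) ->
  (K <= N)%N -> (K <= L)%N -> (msize p <= K.+1)%N ->
  (forall x : euclid R d, cube x -> `|f x - peval p x| <= E) ->
  spectral_projection alpha V L N f fNL ->
  solution_operator alpha V f u -> solution_operator alpha V fNL uNL ->
  (normL2 ball (cst 1%R) (uNL \- u)%R <=
    (2 / s * Num.sqrt (fine (mu (@cube R d)) + 1) * E)%:E)%E.
Proof.
move=> s0 sle KN KL pK fp pr [a [v [Ef Ev uE _]]] [b [vN [EfN EvN uNE _]]].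
have E0 : 0 <= E.
  have c0 : cube ([tuple 0 | i < d] : euclid R d) by move=> i; rewrite tnth_mktuple; lra.
  exact: le_trans (fp _ c0).
have mf := Ef.1; have mfN := EfN.1; have mv := Ev.1; have mvN := EvN.1.
have fpB x : ball x -> `|f x - peval p x| <= E by move/unit_ball_cube/fp.
have bf : ball_bounded f.
  have [B HB] := ball_bounded_peval p; exists (E + B) => x Bx.
  by rewrite -(subrK (peval p x) (f x)) (le_trans (ler_normD _ _))// lerD ?fpB ?HB.
have [Y HY pE] := ball_sum_span d_gt0 alpha_gt0 KN KL pK.
have [c cE] : exists c : forall l, 'I_(M l) -> nat -> R,
    forall l n, Y l n = harmonic_part V c l n.
  have ex l n : exists k : 'I_(M l) -> R, Y l n = \sum_(m < M l) k m *: @V l m.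
    by have [_ H _] := HV l; exact: H.
  exists (fun l m n => sval (cid (ex l n)) m) => l n.
  exact: svalP (cid (ex l n)).
have qE x : ball_poly_sum alpha V c L N x = peval p x.
  rewrite ball_poly_sumE pE; congr (peval _ x).
  by apply: eq_bigr => l _; apply: eq_bigr => n _; rewrite cE.
set m := fine _; have m0 : 0 <= m by exact: fine_ge0.
have mE : mu (@cube R d) = m%:E by rewrite fineK// ge0_fin_numE// lebesgue_cube.
apply: (@normL2_weight_le (vN \- v)).
- by rewrite mulr_ge0// mulr_ge0 ?sqrtr_ge0// divr_ge0// ltW.
- exact: measurable_funB.
- by move=> x Bx /=; rewrite uNE// uE// mulrBr.
apply: (le_trans (expansion_stable alpha_gt0 HV s0 sle Ef EfN Ev EvN)).
have H1 : (energy (fNL \- f)%R <= (E ^+ 2 * m)%:E)%E.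
  apply: le_trans (projection_best c mf bf mfN pr) _.
  rewrite EFinM -mE; apply: energy_le_sup.
    by apply: measurable_funB => //; exact: measurable_ball_poly_sum.
  by move=> x Bx /=; rewrite qE distrC fpB.
have s2 : 0 < 4 / s ^+ 2 by rewrite divr_gt0// exprn_gt0.
apply: (@le_trans _ _ ((4 / s ^+ 2)%:E * (E ^+ 2 * m)%:E)%E).
  by rewrite lee_pmul2l.
rewrite -EFinM lee_fin !exprMn exprVn sqr_sqrtr; last by rewrite addr_ge0.
have -> : 2 ^+ 2 / s ^+ 2 * (m + 1) * E ^+ 2 =
  4 / s ^+ 2 * (E ^+ 2 * m) + 4 / s ^+ 2 * E ^+ 2 by ring.
by rewrite lerDl mulr_ge0 ?sqr_ge0// ltW.
Qed.

End spectral_error.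

Theorem theorem6 (R : realType) (d : nat) (alpha : R) (M : nat -> nat)
    (V : forall l : nat, 'I_(M l) -> mpoly d R) :
  d = 2%N \/ d = 3%N ->
  0 < alpha < 2 ->
  (forall l : nat, orthonormal_harmonic_basis l (V l)) ->
  exists2 C : R, 0 < C &
    forall (rho : R) (f : euclid R d -> R) (F : d.-tuple R[i] -> R[i])
      (K N L : nat) (fNL u uNL : euclid R d -> R),
    1 < rho ->
    bounded_analytic_extension rho F f ->
    (K <= N)%N -> (2 * K <= L)%N ->
    spectral_projection alpha V L N f fNL ->
    solution_operator alpha V f u ->
    solution_operator alpha V fNL uNL ->
    (normL2 unit_ball (cst 1%R) (uNL \- u)%R <=
      (C * (rho ^- (K %/ d) / ((rho - 1) * (1 - rho^-1) ^+ (d - 1)))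
         * sup_norm rho F)%:E)%E.
Proof.
move=> d23 /andP[a0 a2] HV; have d1 : (1 < d)%N by case: d23 => ->.
have d0 : (0 < d)%N := ltnW d1.
have [s s0 sle] := eigenvalue_lower_bound d1 a0.
pose m := fine (lebesgue R d (@cube R d)); have m0 : 0 <= m by exact: fine_ge0.
pose A := 2 / s * Num.sqrt (m + 1).
have A0 : 0 < A by rewrite mulr_gt0 ?divr_gt0// sqrtr_gt0 ltr_wpDl.
exists (A * (d%:R * 2 ^+ d)); first by rewrite mulr_gt0// mulr_gt0 ?ltr0n// exprn_gt0.
move=> rho f F K N L fNL u uNL rho1 Ff KN KL pr su suN.
set Q := _ / (_ * _); apply/lee_addgt0Pr => e e0.
have [p [pK fp]] := polynomial_approx (K %/ d) d0 rho1 Ff (divr_gt0 e0 A0).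
have pK1 : (msize p <= K.+1)%N.
  by apply: leq_trans pK _; rewrite ltnS mulnC leq_trunc_div.
have KL1 : (K <= L)%N by lia.
apply: le_trans (spectral_error d0 a0 HV s0 sle KN KL1 pK1 fp pr su suN) _.
rewrite -EFinD lee_fin -/m -/A -/Q mulrDr [A * (e / A)]mulrC divfK ?gt_eqF//.
rewrite lerD2r le_eqVlt; apply/orP; left; apply/eqP.
by move: (sup_norm rho F) (2 ^+ d) (d%:R : R) => x y z; ring.
Qed.
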